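(* Let $\nu$ be a L\'evy measure on $\mathbb{R}^d$ that is symmetric, i.e. $\nu(D)=\nu(-D)$ for every Borel set $D\subset\mathbb{R}^d$, with $\nu(\mathbb{R}^d)=\infty$. Assume that for a set $T\subset(0,\infty)$ and a constant $M_3>0$, $$\int_{\mathbb{R}^d}e^{-t\operatorname{Re}\Phi(\xi)}|\xi|\,d\xi\le M_3\,(h(t))^{-d-1}\quad\text{for all }t\in T,$$ and that there is a constant $M_4>0$ such that $$\nu(B(x,r))\ge M_4\, r^{\gamma} f(|x|+r),\quad x\in A,\ r>0,$$ for some Borel set $A\subset\mathbb{R}^d$, some $\gamma\in[0,d]$ and some function $f:(0,\infty)\to[0,\infty)$. Then there exist constants $C_4$, $C_5$ and $C_6>C_5$ such that $$p_t(x+tb)\ge C_4 (h(t))^{-d}\quad\text{for } |x|<C_6h(t),\ t\in T,$$ $$p_t(x+tb)\ge C_4\, t\,[h(t)]^{\gamma-d} f(|x|+C_5h(t))\quad\text{for } |x|\ge C_6h(t),\ x\in A,\ t\in T.$$ In particular, $$p_t(x+tb)\ge C_4 (h(t))^{-d}\min\Big\{1,\ t[h(t)]^{\gamma} f\big(\min\{|x|+C_5h(t),\,2|x|\}\big)\Big\},\quad x\in A,\ t\in T$$ (where, if $0\in A$, for $x=0$ the expression is read with an arbitrary value $f(0)\in[0,\infty]$).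
   Context: Let $d\ge1$ be an integer and $b\in\mathbb{R}^d$. A L\'evy measure on $\mathbb{R}^d$ is a Borel measure $\nu$ (with $\nu(\{0\})=0$) such that $\int(1\wedge|y|^2)\,\nu(dy)<\infty$. Write $\xi\cdot y$ for the scalar product, $B(x,r)=\{y:|y-x|<r\}$. $\{P_t,\ t\ge0\}$ is the convolution semigroup of probability measures on $\mathbb{R}^d$ with $\int e^{i\xi\cdot y}P_t(dy)=e^{-t\Phi(\xi)}$, where $$\Phi(\xi)=-\int\big(e^{i\xi\cdot y}-1-i\,\xi\cdot y\,\mathbf 1_{B(0,1)}(y)\big)\nu(dy)-i\,\xi\cdot b .$$ Set $\Psi(r)=\sup_{|\xi|\le r}\operatorname{Re}\Phi(\xi)$ for $r>0$; since $\nu(\mathbb{R}^d)=\infty$, $\Psi$ is continuous, nondecreasing and unbounded. Set $\Psi^{-1}(s)=\sup\{r>0:\Psi(r)=s\}$ for $s>0$, and $h(t)=1/\Psi^{-1}(1/t)$ for $t>0$. The integrability assumption implies that for $t\in T$ the measure $P_t$ has a density in $C_b^1(\mathbb{R}^d)$, denoted $p_t$. Constants are finite and positive and do not depend on $x$ or $t$. *)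

(* Defs.v *)
From HB Require Import structures.
From mathcomp Require Import all_boot all_order all_algebra.
From mathcomp Require Import complex.
From mathcomp Require Import all_classical all_reals all_analysis.
From mathcomp Require Import measurable_realfun.

Set Implicit Arguments.
Unset Strict Implicit.
Unset Printing Implicit Defensive.

Import Order.TTheory GRing.Theory Num.Theory.
Import numFieldNormedType.Exports.

Local Open Scope classical_set_scope.
Local Open Scope ring_scope.

(** The Borel sigma-algebra on [R^n]. The topology that the library puts on
    ['rV[R]_n] comes from the max norm; it is the Euclidean one. *)
Section borel.
Variables (R : realType) (n : nat).

HB.instance Definition _ :=
  @isMeasurable.Build (sigma_display (@open 'rV[R]_n)) 'rV[R]_n
    <<s @open 'rV[R]_n >> (@sigma_algebra0 _ setT _) (@sigma_algebraC _ _)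
    (@sigma_algebra_bigcup _ setT _).

End borel.

Section borel_theory.
Variables (R : realType) (n : nat).

Lemma open_measurable_rV (U : set 'rV[R]_n) : open U -> measurable U.
Proof. exact: sub_sigma_algebra. Qed.

Lemma measurable_coord (i : 'I_n) :
  measurable_fun [set: 'rV[R]_n] (fun v : 'rV[R]_n => v ord0 i).
Proof.
apply: (measurability _ (RGenOpens.measurableE R)).
move=> _ [_ [a [b ->] <-]]; rewrite setTI; apply: open_measurable_rV.
by apply: open_comp; [move=> x _; exact: coord_continuous|exact: interval_open].
Qed.

Lemma measurable_rowP d (T : measurableType d) (f : T -> 'rV[R]_n) :
  (forall i, measurable_fun [set: T] (fun x => f x ord0 i)) ->
  measurable_fun [set: T] f.
Proof.
move=> mf.
apply: (@measurability _ _ _ _ _ _ (@open 'rV[R]_n)) => // _ [U oU <-].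
rewrite setTI.
pose B (q : 'rV[rat]_n * rat) : set 'rV[R]_n :=
  [set v | forall i, `|v ord0 i - ratr (q.1 ord0 i)| < ratr q.2].
have -> : f @^-1` U =
    \bigcup_(q in [set q | B q `<=` U]) (f @^-1` B q).
  apply/seteqP; split=> [x Ufx|x [q /= sqU] /sqU //].
  have /nbhs_ballP[e /= e0 eU] : nbhs (f x) U.
    by apply: open_nbhs_nbhs; split.
  have [r] : exists r, ratr r \in `]0, e / 2[%R.
    by apply: rat_in_itvoo; rewrite divr_gt0.
  rewrite in_itv/= => /andP[r0 re].
  have qP (i : 'I_n) : exists s : rat,
      ratr s \in `](f x ord0 i - ratr r), (f x ord0 i + ratr r)[%R.
    by apply: rat_in_itvoo; rewrite ltrBlDr -addrA ltrDl addr_gt0.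
  have [q qE] := choice qP.
  exists (\row_i q i, r) => /=; last first.
    move=> i; rewrite mxE ltr_distlC.
    by have := qE i; rewrite in_itv.
  move=> v /= Bv; apply: eU; split=> // i j; rewrite ord1 /ball/=.
  have := Bv j; rewrite mxE => vq.
  have := qE j; rewrite in_itv/= -ltr_distlC => fq.
  rewrite (le_lt_trans (ler_distD (ratr (q j)) _ _))//.
  by rewrite [ltRHS](splitr e) ltrD// ?(lt_trans fq)// distrC (lt_trans vq).
rewrite bigcup_mkcond; apply: countable_bigcupT_measurable => [|q].
  exact: countableP.
case: ifPn => // _.
rewrite (_ : _ @^-1` _ = \bigcap_(i in [set: 'I_n])
   (fun x => f x ord0 i) @^-1`
     `](ratr (q.1 ord0 i) - ratr q.2), (ratr (q.1 ord0 i) + ratr q.2)[); last first.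
  apply/seteqP; split=> [x Bx i _|x Bx i] /=.
    by rewrite in_itv/= -ltr_distl; exact: Bx.
  by have := Bx i I; rewrite /= in_itv/= -ltr_distl.
apply: fin_bigcap_measurable; first exact: finite_finset.
by move=> i _; rewrite -[X in measurable X]setTI; exact: mf.
Qed.

End borel_theory.

Section lebesgue.
Variable R : realType.
Notation lambda := (@lebesgue_measure R).

Definition cons_rV n (x : R) (v : 'rV[R]_n) : 'rV[R]_n.+1 :=
  \row_i oapp (v ord0) x (unlift ord0 i).

Definition rV_of_pair n (p : measurableTypeR R * 'rV[R]_n) := cons_rV p.1 p.2.
Definition pair_of_rV n (v : 'rV[R]_n.+1) : measurableTypeR R * 'rV[R]_n :=
  (v ord0 ord0, \row_j v ord0 (lift ord0 j)).

Lemma rV_of_pairK n : cancel (@rV_of_pair n) (@pair_of_rV n).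
Proof.
move=> [x v]; congr (_, _); first by rewrite mxE unlift_none.
by apply/rowP => j; rewrite !mxE liftK.
Qed.

Lemma pair_of_rVK n : cancel (@pair_of_rV n) (@rV_of_pair n).
Proof.
move=> v; apply/rowP => i; rewrite mxE.
by case: unliftP => [j ->|->] //=; rewrite mxE.
Qed.

Lemma measurable_rV_of_pair n : measurable_fun [set: measurableTypeR R * 'rV[R]_n] (@rV_of_pair n).
Proof.
apply: measurable_rowP => i; case: (unliftP ord0 i) => [j ->|->].
  rewrite (_ : (fun _ => _) =
      (fun v : 'rV[R]_n => v ord0 j) \o snd); last first.
    by apply/funext => p; rewrite mxE liftK.
  by apply: measurableT_comp => //; exact: measurable_coord.
rewrite (_ : (fun _ => _) = fst) //.
by apply/funext => p; rewrite mxE unlift_none.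
Qed.

Lemma measurable_pair_of_rV n : measurable_fun [set: 'rV[R]_n.+1]
  (@pair_of_rV n).
Proof.
apply/measurable_fun_pairP; split; first exact: measurable_coord.
apply: measurable_rowP => j.
rewrite (_ : (fun _ => _) = (fun v : 'rV[R]_n.+1 => v ord0 (lift ord0 j))).
  exact: measurable_coord.
by apply/funext => v; rewrite mxE.
Qed.

Section step.
Variables (n : nat) (mu : {sigma_finite_measure set 'rV[R]_n -> \bar R}).

Definition lebesgue_step (A : set 'rV[R]_n.+1) : \bar R :=
  (\int[lambda]_x mu [set v | A (cons_rV x v)])%E.

Lemma lebesgue_stepE : lebesgue_step = pushforward (lambda \x mu)%E (@rV_of_pair n).
Proof.
apply/funext => A; apply: eq_integral => x _ /=.
by congr (mu _); apply/seteqP; split=> v; rewrite /xsection/= inE.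
Qed.

Lemma measurable_preimage_rV_of_pair (A : set 'rV[R]_n.+1) :
  measurable A -> measurable (@rV_of_pair n @^-1` A).
Proof.
by move=> mA; rewrite -[X in measurable X]setTI; exact: measurable_rV_of_pair.
Qed.

Lemma lebesgue_step0 : lebesgue_step set0 = 0%E.
Proof. by rewrite lebesgue_stepE /pushforward preimage_set0 measure0. Qed.

Lemma lebesgue_step_ge0 A : (0 <= lebesgue_step A)%E.
Proof. by rewrite lebesgue_stepE /pushforward measure_ge0. Qed.

Lemma lebesgue_step_sigma_additive : semi_sigma_additive lebesgue_step.
Proof.
move=> F mF tF mUF; rewrite lebesgue_stepE /pushforward preimage_bigcup.
apply: measure_semi_sigma_additive.
- by move=> i; exact: measurable_preimage_rV_of_pair.
- apply/trivIsetP => /= i j _ _ ij; rewrite -preimage_setI.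
  by move/trivIsetP : tF => /(_ _ _ _ _ ij) ->//; rewrite preimage_set0.
- by rewrite -preimage_bigcup; exact: measurable_preimage_rV_of_pair.
Qed.

HB.instance Definition _ := isMeasure.Build _ _ _ lebesgue_step
  lebesgue_step0 lebesgue_step_ge0 lebesgue_step_sigma_additive.

Lemma lebesgue_step_sigma_finite : sigma_finite setT lebesgue_step.
Proof.
have /sigma_finiteP[F [TF ndF Foo]] := sigma_finiteT lambda.
have /sigma_finiteP[G [TG ndG Goo]] := sigma_finiteT mu.
exists (fun k => @pair_of_rV n @^-1` (F k `*` G k)).
  apply/esym/seteqP; split=> // v _.
  have [i _ Fi] : (\bigcup_i F i) (@pair_of_rV n v).1 by rewrite -TF.
  have [k _ Gk] : (\bigcup_k G k) (@pair_of_rV n v).2 by rewrite -TG.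
  exists (maxn i k) => //; split.
    by move: Fi; apply/subsetPset/ndF/leq_maxl.
  by move: Gk; apply/subsetPset/ndG/leq_maxr.
move=> k; have [mF Fk] := Foo k; have [mG Gk] := Goo k; split.
  rewrite -[X in measurable X]setTI; apply: measurable_pair_of_rV => //.
  exact: measurableX.
rewrite lebesgue_stepE /pushforward -comp_preimage.
rewrite (_ : _ \o _ = id); last by apply/funext => p; exact: rV_of_pairK.
rewrite preimage_id [ltLHS]product_measure1E//.
by rewrite lte_mul_pinfty// ge0_fin_numE.
Qed.

HB.instance Definition _ := Measure_isSigmaFinite.Build _ _ _ lebesgue_step
  lebesgue_step_sigma_finite.

End step.

(** Lebesgue measure on [R^n], by Tonelli: the first coordinate is integrated
    out last, and [R^0] is a single point of mass 1. *)
Fixpoint lebesgue_rV n : {sigma_finite_measure set 'rV[R]_n -> \bar R} :=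
  match n with
  | 0 => \d_(0 : 'rV[R]_0)
  | m.+1 => lebesgue_step (lebesgue_rV m)
  end.

Lemma lebesgue_rV_box n (a b : 'rV[R]_n) : (forall i, a ord0 i <= b ord0 i) ->
  lebesgue_rV n [set v | forall i, v ord0 i \in `[a ord0 i, b ord0 i]] =
  (\prod_(i < n) (b ord0 i - a ord0 i))%:E.
Proof.
elim: n a b => [|n IHn] a b ab.
  rewrite big_ord0 [LHS]diracE.
  by rewrite mem_set// => i; have := ltn_ord i.
rewrite big_ord_recl EFinM.
pose tl (c : 'rV[R]_n.+1) : 'rV[R]_n := \row_j c ord0 (lift ord0 j).
pose B : set 'rV[R]_n :=
  [set v | forall i, v ord0 i \in `[tl a ord0 i, tl b ord0 i]].
have BE : lebesgue_rV n B =
    (\prod_(i < n) (b ord0 (lift ord0 i) - a ord0 (lift ord0 i)))%:E.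
  rewrite IHn; last by move=> i; rewrite !mxE.
  by congr EFin; apply: eq_bigr => i _; rewrite !mxE.
rewrite -BE -[LHS]/(\int[lambda]_x lebesgue_rV n [set v | forall i,
  cons_rV x v ord0 i \in `[a ord0 i, b ord0 i]])%E.
under eq_integral => x _.
  rewrite (_ : lebesgue_rV n _ =
      ((\1_(`[a ord0 ord0, b ord0 ord0]) x)%:E * lebesgue_rV n B)%E); last first.
    rewrite indicE; case: (boolP (x \in _)) => xab.
      rewrite mul1e; congr (lebesgue_rV n _); apply/seteqP; split=> v /= Bv i.
        by have := Bv (lift ord0 i); rewrite !mxE liftK.
      case: (unliftP ord0 i) => [j ->|->]; rewrite mxE.
        by have := Bv j; rewrite !mxE liftK.
      by rewrite unlift_none/=; move: xab; rewrite inE.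
    rewrite mul0e (_ : [set v | _] = set0) ?measure0//.
    apply/seteqP; split=> v //= /(_ ord0); rewrite mxE unlift_none/= => xin.
    by move: xab; rewrite notin_setE.
  over.
rewrite ge0_integralZr//; last first.
  by apply/measurable_EFinP; exact: measurable_indic.
rewrite integral_indic// setIT; congr (_ * _)%E.
rewrite [LHS](lebesgue_measure_itv `[a ord0 ord0, b ord0 ord0])/= lte_fin.
case: ltP => [//|ba]; congr EFin; apply/esym/eqP.
by rewrite subr_eq0 eq_le ba ab.
Qed.

End lebesgue.
Arguments lebesgue_rV : simpl never.

Section euclidean.
Variables (R : realType) (d : nat).
Implicit Types x y : 'rV[R]_d.

Definition dot x y : R := \sum_(i < d) x ord0 i * y ord0 i.

(** The library norm [`|x|] on ['rV[R]_d] is the max norm. *)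
Definition enorm x : R := Num.sqrt (dot x x).

Definition eball x (r : R) : set 'rV[R]_d := [set y | enorm (y - x) < r].

End euclidean.

Definition cexp (R : realType) (z : R[i]) : R[i] :=
  ((expR (complex.Re z) * cos (complex.Im z)) +i*
   (expR (complex.Re z) * sin (complex.Im z)))%C.

(** Componentwise; [\int] here is the real-valued integral [Rintegral]. *)
Definition cintegral (R : realType) (disp : measure_display)
    (T : measurableType disp) (mu : {measure set T -> \bar R}) (f : T -> R[i]) : R[i] :=
  ((\int[mu]_x complex.Re (f x))%R +i* (\int[mu]_x complex.Im (f x))%R)%C.

Section levy.
Variables (R : realType) (d : nat).
Notation Rd := 'rV[R]_d.

Definition levy_measure (nu : {measure set Rd -> \bar R}) : Prop :=
  nu [set 0] = 0%E /\
  (\int[nu]_y (Num.min 1 (enorm y ^+ 2))%:E < +oo)%E.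

Definition symmetric_measure (nu : {measure set Rd -> \bar R}) : Prop :=
  forall D : set Rd, measurable D -> nu D = nu [set - y | y in D].

Section exponent.
Variables (nu : {measure set Rd -> \bar R}) (b : Rd).

(** [Phi], the characteristic exponent with triplet [(b, 0, nu)]. *)
Definition levy_exponent (xi : Rd) : R[i] :=
  - cintegral nu (fun y =>
      cexp ('i%C * (dot xi y)%:C%C) - 1
      - 'i%C * (dot xi y)%:C%C * (\1_(eball 0 1) y)%:C%C)
  - 'i%C * (dot xi b)%:C%C.

(** [sup] is the real supremum, which is [0] on sets that are empty or not
    bounded above. For [r, s > 0] and an infinite Levy measure [nu] the sets
    below are nonempty and bounded, so that this case does not arise. *)
Definition levy_Psi (r : R) : R :=
  sup [set complex.Re (levy_exponent xi) | xi in [set xi | enorm xi <= r]].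

Definition levy_Psi_inv (s : R) : R :=
  sup [set r | 0 < r /\ levy_Psi r = s].

Definition levy_h (t : R) : R := (levy_Psi_inv t^-1)^-1.

End exponent.

Definition convolution (mu1 mu2 : set Rd -> \bar R) (B : set Rd) : \bar R :=
  (\int[mu1]_x mu2 [set y | B (x + y)%R])%E.

(** Only the times [t >= 0] are constrained. *)
Definition convolution_semigroup (P : R -> probability Rd R) : Prop :=
  [/\ forall B : set Rd, measurable B -> P 0 B = \d_(0 : Rd) B,
      forall s t, 0 <= s -> 0 <= t -> forall B : set Rd, measurable B ->
        P (s + t) B = convolution (P s) (P t) B &
      forall g : Rd -> R, continuous g -> (exists M, forall x, `|g x| <= M) ->
        (\int[P t]_x g x) @[t --> 0^'+] --> g 0].

Definition levy_semigroup (nu : {measure set Rd -> \bar R}) (b : Rd)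
    (P : R -> probability Rd R) : Prop :=
  convolution_semigroup P /\
  forall (t : R) (xi : Rd), 0 <= t ->
    cintegral (P t) (fun y => cexp ('i%C * (dot xi y)%:C%C)) =
    cexp (- (t%:C%C * levy_exponent nu b xi)).

(** [C_b^1(R^d)]: continuous and bounded together with the first-order partial
    derivatives. *)
Definition Cb1 (q : Rd -> R) : Prop :=
  [/\ forall x, differentiable q x,
      forall i : 'I_d, continuous (fun x => 'D_(delta_mx ord0 i) q x),
      exists M, forall x, `|q x| <= M &
      exists M, forall x (i : 'I_d), `|'D_(delta_mx ord0 i) q x| <= M].

Definition is_Cb1_density (mu : set Rd -> \bar R) (q : Rd -> R) : Prop :=
  [/\ Cb1 q, forall x, 0 <= q x &
      forall B : set Rd, measurable B ->
        mu B = (\int[lebesgue_rV R d]_(x in B) (q x)%:E)%E].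

(** The density of [mu] that lies in [C_b^1(R^d)]; two continuous densities of
    the same measure coincide, so there is at most one. If there is none, the
    value is that of [get] on the empty set and carries no information. *)
Definition density (mu : set Rd -> \bar R) : Rd -> R :=
  get [set q : Rd -> R | is_Cb1_density mu q].

End levy.

(** [f], given on [(0, +oo)], completed by the value [f0] at [0]. *)
Definition extend0 (R : realType) (f : R -> R) (f0 : \bar R) (s : R) : \bar R :=
  if s == 0 then f0 else (f s)%:E.

(* Main.v *)
Require Import Defs.
From HB Require Import structures.
From mathcomp Require Import all_boot all_order all_algebra.
From mathcomp Require Import complex.
From mathcomp Require Import all_classical all_reals all_analysis.
From mathcomp Require Import measurable_realfun.
From mathcomp Require Import ring lra.
Import Order.TTheory GRing.Theory Num.Theory.
Import numFieldNormedType.Exports.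
Local Open Scope classical_set_scope.
Local Open Scope ring_scope.


(* Write G u z for the integral of u(xi) cos(xi . z). By symmetry the exponent is
   psi(xi) - i xi . b with psi(xi) the integral of 1 - cos(xi . y) against nu, so Fourier
   inversion gives p_t(x + t b) = (2 pi)^-d G(exp(-t psi))(x) and everything can be read
   off on the Fourier side. Near 0: G u is largest at 0, where it is at least the integral
   of u over a box of side of order 1 / h, and its Lipschitz constant is at most M3 h^-d-1.
   Far from 0: let m be the cosine transform and lam the mass of nu restricted to
   |y| >= a h, so that t lam is bounded, and let u be exp(-t psi') with psi' the exponent
   of the jumps |y| < a h. Then exp(-t psi) = exp(-t lam) u exp(t m). As u and m are
   transforms of nonnegative measures, G(u exp(t m)) >= t G(u m), which is t times the
   average of G u (x - y) over the large jumps y; the near estimate applies to u, and the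
   jumps in the ball of radius C5 h around x contribute the bound. Nonnegativity of G u, as
   well as the inversion formula, is obtained by damping with the product of the
   exp(-s |xi_i|), whose transform is a product of Poisson kernels. *)

Set Implicit Arguments.
Unset Strict Implicit.
Unset Printing Implicit Defensive.

(** * Real-valued integrals *)

(** No process with exponent psi' is constructed, so the sign of G u cannot be read off a density:
    the smallest jumps are cut away to reach a finite measure, where the exponential series applies,
    and the cut is removed while the damping is still on. The damping is exp(-s |xi_i|) and not
    Gaussian because all stays explicit: the kernel 2 s / (s^2 + x^2) has primitive 2 atan(x / s),
    and inversion over a box becomes a limit of arctangents. That t lam is bounded comes from
    integrating psi(v e_i) over 0 <= v <= s, with s of order 1 / h: a jump of length at least a h
    contributes at least s / 2 in some coordinate, while psi <= 1 / t below 1 / h, and psi(2 xi) <=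
    4 psi(xi) carries this on to multiples of 1 / h. The constants are chosen without circularity:
    k1, the near radius of exp(-t psi) in units of h; a = k1 / 2; then the bound L of t lam; then
    k2, the near radius of u, which depends on L; then C5 < k2. The ball around x must avoid |y| < a
    h, so the far estimate starts at C6 = a + C5, and C6 <= k1 makes the two regimes meet. *)

Section Rintegral_toolkit.
Context d (T : measurableType d) (R : realType) (mu : {measure set T -> \bar R}).
Implicit Types f g : T -> R.

Lemma integrable_dominated f g : measurable_fun [set: T] f ->
  (forall x, `|f x| <= g x) -> mu.-integrable [set: T] (EFin \o g) ->
  mu.-integrable [set: T] (EFin \o f).
Proof.
move=> mf fg; apply: le_integrable => //; first exact/measurable_EFinP.
move=> x _ /=; rewrite lee_fin (le_trans (fg x))//; exact: ler_norm.
Qed.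

Lemma integrable_cmul c f : mu.-integrable [set: T] (EFin \o f) ->
  mu.-integrable [set: T] (EFin \o (fun x => c * f x)).
Proof. by move=> fi; exact: (integrableZl measurableT c fi). Qed.

Lemma EFin_Rintegral f : mu.-integrable [set: T] (EFin \o f) ->
  ((\int[mu]_x f x)%R)%:E = (\int[mu]_x (f x)%:E)%E.
Proof. by move=> fi; rewrite /Rintegral fineK//; exact: integrable_fin_num. Qed.

Lemma Rintegral_dct (f_ : nat -> T -> R) f g :
  (forall n, measurable_fun [set: T] (f_ n)) ->
  (forall x, f_ ^~ x @ \oo --> f x) ->
  (forall n x, `|f_ n x| <= g x) ->
  mu.-integrable [set: T] (EFin \o g) ->
  mu.-integrable [set: T] (EFin \o f) /\
  (fun n => \int[mu]_x f_ n x) @ \oo --> \int[mu]_x f x.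
Proof.
move=> mf_ f_f f_g ig.
have mf : measurable_fun [set: T] f.
  by apply: (measurable_fun_cvg mf_) => x _; exact: f_f.
have [] := @dominated_convergence _ T R mu setT measurableT
  (fun n x => (f_ n x)%:E) (EFin \o f) (EFin \o g).
- by move=> n; exact/measurable_EFinP.
- exact/measurable_EFinP.
- by apply: aeW => x _; apply: cvg_EFin; [exact: nearW|exact: f_f].
- by [].
- by apply: aeW => x n _; rewrite lee_fin.
move=> fi _ cv; split=> //.
by apply: fine_cvg; rewrite EFin_Rintegral.
Qed.

End Rintegral_toolkit.

(** * Exchange of integrals for a bounded kernel *)

Section Rintegral_Fubini.
Context d1 d2 (X : measurableType d1) (Y : measurableType d2) (R : realType).
Variables (m1 : {sigma_finite_measure set X -> \bar R}).
Variables (m2 : {finite_measure set Y -> \bar R}).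

Lemma integrable_bounded (g : Y -> R) (C : R) : measurable_fun [set: Y] g ->
  (forall y, `|g y| <= C) -> m2.-integrable [set: Y] (EFin \o g).
Proof.
move=> mg gC; apply: (integrable_dominated mg gC).
by apply: finite_measure_integrable_cst.
Qed.

Variables (u : X -> R) (k : X * Y -> R) (C : R).
Hypotheses (iu : m1.-integrable [set: X] (EFin \o u))
  (mk : measurable_fun [set: X * Y] k) (kC : forall p, `|k p| <= C).

Let mu : measurable_fun [set: X] u.
Proof. by apply/measurable_EFinP; case/integrableP: iu. Qed.

Let mky x : measurable_fun [set: Y] (fun y => k (x, y)).
Proof. by apply: measurableT_comp mk _; exact: pair1_measurable. Qed.

Let mkx y : measurable_fun [set: X] (fun x => k (x, y)).
Proof. by apply: measurableT_comp mk _; exact: pair2_measurable. Qed.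

Let iky x : m2.-integrable [set: Y] (fun y => (k (x, y))%:E).
Proof. by apply: (@integrable_bounded _ C). Qed.

Lemma integrable_mul_bounded (g : X -> R) (D : R) : measurable_fun [set: X] g ->
  (forall x, `|g x| <= D) -> m1.-integrable [set: X] (fun x => (u x * g x)%:E).
Proof.
move=> mg gD.
apply: (@integrable_dominated _ _ _ m1 _ (fun x => D * `|u x|)).
- exact: measurable_funM.
- by move=> x; rewrite normrM mulrC ler_wpM2r.
- by apply: integrable_cmul; exact: (integrable_norm iu).
Qed.

Let iukx y : m1.-integrable [set: X] (fun x => (u x * k (x, y))%:E).
Proof. by apply: (@integrable_mul_bounded _ C). Qed.

Lemma normr_Rintegral_mul y :
  `|\int[m1]_x (u x * k (x, y))| <= C * \int[m1]_x `|u x|.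
Proof.
apply: (le_trans (le_normr_Rintegral measurableT (iukx y))).
rewrite -RintegralZl//; last exact: (integrable_norm iu).
apply: le_Rintegral => //.
- exact: (integrable_norm (iukx y)).
- by apply: integrable_cmul; exact: (integrable_norm iu).
- by move=> x _; rewrite normrM mulrC ler_wpM2r.
Qed.

Let f (p : X * Y) : \bar R := (u p.1 * k p)%:E.

Let mf : measurable_fun [set: X * Y] f.
Proof.
apply/measurable_EFinP; apply: measurable_funM => //.
exact: measurableT_comp.
Qed.

Let fi : (m1 \x m2)%E.-integrable [set: X * Y] f.
Proof.
apply/(integrable12ltyP m1 m2 mf).
have iD : m1.-integrable [set: X] (fun x => (C * fine (m2 setT) * `|u x|)%:E).
  by apply: integrable_cmul; exact: (integrable_norm iu).
have /integrableP[mD] := iD; apply: le_lt_trans.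
apply: ge0_le_integral => //.
- by move=> x _; apply: integral_ge0.
- apply: (@measurable_fun_fubini_tonelli_F _ _ _ _ _ m2 (abse \o f)) => //.
  + exact: measurableT_comp.
  + by move=> p; exact: abse_ge0.
- by apply: measurableT_comp mD.
- move=> x _; apply: (@le_trans _ _ (\int[m2]_y (C * `|u x|)%:E)%E).
    apply: ge0_le_integral => //.
    + apply: measurableT_comp => //; apply/measurable_EFinP.
      by apply: (measurable_funM (f := cst (u x)) (g := fun y => k (x, y))).
    + by move=> y _; rewrite lee_fin normrM mulrC ler_wpM2r.
  rewrite integral_cst//.
  apply: (@le_trans _ _ ((C * `|u x|)%:E * (fine (m2 setT))%:E)%E).
    by rewrite fineK// fin_num_measure.
  by rewrite -EFinM lee_fin mulrAC ler_norm.
Qed.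

(** Adding [C] makes the kernel nonnegative, so that measurability follows from Tonelli; the
    constant [C * fine (m2 setT)] is then taken off again. *)
Lemma measurable_Rintegral1 :
  measurable_fun [set: X] (fun x => \int[m2]_y k (x, y)).
Proof.
have mkC : measurable_fun [set: X * Y] (fun p => (k p + C)%:E).
  by apply/measurable_EFinP; exact: measurable_funD.
have kC0 p : (0 <= (k p + C)%:E)%E.
  by rewrite lee_fin -lerBlDr sub0r; have := kC p; rewrite ler_norml => /andP[].
have iC : m2.-integrable [set: Y] (EFin \o cst C).
  exact: finite_measure_integrable_cst.
rewrite (_ : (fun x => _) = fun x =>
    fine (\int[m2]_y (k (x, y) + C)%:E)%E - C * fine (m2 setT)); last first.
  apply/funext => x; rewrite -/(Rintegral m2 setT (fun y => k (x, y) + C)).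
  by rewrite RintegralD//; [rewrite Rintegral_cst// addrK|exact: iky].
apply: measurable_funB => //; apply: measurableT_comp => //.
exact: (@measurable_fun_fubini_tonelli_F _ _ X Y R m2 _ mkC kC0).
Qed.

Lemma measurable_Rintegral2 :
  measurable_fun [set: Y] (fun y => \int[m1]_x (u x * k (x, y))).
Proof.
apply/measurable_EFinP.
rewrite (_ : _ \o _ = fun y => (\int[m1]_x f (x, y))%E).
  exact: (measurable_fubini_G fi).
apply/funext => y /=; rewrite EFin_Rintegral//; exact: iukx.
Qed.

(** Absolute integrability holds because an integrable weight meets a bounded kernel and a finite
    measure. It serves for [laplace_rV] against [P], for a box against the Poisson kernel, and for
    averages over jumps. *)
Lemma Rintegral_Fubini :
  \int[m1]_x (u x * \int[m2]_y k (x, y)) =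
  \int[m2]_y \int[m1]_x (u x * k (x, y)).
Proof.
apply: EFin_inj; rewrite EFin_Rintegral; last first.
  apply: (@integrable_mul_bounded _ (C * fine (m2 setT))).
    exact: measurable_Rintegral1.
  move=> x; apply: (le_trans (le_normr_Rintegral measurableT (iky x))).
  rewrite -(Rintegral_cst m2 measurableT C); apply: le_Rintegral => //.
  - exact: (integrable_norm (iky x)).
  - exact: finite_measure_integrable_cst.
rewrite EFin_Rintegral; last first.
  exact: (integrable_bounded measurable_Rintegral2 normr_Rintegral_mul).
transitivity (\int[m1]_x \int[m2]_y f (x, y))%E.
  apply: eq_integral => x _; rewrite EFinM EFin_Rintegral; last exact: iky.
  by rewrite -integralZl//; exact: iky.
rewrite (Fubini fi); apply: eq_integral => y _.
by rewrite EFin_Rintegral//; exact: iukx.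
Qed.

End Rintegral_Fubini.

(** * Euclidean space and Lebesgue measure *)

Section euclidean_theory.
Variables (R : realType) (d : nat).
Implicit Types (x y z : 'rV[R]_d) (a : R).

Lemma dotC x y : dot x y = dot y x.
Proof. by apply: eq_bigr => i _; rewrite mulrC. Qed.

Lemma dotDr x y z : dot x (y + z) = dot x y + dot x z.
Proof.
by rewrite /dot -big_split/=; apply: eq_bigr => i _; rewrite mxE mulrDr.
Qed.

Lemma dotZr a x y : dot x (a *: y) = a * dot x y.
Proof. by rewrite /dot mulr_sumr; apply: eq_bigr => i _; rewrite mxE mulrCA. Qed.

Lemma dotNr x y : dot x (- y) = - dot x y.
Proof. by rewrite -scaleN1r dotZr mulN1r. Qed.

Lemma dotBr x y z : dot x (y - z) = dot x y - dot x z.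
Proof. by rewrite dotDr dotNr. Qed.

Lemma dotDl x y z : dot (x + y) z = dot x z + dot y z.
Proof. by rewrite dotC dotDr !(dotC z). Qed.

Lemma dotZl a x y : dot (a *: x) y = a * dot x y.
Proof. by rewrite dotC dotZr dotC. Qed.

Lemma dotNl x y : dot (- x) y = - dot x y.
Proof. by rewrite dotC dotNr dotC. Qed.

Lemma dot0r x : dot x 0 = 0.
Proof. by rewrite -(scale0r 0) dotZr mul0r. Qed.

Lemma dot0l x : dot 0 x = 0.
Proof. by rewrite dotC dot0r. Qed.

Lemma dot_delta i y : dot (delta_mx ord0 i) y = y ord0 i.
Proof.
rewrite /dot (bigD1 i)//= mxE !eqxx mul1r big1 ?addr0// => j ji.
by rewrite mxE (negbTE ji) andbF mul0r.
Qed.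

Lemma dotxx_ge0 x : 0 <= dot x x.
Proof. by apply: sumr_ge0 => i _; rewrite -expr2 sqr_ge0. Qed.

Lemma enorm_ge0 x : 0 <= enorm x.
Proof. exact: sqrtr_ge0. Qed.

Lemma sqr_enorm x : enorm x ^+ 2 = dot x x.
Proof. by rewrite sqr_sqrtr// dotxx_ge0. Qed.

Lemma enormN x : enorm (- x) = enorm x.
Proof. by rewrite /enorm dotNr dotNl opprK. Qed.

Lemma enormZ a x : enorm (a *: x) = `|a| * enorm x.
Proof.
by rewrite /enorm dotZr dotZl mulrA -expr2 sqrtrM ?sqrtr_sqr// sqr_ge0.
Qed.

Lemma enorm0 : enorm (0 : 'rV[R]_d) = 0.
Proof. by rewrite /enorm dot0r sqrtr0. Qed.

Lemma normr_coord_le_enorm x i : `|x ord0 i| <= enorm x.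
Proof.
rewrite -sqrtr_sqr ler_wsqrtr// /dot (bigD1 i)//= -expr2 lerDl.
by apply: sumr_ge0 => j _; rewrite -expr2 sqr_ge0.
Qed.

Lemma enorm_eq0 x : enorm x = 0 -> x = 0.
Proof.
move=> x0; apply/rowP => i; rewrite mxE; apply/eqP.
by rewrite -normr_le0 -x0 normr_coord_le_enorm.
Qed.

Lemma CauchySchwarz_dot x y : `|dot x y| <= enorm x * enorm y.
Proof.
have [y0|y0] := eqVneq (enorm y) 0.
  by rewrite (enorm_eq0 y0) dot0r normr0 mulr_ge0 ?enorm_ge0.
have yy : 0 < dot y y by rewrite -sqr_enorm exprn_gt0// lt_def y0 enorm_ge0.
rewrite -(@ler_pXn2r _ 2)// ?nnegrE ?mulr_ge0 ?enorm_ge0//.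
rewrite exprMn !sqr_enorm -normrX ger0_norm ?sqr_ge0//.
(* The square of this vector is [dot y y] times [dot x x * dot y y - dot x y ^+ 2], and the positive
   factor [dot y y] is divided out. *)
have := dotxx_ge0 (dot y y *: x - dot x y *: y).
rewrite !(dotBr, dotDl, dotNl, dotZr, dotZl) (dotC y x).
move=> h; rewrite -subr_ge0 -(pmulr_rge0 _ yy); apply: le_trans h _.
by rewrite le_eqVlt; apply/orP; left; apply/eqP; ring.
Qed.

Lemma ler_enormD x y : enorm (x + y) <= enorm x + enorm y.
Proof.
rewrite -(@ler_pXn2r _ 2)// ?nnegrE ?addr_ge0 ?enorm_ge0//.
rewrite sqrrD !sqr_enorm dotDr !dotDl (dotC y x) mulr2n.
have := le_trans (ler_norm _) (CauchySchwarz_dot x y); lra.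
Qed.

Lemma enorm_le_sum x : enorm x <= \sum_(i < d) `|x ord0 i|.
Proof.
rewrite {1}(row_sum_delta x); elim/big_ind2: _ => [|u p v q up vq|i _].
- by rewrite enorm0.
- by rewrite (le_trans (ler_enormD _ _))// lerD.
- rewrite enormZ ler_piMr// -(@ler_pXn2r _ 2)// ?nnegrE ?enorm_ge0//.
  by rewrite sqr_enorm dot_delta mxE !eqxx expr1n.
Qed.

(** Neighbourhoods in ['rV[R]_d] come from the max norm; this carries Euclidean estimates over to
    them. *)
Lemma enorm_le_mx_norm x : enorm x <= d%:R * `|x|.
Proof.
rewrite (le_trans (enorm_le_sum x))//.
have -> : d%:R * `|x| = \sum_(i < d) `|x|.
  by rewrite sumr_const card_ord mulr_natl.
apply: ler_sum => i _; rewrite [leRHS]/Num.Def.normr/= mx_normrE.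
by apply/bigmax_geP; right => /=; exists (ord0, i).
Qed.

End euclidean_theory.

Section euclidean_measurability.
Variables (R : realType) (d : nat).
Implicit Types (x y z : 'rV[R]_d).

Lemma continuous_measurable_rV n (f : 'rV[R]_n -> R) : continuous f ->
  measurable_fun [set: 'rV[R]_n] f.
Proof.
move=> cf; apply: (measurability _ (RGenOpens.measurableE R)).
move=> _ [_ [a [b ->] <-]]; rewrite setTI; apply: open_measurable_rV.
by apply: open_comp; [move=> x _; exact: cf|exact: interval_open].
Qed.

Lemma measurable_dot2 (disp : measure_display) (T : measurableType disp)
    (f g : T -> 'rV[R]_d) :
  measurable_fun [set: T] f -> measurable_fun [set: T] g ->
  measurable_fun [set: T] (fun t => dot (f t) (g t)).
Proof.
move=> mf mg; apply: measurable_sum => i; apply: measurable_funM.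
- exact: (measurableT_comp (measurable_coord i) mf).
- exact: (measurableT_comp (measurable_coord i) mg).
Qed.

Lemma measurable_dot x : measurable_fun [set: 'rV[R]_d] (dot x).
Proof. by apply: measurable_dot2 => //; exact: measurable_id. Qed.

Lemma measurable_dotl x : measurable_fun [set: 'rV[R]_d] (fun y => dot y x).
Proof. by apply: measurable_dot2 => //; exact: measurable_id. Qed.

Lemma measurable_addl x : measurable_fun [set: 'rV[R]_d] (fun y => y - x).
Proof.
apply: measurable_rowP => i.
rewrite (_ : (fun y => _) = fun y : 'rV[R]_d => y ord0 i - x ord0 i).
  by apply: measurable_funB => //; exact: measurable_coord.
by apply/funext => y; rewrite !mxE.
Qed.

Lemma measurable_oppr : measurable_fun [set: 'rV[R]_d] (fun y => - y).
Proof.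
apply: measurable_rowP => i.
rewrite (_ : (fun y => _) = fun y : 'rV[R]_d => - (y ord0 i)).
  by apply: measurable_funN => //; exact: measurable_coord.
by apply/funext => y; rewrite !mxE.
Qed.

Lemma measurable_enorm : measurable_fun [set: 'rV[R]_d] (@enorm R d).
Proof.
rewrite (_ : @enorm R d = @Num.sqrt R \o (fun x => dot x x))//.
apply: measurableT_comp; last first.
  by apply: measurable_dot2; exact: measurable_id.
by apply: continuous_measurable_fun; exact: sqrt_continuous.
Qed.

Lemma measurable_eball x r : measurable (eball x r).
Proof.
rewrite -[X in measurable X]setTI.
rewrite (_ : eball x r = (fun y => enorm (y - x)) @^-1` `]-oo, r[); last first.
  by apply/seteqP; split => y /=; rewrite in_itv.
have := measurableT_comp measurable_enorm (measurable_addl x).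
by apply => //; exact: measurable_itv.
Qed.

Lemma measurable_cosdot x : measurable_fun [set: 'rV[R]_d] (fun y => cos (dot x y)).
Proof.
apply: (measurableT_comp (f := @cos R)); last exact: measurable_dot.
by apply: continuous_measurable_fun; exact: continuous_cos.
Qed.

Lemma measurable_sindot x : measurable_fun [set: 'rV[R]_d] (fun y => sin (dot x y)).
Proof.
apply: (measurableT_comp (f := @sin R)); last exact: measurable_dot.
by apply: continuous_measurable_fun; exact: continuous_sin.
Qed.

End euclidean_measurability.

(** * Product functions on R^(n+1) *)

Section tensor.
Variables (R : realType).
Notation lambda := (@lebesgue_measure R).

Definition tail_rV n (v : 'rV[R]_n.+1) : 'rV[R]_n := \row_j v ord0 (lift ord0 j).

Lemma cons_rV0 n (x : R) (v : 'rV[R]_n) : cons_rV x v ord0 ord0 = x.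
Proof. by rewrite mxE unlift_none. Qed.

Lemma cons_rVS n (x : R) (v : 'rV[R]_n) j : cons_rV x v ord0 (lift ord0 j) = v ord0 j.
Proof. by rewrite mxE liftK. Qed.

Lemma tail_cons_rV n (x : R) (v : 'rV[R]_n) : tail_rV (cons_rV x v) = v.
Proof. by apply/rowP => j; rewrite mxE cons_rVS. Qed.

Lemma measurable_tail_rV n : measurable_fun [set: 'rV[R]_n.+1] (@tail_rV n).
Proof. exact: (measurableT_comp measurable_snd (@measurable_pair_of_rV R n)). Qed.

(** [lebesgue_rV n.+1] is the image of a product measure under [rV_of_pair], so Fubini applies after
    a change of variables. This is the induction step of the product formulas on R^n. *)
Lemma integrable_tensor n (f : R -> R) (g : 'rV[R]_n -> R) :
  lambda.-integrable [set: R] (EFin \o f) ->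
  (lebesgue_rV R n).-integrable [set: 'rV[R]_n] (EFin \o g) ->
  (lebesgue_rV R n.+1).-integrable [set: 'rV[R]_n.+1]
     (fun v => (f (v ord0 ord0) * g (tail_rV v))%:E) /\
  \int[lebesgue_rV R n.+1]_v (f (v ord0 ord0) * g (tail_rV v)) =
    \int[lambda]_x f x * \int[lebesgue_rV R n]_v g v.
Proof.
move=> fi gi.
have mf : measurable_fun [set: R] f by apply/measurable_EFinP; case/integrableP: fi.
have mg : measurable_fun setT g by apply/measurable_EFinP; case/integrableP: gi.
pose mu := lebesgue_rV R n.
pose F (v : 'rV[R]_n.+1) : \bar R := (f (v ord0 ord0) * g (tail_rV v))%:E.
have mF : measurable_fun setT F.
  apply/measurable_EFinP; apply: measurable_funM.
    exact: (measurableT_comp mf (@measurable_coord R n.+1 ord0)).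
  exact: (measurableT_comp mg (@measurable_tail_rV n)).
pose H (p : measurableTypeR R * 'rV[R]_n) : \bar R := (f p.1 * g p.2)%:E.
have FH : F \o @rV_of_pair R n = H.
  by apply/funext => -[x v]; rewrite /F /H /= cons_rV0 tail_cons_rV.
have mH : measurable_fun setT H.
  by rewrite -FH; exact: (measurableT_comp mF (@measurable_rV_of_pair R n)).
have Hi : (lambda \x mu)%E.-integrable setT H.
  apply/(integrable12ltyP lambda mu mH).
  under eq_integral => x _.
    under eq_integral => v _ do rewrite /H /= normrM EFinM.
    rewrite integralZl//; last exact: (integrable_norm gi).
    rewrite -EFin_Rintegral; last exact: (integrable_norm gi).
    rewrite muleC; over.
  rewrite integralZl//=; last exact: (integrable_norm fi).
  rewrite -EFin_Rintegral; last exact: (integrable_norm fi).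
  by rewrite -EFinM ltry.
(* An equality of bare set functions: the two sides carry different measure structures, hence the
   passages through [eq_measure_integral] below. *)
have E : lebesgue_rV R n.+1 = pushforward (lambda \x mu)%E (@rV_of_pair R n) :> (set _ -> \bar R).
  exact: lebesgue_stepE.
have Fi : (lebesgue_rV R n.+1).-integrable setT F.
  have := @integrable_pushforward _ _ _ _ R _ (@measurable_rV_of_pair R n)
    (lambda \x mu)%E setT F mF.
  rewrite preimage_setT FH => /(_ Hi measurableT) /integrableP[_ Foo].
  apply/integrableP; split=> //; apply: le_lt_trans Foo.
  rewrite le_eqVlt; apply/orP; left; apply/eqP.
  apply: eq_measure_integral; first exact: measurable_rV_of_pair.
  by move=> mr A mA _; rewrite -[RHS]/(pushforward (lambda \x mu)%E (@rV_of_pair R n) A) -E.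
split=> //; apply: EFin_inj; rewrite EFin_Rintegral//.
have Hi' : (lambda \x mu)%E.-integrable (@rV_of_pair R n @^-1` setT) (F \o @rV_of_pair R n).
  by rewrite preimage_setT FH.
transitivity (\int[(lambda \x mu)%E]_(p in @rV_of_pair R n @^-1` setT) (F \o @rV_of_pair R n) p)%E.
  rewrite -(integral_pushforward (@measurable_rV_of_pair R n) mF Hi' measurableT).
  apply: eq_measure_integral; first exact: measurable_rV_of_pair.
  by move=> mr A mA _; rewrite -[RHS]/(pushforward (lambda \x mu)%E (@rV_of_pair R n) A) -E.
rewrite preimage_setT FH -(integral12_prod_meas1 Hi).
under eq_integral => x _.
  rewrite /fubini_F; under eq_integral => v _ do rewrite /H /= EFinM.
  rewrite integralZl// -EFin_Rintegral// muleC; over.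
rewrite integralZl// -EFin_Rintegral// -EFinM; congr EFin; exact: mulrC.
Qed.
End tensor.

(** * The Poisson kernel *)

Section laplace_kernel.
Variable R : realType.
Notation lambda := (@lebesgue_measure R).
Implicit Types (s z x : R) (g : R -> R).

(** Folding the line at 0 turns |x| into x and leaves a single integral over a half-line for the
    fundamental theorem of calculus. *)
Lemma ge0_integral_halves (f : R -> R) : (forall x, 0 <= f x) -> continuous f ->
  (\int[lambda]_x (f x)%:E = \int[lambda]_(x in `[0%R, +oo[) (f x + f (- x))%:E)%E.
Proof.
move=> f0 cf.
have mf : measurable_fun [set: R] f by exact: continuous_measurable_fun.
have mposnums : measurable [set x : R | 0 <= x] by rewrite -set_itvcy.
rewrite -(setUv [set x : R | 0 <= x]) ge0_integral_setU//= ; last 4 first.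
  exact: measurableC.
  by apply/measurable_EFinP; rewrite setUv.
  by move=> x _; rewrite lee_fin.
  exact/disj_setPCl.
rewrite -set_itvcy// setCitvr.
rewrite integral_itv_bndo_bndc; last exact/measurable_EFinP/measurable_funTS.
rewrite [X in (_ + X)%E](_ : _ = \int[lambda]_(x in `[0%R, +oo[) (f (- x))%:E)%E; last first.
  rewrite -{1}oppr0 ge0_integration_by_substitutionNy//.
  exact: continuous_subspaceT.
rewrite -ge0_integralD//=.
- by move=> x _; rewrite lee_fin.
- exact/measurable_EFinP/measurable_funTS.
- by move=> x _; rewrite lee_fin.
- apply/measurable_EFinP/measurable_funTS; apply: measurableT_comp => //.
Qed.

Definition laplace s x : R := expR (- (s * `|x|)).

Lemma laplace_gt0 s x : 0 < laplace s x.
Proof. exact: expR_gt0. Qed.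

Lemma continuous_laplace s : continuous (laplace s).
Proof.
move=> x; rewrite /laplace.
apply: (@continuous_comp _ _ _ (fun x => - (s * `|x|)) (@expR R)); last exact: continuous_expR.
apply: continuousN; apply: continuousM; first exact: cst_continuous.
exact: norm_continuous.
Qed.

(** A primitive of [f] below. The summand 1 in [f] keeps the integrand nonnegative, as the
    fundamental theorem on a half-line demands; its share 2 / s is subtracted in
    [Rintegral_laplace]. *)
Let F s z c x := - (2 / s) * expR (- (s * x)) +
  c * (2 / (s ^+ 2 + z ^+ 2)) * (expR (- (s * x)) * (z * sin (x * z) - s * cos (x * z))).

Let f s z c x := 2 * expR (- (s * x)) * (1 + c * cos (x * z)).

Let dF s z c x : 0 < s -> is_derive x 1 (F s z c) (f s z c x).
Proof.
move=> s0; rewrite /F.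
have h : s ^+ 2 + z ^+ 2 != 0 by rewrite gt_eqF// ltr_pwDl ?exprn_gt0 ?sqr_ge0.
apply: is_derive_eq.
rewrite /GRing.scale /= /f; field.
by rewrite h gt_eqF.
Qed.

Let F_cvg0 s z c : 0 < s -> F s z c x @[x --> +oo] --> 0.
Proof.
move=> s0.
have e0 : expR (- (s * x)) @[x --> +oo] --> (0 : R).
  apply: (@cvg_comp _ _ _ (fun x => s * x) (fun y => expR (- y)) _ +oo%R).
    exact: gt0_cvgMry.
  exact: cvgr_expR.
pose K := `|c * (2 / (s ^+ 2 + z ^+ 2))|.
have G0 : - (2 / s) * expR (- (s * x)) @[x --> +oo] --> (0 : R).
  by rewrite -(mulr0 (- (2 / s))); apply: cvgM => //; exact: cvg_cst.
have H0 : c * (2 / (s ^+ 2 + z ^+ 2)) * (expR (- (s * x)) * (z * sin (x * z) - s * cos (x * z)))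
    @[x --> +oo] --> (0 : R).
  rewrite -(mulr0 (c * (2 / (s ^+ 2 + z ^+ 2)))); apply: cvgM; first exact: cvg_cst.
  apply/cvgr0Pnorm_le => e epos.
  have K0 : 0 < `|z| + s by rewrite ltr_wpDl.
  have /cvgr0_norm_le/(_ (e / (`|z| + s))) := e0.
  move=> /(_ (divr_gt0 epos K0)); apply: filterS => x.
  rewrite ler_pdivlMr// => /(le_trans _); apply.
  rewrite normrM ler_wpM2l// (le_trans (ler_normB _ _))// lerD// normrM.
    by rewrite ler_piMr// sin_max.
  by rewrite (gtr0_norm s0) ler_piMr ?(ltW s0)// cos_max.
by rewrite -[0]addr0; exact: cvgD.
Qed.

Let integral_half s z c : 0 < s -> 0 <= c <= 1 ->
  (\int[lambda]_(x in `[0%R, +oo[) (f s z c x)%:E =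
   (2 / s + c * (2 * s / (s ^+ 2 + z ^+ 2)))%:E)%E.
Proof.
move=> s0 /andP[c0 c1].
have cF x : {for x, continuous (F s z c)}.
  by apply/differentiable_continuous/derivable1_diffP; case: (dF z c x s0).
rewrite (@ge0_continuous_FTC2y _ (f s z c) (F s z c) 0 0).
- rewrite sub0e -EFinN; congr EFin; rewrite /F mulr0 oppr0 expR0 !mul0r sin0 cos0; ring.
- move=> x _; rewrite /f mulr_ge0// ?mulr_ge0 ?expR_ge0//.
  rewrite -lerBlDl sub0r.
  have := cos_geN1 (x * z); have := cos_le1 (x * z); nra.
- apply: continuous_subspaceT => x; rewrite /f.
  apply: cvgM.
    apply: cvgM; first exact: cvg_cst.
    apply: (@continuous_comp _ _ _ (fun x => - (s * x)) (@expR R)); last exact: continuous_expR.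
    by apply: cvgN; apply: cvgM; [exact: cvg_cst|exact: cvg_id].
  apply: cvgD; first exact: cvg_cst.
  apply: cvgM; first exact: cvg_cst.
  apply: (@continuous_comp _ _ _ (fun x => x * z) (@cos R)); last exact: continuous_cos.
  by apply: cvgM; [exact: cvg_id|exact: cvg_cst].
- exact: F_cvg0.
- by move=> x _; case: (dF z c x s0).
- by apply: cvg_at_right_filter; exact: cF.
- by move=> x _; rewrite derive1E; case: (dF z c x s0).
Qed.

(** Only the even part of [g] counts, and it is prescribed to be [c * cos (x * z)]: [c = 1] serves
    the cosine, [c = 0] the sine and the zero function. *)
Let laplace_half s z c g : 0 < s -> 0 <= c <= 1 -> continuous g ->
  (forall x, `|g x| <= 1) -> (forall x, g x + g (- x) = 2 * c * cos (x * z)) ->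
  (\int[lambda]_x (laplace s x * (1 + g x))%:E =
   (2 / s + c * (2 * s / (s ^+ 2 + z ^+ 2)))%:E)%E.
Proof.
move=> s0 c01 cg g1 gE; rewrite ge0_integral_halves.
- rewrite -integral_half//; apply: eq_integral => x.
  rewrite inE/= in_itv/= andbT => x0; congr EFin.
  rewrite /f /laplace normrN ger0_norm// -mulrDr addrACA gE; ring.
- move=> x; rewrite mulr_ge0 ?(ltW (laplace_gt0 _ _))//.
  by have := g1 x; rewrite ler_norml => /andP[h1 h2]; lra.
- move=> x; apply: cvgM; first exact: continuous_laplace.
  by apply: cvgD; [exact: cvg_cst|exact: cg].
Qed.

Lemma integrable_laplace s : 0 < s -> lambda.-integrable [set: R] (EFin \o laplace s).
Proof.
move=> s0; apply/integrableP; split.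
  by apply/measurable_EFinP; exact: (continuous_measurable_fun (@continuous_laplace s)).
under eq_integral => x _.
  rewrite /= ger0_norm; last by rewrite ltW// laplace_gt0.
  rewrite (_ : laplace s x = laplace s x * (1 + (cst 0 x)))%R; last by rewrite addr0 mulr1.
  over.
rewrite (@laplace_half s 0 0) ?ltry ?lexx ?ler01//.
- exact: cst_continuous.
- by move=> x; rewrite normr0 ler01.
- by move=> x; rewrite addr0 mulr0 mul0r.
Qed.

Let Rintegral_laplace s z c g : 0 < s -> 0 <= c <= 1 -> continuous g ->
  (forall x, `|g x| <= 1) -> (forall x, g x + g (- x) = 2 * c * cos (x * z)) ->
  \int[lambda]_x (laplace s x * g x) = c * (2 * s / (s ^+ 2 + z ^+ 2)).
Proof.
move=> s0 c01 cg g1 gE.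
have ig : lambda.-integrable [set: R] (fun x => (laplace s x * g x)%:E).
  refine (@integrable_dominated _ _ _ lambda (fun x => laplace s x * g x) (laplace s) _ _ _); last exact: integrable_laplace.
  - apply: measurable_funM; apply: continuous_measurable_fun => //.
    exact: continuous_laplace.
  - by move=> x; rewrite normrM gtr0_norm ?laplace_gt0// ler_piMr// ltW// laplace_gt0.
have E1 : \int[lambda]_x laplace s x = 2 / s.
  apply: EFin_inj; transitivity (\int[lambda]_x (laplace s x)%:E)%E.
    exact: (EFin_Rintegral (integrable_laplace s0)).
  transitivity (\int[lambda]_x (laplace s x * (1 + cst 0 x))%:E)%E.
    by apply: eq_integral => x _; rewrite /= addr0 mulr1.
  rewrite (@laplace_half s 0 0) ?mul0r ?addr0 ?lexx ?ler01//.
  - exact: cst_continuous.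
  - by move=> x; rewrite normr0 ler01.
  - by move=> x; rewrite addr0 mulr0 mul0r.
have := laplace_half s0 c01 cg g1 gE => /(congr1 fine)/=.
rewrite -[X in X = _ -> _]/(Rintegral lambda setT (fun x => laplace s x * (1 + g x))).
under eq_Rintegral do rewrite mulrDr mulr1.
by rewrite RintegralD//; [rewrite E1 => /addrI|exact: integrable_laplace].
Qed.

Lemma Rintegral_laplace_cos s z : 0 < s ->
  \int[lambda]_x (laplace s x * cos (x * z)) = 2 * s / (s ^+ 2 + z ^+ 2).
Proof.
move=> s0; rewrite (@Rintegral_laplace s z 1) ?mul1r ?lexx ?ler01//.
- move=> x; apply: (@continuous_comp _ _ _ (fun x => x * z) (@cos R)); last exact: continuous_cos.
  by apply: cvgM; [exact: cvg_id|exact: cvg_cst].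
- by move=> x; exact: cos_max.
- by move=> x; rewrite mulNr cosN mulr1; ring.
Qed.

Lemma Rintegral_laplace_sin s z : 0 < s ->
  \int[lambda]_x (laplace s x * sin (x * z)) = 0.
Proof.
move=> s0; rewrite (@Rintegral_laplace s 0 0) ?mul0r ?lexx ?ler01//.
- move=> x; apply: (@continuous_comp _ _ _ (fun x => x * z) (@sin R)); last exact: continuous_sin.
  by apply: cvgM; [exact: cvg_id|exact: cvg_cst].
- by move=> x; exact: sin_max.
- by move=> x; rewrite mulNr sinN subrr !mulr0 mul0r.
Qed.

End laplace_kernel.

Section product_kernel.
Variable R : realType.
Notation lambda := (@lebesgue_measure R).

Lemma Rintegral_lebesgue_rV0 (f : 'rV[R]_0 -> R) : measurable_fun setT f ->
  (lebesgue_rV R 0).-integrable setT (EFin \o f) /\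
  \int[lebesgue_rV R 0]_v f v = f 0.
Proof.
move=> mf; have mf' : measurable_fun setT (EFin \o f) by exact/measurable_EFinP.
split.
  apply/integrableP; split=> //; rewrite [ltLHS]integral_dirac//; last exact: measurableT_comp.
  by rewrite diracT mul1e ltry.
by rewrite /Rintegral [X in fine X]integral_dirac// diracT mul1e.
Qed.

Lemma prod_recl_rV n (h : 'I_n.+1 -> R -> R) (v : 'rV[R]_n.+1) :
  \prod_(i < n.+1) h i (v ord0 i) =
  h ord0 (v ord0 ord0) * \prod_(i < n) h (lift ord0 i) (tail_rV v ord0 i).
Proof.
rewrite big_ord_recl; congr (_ * _); apply: eq_bigr => i _.
by rewrite mxE.
Qed.

Lemma Rintegral_prod n (h : 'I_n -> R -> R) :
  (forall i, lambda.-integrable [set: R] (EFin \o h i)) ->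
  (lebesgue_rV R n).-integrable setT (fun v => (\prod_(i < n) h i (v ord0 i))%:E) /\
  \int[lebesgue_rV R n]_v (\prod_(i < n) h i (v ord0 i)) =
  \prod_(i < n) \int[lambda]_x h i x.
Proof.
elim: n h => [|n IH] h ih.
  have [] := @Rintegral_lebesgue_rV0 (fun v => \prod_(i < 0) h i (v ord0 i)).
    by apply: measurable_prod => -[].
  by move=> i1 ->; split=> //; rewrite !big_ord0.
have [i1 E1] := IH (fun i => h (lift ord0 i)) (fun i => ih _).
have [i2 E2] := integrable_tensor (ih ord0) i1.
under eq_fun do rewrite prod_recl_rV.
under eq_Rintegral do rewrite prod_recl_rV.
by split=> //; rewrite E2 E1 big_ord_recl.
Qed.

Definition laplace_rV n (s : R) (v : 'rV[R]_n) : R :=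
  \prod_(i < n) laplace s (v ord0 i).

Lemma laplace_rVS n s (v : 'rV[R]_n.+1) :
  laplace_rV s v = laplace s (v ord0 ord0) * laplace_rV s (tail_rV v).
Proof. by rewrite /laplace_rV (prod_recl_rV (fun=> laplace s)). Qed.

Lemma dot_recl n (v z : 'rV[R]_n.+1) :
  dot v z = v ord0 ord0 * z ord0 ord0 + dot (tail_rV v) (tail_rV z).
Proof.
by rewrite /dot big_ord_recl; congr (_ + _); apply: eq_bigr => i _; rewrite !mxE.
Qed.

Lemma integrable_laplace_rV n s : 0 < s ->
  (lebesgue_rV R n).-integrable setT (EFin \o @laplace_rV n s).
Proof.
move=> s0; have [] // := @Rintegral_prod n (fun=> laplace s).
by move=> i; exact: integrable_laplace.
Qed.

Lemma laplace_rV_ge0 n s (v : 'rV[R]_n) : 0 <= laplace_rV s v.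
Proof. by apply: prodr_ge0 => i _; rewrite ltW// laplace_gt0. Qed.

Lemma laplace_rV_le1 n s (v : 'rV[R]_n) : 0 <= s -> laplace_rV s v <= 1.
Proof.
move=> s0; apply: prodr_ile1 => i _; rewrite (ltW (laplace_gt0 _ _))/=.
by rewrite -[leRHS]expR0 ler_expR lerNl oppr0 mulr_ge0.
Qed.

Lemma measurable_laplace_rV n s : measurable_fun setT (@laplace_rV n s).
Proof.
apply: measurable_prod => i _.
apply: measurableT_comp; last exact: measurable_coord.
exact: (continuous_measurable_fun (@continuous_laplace R s)).
Qed.

(** A product of one-dimensional Poisson kernels, not the radial one, and without normalisation:
    each factor has integral 2 pi over the line. *)
Definition poisson_kernel n (s : R) (z : 'rV[R]_n) : R :=
  \prod_(i < n) (2 * s / (s ^+ 2 + z ord0 i ^+ 2)).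

Lemma poisson_kernel_ge0 n s (z : 'rV[R]_n) : 0 <= s -> 0 <= poisson_kernel s z.
Proof.
move=> s0; apply: prodr_ge0 => i _.
by rewrite divr_ge0 ?mulr_ge0 ?addr_ge0 ?sqr_ge0.
Qed.

(** Cosine and sine are treated together because the addition formulas couple them when the first
    coordinate is split off. *)
Lemma Rintegral_laplace_rV n s (z : 'rV[R]_n) : 0 < s ->
  \int[lebesgue_rV R n]_v (laplace_rV s v * cos (dot v z)) = poisson_kernel s z /\
  \int[lebesgue_rV R n]_v (laplace_rV s v * sin (dot v z)) = 0.
Proof.
move=> s0; elim: n z => [|n IH] z.
  split.
    have [] := @Rintegral_lebesgue_rV0 (fun v => laplace_rV s v * cos (dot v z)).
      apply: measurable_funM; first exact: measurable_laplace_rV.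
      under eq_fun do rewrite dotC; exact: measurable_cosdot.
    by move=> _ ->; rewrite /laplace_rV /poisson_kernel !big_ord0 dot0l cos0 mulr1.
  have [] := @Rintegral_lebesgue_rV0 (fun v => laplace_rV s v * sin (dot v z)).
    apply: measurable_funM; first exact: measurable_laplace_rV.
    under eq_fun do rewrite dotC; exact: measurable_sindot.
  by move=> _ ->; rewrite dot0l sin0 mulr0.
have [cE sE] := IH (tail_rV z).
pose c1 x := laplace s x * cos (x * z ord0 ord0).
pose s1 x := laplace s x * sin (x * z ord0 ord0).
pose c2 (v : 'rV[R]_n) := laplace_rV s v * cos (dot v (tail_rV z)).
pose s2 (v : 'rV[R]_n) := laplace_rV s v * sin (dot v (tail_rV z)).
have mtrig (g : R -> R) : continuous g -> measurable_fun setT (fun x : R => g (x * z ord0 ord0)).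
  move=> cg; apply: continuous_measurable_fun => x.
  apply: (@continuous_comp R R R (fun x => x * z ord0 ord0) g); last exact: cg.
  by apply: cvgM; [exact: cvg_id|exact: cvg_cst].
have ic1 : lambda.-integrable [set: R] (EFin \o c1).
  apply: (integrable_mul_bounded (integrable_laplace s0) (D := 1)).
    by apply: mtrig; exact: continuous_cos.
  by move=> x; exact: cos_max.
have is1 : lambda.-integrable [set: R] (EFin \o s1).
  apply: (integrable_mul_bounded (integrable_laplace s0) (D := 1)).
    by apply: mtrig; exact: continuous_sin.
  by move=> x; exact: sin_max.
have ic2 : (lebesgue_rV R n).-integrable setT (EFin \o c2).
  apply: (integrable_mul_bounded (integrable_laplace_rV n s0) (D := 1)).
    by under eq_fun do rewrite dotC; exact: measurable_cosdot.
  by move=> x; exact: cos_max.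
have is2 : (lebesgue_rV R n).-integrable setT (EFin \o s2).
  apply: (integrable_mul_bounded (integrable_laplace_rV n s0) (D := 1)).
    by under eq_fun do rewrite dotC; exact: measurable_sindot.
  by move=> x; exact: sin_max.
have [icc Ecc] := integrable_tensor ic1 ic2.
have [iss Ess] := integrable_tensor is1 is2.
have [ics Ecs] := integrable_tensor ic1 is2.
have [isc Esc] := integrable_tensor is1 ic2.
split.
  transitivity (\int[lebesgue_rV R n.+1]_v (c1 (v ord0 ord0) * c2 (tail_rV v)
     - s1 (v ord0 ord0) * s2 (tail_rV v))).
    apply: eq_Rintegral => v _; rewrite laplace_rVS dot_recl cosD /c1 /c2 /s1 /s2; ring.
  rewrite RintegralB// Ecc Ess cE sE mulr0 subr0 Rintegral_laplace_cos//.
  by rewrite /poisson_kernel big_ord_recl; congr (_ * _); apply: eq_bigr => i _; rewrite mxE.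
transitivity (\int[lebesgue_rV R n.+1]_v (s1 (v ord0 ord0) * c2 (tail_rV v)
     + c1 (v ord0 ord0) * s2 (tail_rV v))).
  apply: eq_Rintegral => v _; rewrite laplace_rVS dot_recl sinD /c1 /c2 /s1 /s2; ring.
by rewrite RintegralD// Ecs Esc sE mulr0 Rintegral_laplace_sin// mul0r addr0.
Qed.

End product_kernel.

Lemma integrable_indic_lty d (T : measurableType d) (R : realType)
    (mu : {measure set T -> \bar R}) (A : set T) : measurable A ->
  (mu A < +oo)%E -> mu.-integrable [set: T] (fun x => (\1_A x)%:E).
Proof.
move=> mA Aoo; apply/integrableP; split.
  by apply/measurable_EFinP; exact: measurable_indic.
under eq_integral do rewrite /= ger0_norm//.
by rewrite integral_indic// setIT.
Qed.

(** * Boxes and their mass under the Poisson kernel *)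

Section boxes.
Variable R : realType.
Notation lambda := (@lebesgue_measure R).

Definition cbox n (a b : 'rV[R]_n) : set 'rV[R]_n :=
  [set v | forall i, v ord0 i \in `[a ord0 i, b ord0 i]].

Definition obox n (a b : 'rV[R]_n) : set 'rV[R]_n :=
  [set v | forall i, v ord0 i \in `]a ord0 i, b ord0 i[].

Lemma measurable_coords n (P : 'I_n -> set R) : (forall i, measurable (P i)) ->
  measurable [set v : 'rV[R]_n | forall i, P i (v ord0 i)].
Proof.
move=> mP; rewrite (_ : [set v | _] = \bigcap_(i in [set: 'I_n])
   (fun v : 'rV[R]_n => v ord0 i) @^-1` P i); last first.
  by apply/seteqP; split=> v Pv i //=; exact: Pv.
apply: fin_bigcap_measurable; first exact: finite_finset.
by move=> i _; rewrite -[X in measurable X]setTI; exact: measurable_coord.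
Qed.

Lemma measurable_cbox n (a b : 'rV[R]_n) : measurable (cbox a b).
Proof. exact: (measurable_coords (P := fun i => `[a ord0 i, b ord0 i]%classic)). Qed.

Lemma measurable_obox n (a b : 'rV[R]_n) : measurable (obox a b).
Proof. exact: (measurable_coords (P := fun i => `]a ord0 i, b ord0 i[%classic)). Qed.

Lemma indic_cbox n (a b v : 'rV[R]_n) :
  \1_(cbox a b) v = \prod_(i < n) \1_(`[a ord0 i, b ord0 i]%classic) (v ord0 i) :> R.
Proof.
rewrite indicE; case: (boolP (v \in _)) => vB.
  rewrite big1// => i _; rewrite indicE mem_set//.
  by move: vB; rewrite inE => /(_ i).
have [i vi] : exists i, ~ v ord0 i \in `[a ord0 i, b ord0 i].
  by apply/existsNP; move: vB; rewrite notin_setE.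
by rewrite (bigD1 i)//= indicE memNset ?mul0r.
Qed.

Lemma lebesgue_rV_cbox_lty n (a b : 'rV[R]_n) : (forall i, a ord0 i < b ord0 i) ->
  (lebesgue_rV R n (cbox a b) < +oo)%E.
Proof. by move=> ab; rewrite lebesgue_rV_box ?ltry// => i; exact/ltW. Qed.

Lemma integrable_indic_cbox n (a b : 'rV[R]_n) : (forall i, a ord0 i < b ord0 i) ->
  (lebesgue_rV R n).-integrable setT (fun v => (\1_(cbox a b) v)%:E).
Proof.
move=> ab; apply: integrable_indic_lty; first exact: measurable_cbox.
exact: lebesgue_rV_cbox_lty.
Qed.

Definition poisson_mass (s a b u : R) : R := 2 * (atan ((b - u) / s) - atan ((a - u) / s)).

Lemma Rintegral_poisson_itv (s a b u : R) : 0 < s -> a < b ->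
  lambda.-integrable [set: R]
    (fun x => (\1_(`[a, b]%classic) x * (2 * s / (s ^+ 2 + (x - u) ^+ 2)))%:E) /\
  \int[lambda]_x (\1_(`[a, b]%classic) x * (2 * s / (s ^+ 2 + (x - u) ^+ 2))) =
    poisson_mass s a b u.
Proof.
move=> s0 ab; set k := fun x : R => 2 * s / (s ^+ 2 + (x - u) ^+ 2).
have k0 x : s ^+ 2 + (x - u) ^+ 2 != 0 by rewrite gt_eqF// ltr_pwDl ?exprn_gt0 ?sqr_ge0.
pose F (x : R) := 2 * atan ((x - u) / s).
have dF (x : R) : is_derive x 1 F (k x).
  apply: is_derive_eq; rewrite /GRing.scale/= /k; field.
  by rewrite k0 gt_eqF//=; have := k0 x; rewrite addrC; congr (_ != 0); ring.
have ck : continuous k.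
  move=> x; apply: cvgM; first exact: cvg_cst.
  apply: cvgV => //; apply: cvgD; first exact: cvg_cst.
  apply: (@continuous_comp R R R (fun x => x - u) (fun y => y ^+ 2)); last exact: exprn_continuous.
  by apply: cvgB; [exact: cvg_id|exact: cvg_cst].
have ik : lambda.-integrable [set: R] (fun x => (\1_(`[a, b]%classic) x * k x)%:E).
  have := continuous_compact_integrable (@segment_compact R a b) (continuous_subspaceT ck).
  move=> h; have {h} := (@integrable_mkcond _ _ _ lambda `[a, b]%classic _ (measurable_itv _)).1 h.
  apply: eq_integrable => // x _; rewrite patchE indicE /=.
  by case: ifPn; rewrite ?mul1r ?mul0r.
split=> //; apply: EFin_inj; rewrite EFin_Rintegral//.
transitivity (\int[lambda]_(x in `[a, b]) (k x)%:E)%E.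
  rewrite [RHS]integral_mkcond; apply: eq_integral => x _.
  by rewrite patchE indicE; case: ifPn; rewrite ?mul1r ?mul0r.
rewrite (@continuous_FTC2 _ k F)//.
- by rewrite -EFinB /F /poisson_mass mulrBr.
- exact: continuous_subspaceT.
- have cF x : {for x, continuous F}.
    by apply/differentiable_continuous/derivable1_diffP; case: (dF x).
  split.
  + by move=> x _; case: (dF x).
  + by apply: cvg_at_right_filter; exact: cF.
  + by apply: cvg_at_left_filter; exact: cF.
- by move=> x _; rewrite derive1E; case: (dF x).
Qed.

Lemma Rintegral_poisson_cbox n (s : R) (a b y : 'rV[R]_n) : 0 < s ->
  (forall i, a ord0 i < b ord0 i) ->
  \int[lebesgue_rV R n]_v (\1_(cbox a b) v * poisson_kernel s (v - y)) =
    \prod_(i < n) poisson_mass s (a ord0 i) (b ord0 i) (y ord0 i).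
Proof.
move=> s0 ab.
have [_] := @Rintegral_prod R n (fun i x => \1_(`[a ord0 i, b ord0 i]%classic) x *
  (2 * s / (s ^+ 2 + (x - y ord0 i) ^+ 2)))
  (fun i => (Rintegral_poisson_itv (y ord0 i) s0 (ab i)).1).
under [in RHS]eq_bigr do rewrite (Rintegral_poisson_itv _ s0 (ab _)).2.
move=> <-; apply: eq_Rintegral => v _.
rewrite indic_cbox /poisson_kernel -big_split/=; apply: eq_bigr => i _.
by rewrite !mxE.
Qed.

Lemma poisson_mass_ge0 s a b u : 0 < s -> a < b -> 0 <= poisson_mass s a b u.
Proof.
move=> s0 ab; rewrite mulr_ge0// subr_ge0 ltW// lt_atan//.
by rewrite ltr_pM2r ?invr_gt0// ltrD2r.
Qed.

Lemma poisson_mass_le s a b u : 0 < s -> a < b -> poisson_mass s a b u <= 2 * pi.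
Proof.
move=> s0 ab; rewrite ler_pM2l//.
have := ltW (atan_ltpi2 ((b - u) / s)); have := ltW (atan_gtNpi2 ((a - u) / s)); lra.
Qed.

End boxes.

(** * Fourier inversion *)

Section cosine_transform.
Variables (R : realType) (n : nat).
Notation leb := (lebesgue_rV R n).
Implicit Types (u v : 'rV[R]_n -> R) (z : 'rV[R]_n).

(** The [G u z] of the overview; for even [u] it is the whole Fourier transform. *)
Definition cosint u z : R := \int[leb]_xi (u xi * cos (dot xi z)).

Lemma measurable_cosdotl z : measurable_fun setT (fun xi : 'rV[R]_n => cos (dot xi z)).
Proof. by under eq_fun do rewrite dotC; exact: measurable_cosdot. Qed.

Lemma measurable_sindotl z : measurable_fun setT (fun xi : 'rV[R]_n => sin (dot xi z)).
Proof. by under eq_fun do rewrite dotC; exact: measurable_sindot. Qed.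

Lemma integrable_cosint u z : leb.-integrable setT (EFin \o u) ->
  leb.-integrable setT (fun xi => (u xi * cos (dot xi z))%:E).
Proof.
move=> iu; apply: (integrable_mul_bounded iu (D := 1)).
- exact: measurable_cosdotl.
- by move=> x; exact: cos_max.
Qed.

Lemma normr_cosint_le u z : leb.-integrable setT (EFin \o u) ->
  `|cosint u z| <= \int[leb]_xi `|u xi|.
Proof.
move=> iu; apply: (le_trans (le_normr_Rintegral measurableT (integrable_cosint z iu))).
apply: le_Rintegral => //.
- exact: (integrable_norm (integrable_cosint z iu)).
- exact: (integrable_norm iu).
- by move=> x _; rewrite normrM ler_piMr// cos_max.
Qed.

Lemma cosint_dct (u_ : nat -> 'rV[R]_n -> R) u v z :
  (forall k, measurable_fun setT (u_ k)) ->
  (forall x, u_ ^~ x @ \oo --> u x) ->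
  (forall k x, `|u_ k x| <= v x) ->
  leb.-integrable setT (EFin \o v) ->
  (fun k => cosint (u_ k) z) @ \oo --> cosint u z.
Proof.
move=> mu_ u_u u_v iv.
have [] // := @Rintegral_dct _ _ R leb (fun k xi => u_ k xi * cos (dot xi z))
  (fun xi => u xi * cos (dot xi z)) v.
- by move=> k; apply: measurable_funM => //; exact: measurable_cosdotl.
- by move=> x; apply: cvgM; [exact: u_u|exact: cvg_cst].
- by move=> k x; rewrite normrM (le_trans _ (u_v k x))// ler_piMr// cos_max.
Qed.

End cosine_transform.

Lemma cvg_laplace (R : realType) (x : R) : laplace (k.+1%:R^-1) x @[k --> \oo] --> (1 : R).
Proof.
rewrite [X in _ --> X](_ : _ = expR (- (0 * `|x|))); last by rewrite mul0r oppr0 expR0.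
apply: continuous_cvg; first exact: continuous_expR.
by apply: cvgN; apply: cvgM; [exact: cvg_harmonic|exact: cvg_cst].
Qed.

Lemma cvg_prodr (R : realType) (I : Type) (r : seq I) (f : I -> nat -> R) (l : I -> R) :
  (forall i, f i @ \oo --> l i) ->
  (fun k => \prod_(i <- r) f i k) @ \oo --> \prod_(i <- r) l i.
Proof.
move=> fl; elim: r => [|i r IH].
  by rewrite big_nil; under eq_fun do rewrite big_nil; exact: cvg_cst.
by rewrite big_cons; under eq_fun do rewrite big_cons; exact: cvgM.
Qed.

Lemma cvg_laplace_rV (R : realType) n (v : 'rV[R]_n) :
  laplace_rV (k.+1%:R^-1) v @[k --> \oo] --> (1 : R).
Proof.
have := @cvg_prodr R _ (index_enum 'I_n) (fun i k => laplace k.+1%:R^-1 (v ord0 i))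
  (fun=> 1) (fun i => cvg_laplace (v ord0 i)).
by rewrite big1_eq.
Qed.

Section inversion.
Variables (R : realType) (n : nat) (P : probability 'rV[R]_n R) (c : 'rV[R]_n)
  (phi : 'rV[R]_n -> R).
Notation leb := (lebesgue_rV R n).
Hypotheses (iphi : leb.-integrable setT (EFin \o phi))
  (cfc : forall xi, \int[P]_y cos (dot xi y) = phi xi * cos (dot xi c))
  (cfs : forall xi, \int[P]_y sin (dot xi y) = phi xi * sin (dot xi c)).

(** [cfc] and [cfs] say that [P] has characteristic function phi(xi) exp(i xi . c) with phi real;
    this is the real part of exp(i xi . x) times its conjugate. *)
Lemma Rintegral_cos_shift x xi :
  \int[P]_y cos (dot xi (x - y)) = phi xi * cos (dot xi (x - c)).
Proof.
have ic : P.-integrable setT (EFin \o (fun y => cos (dot xi y))).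
  by apply: (@integrable_bounded _ _ _ _ _ 1); [exact: measurable_cosdot|move=> y; exact: cos_max].
have is_ : P.-integrable setT (EFin \o (fun y => sin (dot xi y))).
  by apply: (@integrable_bounded _ _ _ _ _ 1); [exact: measurable_sindot|move=> y; exact: sin_max].
transitivity (\int[P]_y (cos (dot xi x) * cos (dot xi y) + sin (dot xi x) * sin (dot xi y))).
  by apply: eq_Rintegral => y _; rewrite dotBr cosB.
rewrite RintegralD//; [|exact: integrable_cmul|exact: integrable_cmul].
rewrite !RintegralZl// cfc cfs dotBr cosB; ring.
Qed.

(** A Parseval identity: the kernel is written as the transform of [laplace_rV s] and the integrals
    are exchanged. The left side is visibly nonnegative, the right side is the damped inversion
    integral. *)
Lemma Rintegral_poisson_kernel s x : 0 < s ->
  \int[P]_y poisson_kernel s (x - y) =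
  cosint (fun xi => laplace_rV s xi * phi xi) (x - c).
Proof.
move=> s0; transitivity (\int[leb]_xi (laplace_rV s xi * \int[P]_y cos (dot xi (x - y)))).
  rewrite (@Rintegral_Fubini _ _ _ _ _ leb P (laplace_rV s)
    (fun p => cos (dot p.1 (x - p.2))) 1).
  - by apply: eq_Rintegral => y _; exact: (esym (Rintegral_laplace_rV (x - y) s0).1).
  - exact: integrable_laplace_rV.
  - apply: (measurableT_comp (f := @cos R)).
      by apply: continuous_measurable_fun; exact: continuous_cos.
    apply: measurable_dot2 => //.
    rewrite (_ : (fun p => x - p.2) = (-%R \o (fun y => y - x)) \o snd).
      apply: measurableT_comp => //; apply: measurableT_comp; first exact: measurable_oppr.
      exact: measurable_addl.
    by apply/funext => p /=; rewrite opprB.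
  - by move=> p; exact: cos_max.
apply: eq_Rintegral => xi _.
by rewrite Rintegral_cos_shift mulrA.
Qed.

Let mphi : measurable_fun setT phi.
Proof. by apply/measurable_EFinP; case/integrableP: iphi. Qed.

Let phik (k : nat) (xi : 'rV[R]_n) : R := laplace_rV k.+1%:R^-1 xi * phi xi.

Let normr_phik k xi : `|phik k xi| <= `|phi xi|.
Proof.
rewrite normrM ler_piMl// ger0_norm ?laplace_rV_ge0//.
by rewrite laplace_rV_le1// invr_ge0.
Qed.

Let mphik k : measurable_fun setT (phik k).
Proof. by apply: measurable_funM => //; exact: measurable_laplace_rV. Qed.

Let iphik k : leb.-integrable setT (EFin \o phik k).
Proof.
exact: (integrable_dominated (mphik k) (normr_phik k) (integrable_norm iphi)).
Qed.

Let cvg_phik x : (fun k => cosint (phik k) x) @ \oo --> cosint phi x.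
Proof.
apply: (cosint_dct (v := fun xi => `|phi xi|)) => //.
- move=> xi; rewrite -[X in _ --> X]mul1r; apply: cvgM; last exact: cvg_cst.
  exact: cvg_laplace_rV.
- exact: (integrable_norm iphi).
Qed.

Let poissonE k x :
  \int[P]_y poisson_kernel k.+1%:R^-1 (x - y) = cosint (phik k) (x - c).
Proof. exact: Rintegral_poisson_kernel. Qed.

Lemma cosint_cf_ge0 x : 0 <= cosint phi (x - c).
Proof.
apply: (cvgr_to_ge (@cvg_phik (x - c))); apply: nearW => k.
rewrite -poissonE; apply: Rintegral_ge0 => y _; exact: poisson_kernel_ge0.
Qed.

Let measurable_sub2 : measurable_fun [set: 'rV[R]_n * 'rV[R]_n] (fun p => p.1 - p.2).
Proof.
apply: measurable_rowP => i.
rewrite (_ : (fun p => _) = fun p : 'rV[R]_n * 'rV[R]_n => p.1 ord0 i - p.2 ord0 i).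
  apply: measurable_funB.
  - exact: (measurableT_comp (measurable_coord i) measurable_fst).
  - exact: (measurableT_comp (measurable_coord i) measurable_snd).
by apply/funext => y; rewrite !mxE.
Qed.

Lemma measurable_poisson_kernel s : 0 < s ->
  measurable_fun setT (@poisson_kernel R n s).
Proof.
move=> s0; apply: measurable_prod => i _.
apply: (measurableT_comp (f := fun x : R => 2 * s / (s ^+ 2 + x ^+ 2))); last exact: measurable_coord.
apply: continuous_measurable_fun => x.
apply: cvgM; first exact: cvg_cst.
apply: cvgV; first by rewrite gt_eqF// ltr_pwDl ?exprn_gt0 ?sqr_ge0.
by apply: cvgD; [exact: cvg_cst|exact: exprn_continuous].
Qed.

Lemma poisson_kernel_le s (z : 'rV[R]_n) : 0 < s -> poisson_kernel s z <= (2 / s) ^+ n.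
Proof.
move=> s0; rewrite /poisson_kernel -[n in leRHS]card_ord -prodr_const.
apply: ler_prod => i _; apply/andP; split.
  by rewrite divr_ge0 ?mulr_ge0 ?addr_ge0 ?sqr_ge0 ?ltW.
rewrite ler_pdivrMr; last by rewrite ltr_pwDl ?exprn_gt0 ?sqr_ge0.
rewrite -mulrA ler_pM2l// mulrDr.
rewrite (_ : s^-1 * s ^+ 2 = s); last by rewrite expr2 mulKf ?gt_eqF.
by rewrite lerDl mulr_ge0 ?sqr_ge0// invr_ge0 ltW.
Qed.

Let measurable_cosint_phik k : measurable_fun setT (fun x : 'rV[R]_n => cosint (phik k) (x - c)).
Proof.
have s0 : 0 < k.+1%:R^-1 :> R by [].
under eq_fun do rewrite -poissonE.
have mk : measurable_fun setT (fun p : 'rV[R]_n * 'rV[R]_n => poisson_kernel k.+1%:R^-1 (p.1 - p.2)).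
  by apply: (measurableT_comp _ measurable_sub2); exact: measurable_poisson_kernel.
apply: (measurable_Rintegral1 P mk (C := (2 / k.+1%:R^-1) ^+ n)).
by move=> p; rewrite ger0_norm ?poisson_kernel_le// poisson_kernel_ge0.
Qed.

Lemma measurable_cosint_cf : measurable_fun setT (fun x : 'rV[R]_n => cosint phi (x - c)).
Proof.
exact: (measurable_fun_cvg measurable_cosint_phik (fun x _ => @cvg_phik (x - c))).
Qed.

Variables a b : 'rV[R]_n.
Hypothesis ab : forall i, a ord0 i < b ord0 i.

Let mass k (y : 'rV[R]_n) : R :=
  \prod_(i < n) poisson_mass k.+1%:R^-1 (a ord0 i) (b ord0 i) (y ord0 i).

Let Rintegral_cbox_phik k :
  \int[leb]_x (\1_(cbox a b) x * cosint (phik k) (x - c)) = \int[P]_y mass k y.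
Proof.
have s0 : 0 < k.+1%:R^-1 :> R by [].
transitivity (\int[leb]_x (\1_(cbox a b) x * \int[P]_y poisson_kernel k.+1%:R^-1 (x - y))).
  by apply: eq_Rintegral => x _; rewrite poissonE.
rewrite (@Rintegral_Fubini _ _ _ _ _ leb P (\1_(cbox a b))
    (fun p => poisson_kernel k.+1%:R^-1 (p.1 - p.2)) ((2 / k.+1%:R^-1) ^+ n)).
- by apply: eq_Rintegral => y _; exact: Rintegral_poisson_cbox.
- exact: integrable_indic_cbox.
- exact: (measurableT_comp (measurable_poisson_kernel s0) measurable_sub2).
- by move=> p; rewrite ger0_norm ?poisson_kernel_le// poisson_kernel_ge0.
Qed.

(** Each factor is 2 pi inside the open interval, pi at an endpoint and 0 outside the closed
    interval. *)
Let mass_lim (y : 'rV[R]_n) : R :=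
  \prod_(i < n) (pi * (Num.sg (b ord0 i - y ord0 i) - Num.sg (a ord0 i - y ord0 i))).

Let cvg_mass y : mass ^~ y @ \oo --> mass_lim y.
Proof.
apply: cvg_prodr => i; rewrite /poisson_mass.
have cvg_atan (u : R) : atan (u / k.+1%:R^-1) @[k --> \oo] --> pi / 2 * Num.sg u.
  under eq_fun do rewrite invrK.
  have n_oo : (k.+1%:R : R) @[k --> \oo] --> +oo by rewrite (cvg_shiftS (fun k => k%:R : R)); exact: cvgr_idn.
  have moo (M : R) : 0 < M -> M * x @[x --> +oo] --> +oo.
    by move=> M0; apply: gt0_cvgMry.
  case: (sgrP u) => [u0|u0|u0].
  - by rewrite mulr0 u0; under eq_fun do rewrite mul0r atan0; exact: cvg_cst.
  - have uoo : u * k.+1%:R @[k --> \oo] --> +oo.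
      exact: (cvg_comp _ _ n_oo (moo _ u0)).
    by rewrite mulr1; exact: (cvg_comp _ _ uoo (@cvgy_atan R)).
  - have uoo : - u * k.+1%:R @[k --> \oo] --> +oo.
      by apply: (cvg_comp _ _ n_oo (moo (- u) _)); rewrite oppr_gt0.
    rewrite mulrN1 (_ : (fun k => _) = fun k => - atan (- u * k.+1%:R)).
      by apply: cvgN; apply: (cvg_comp _ _ uoo (@cvgy_atan R)).
    by apply/funext => k; rewrite mulNr atanN opprK.
rewrite (_ : pi * _ = 2 * (pi / 2 * Num.sg (b ord0 i - y ord0 i) - pi / 2 * Num.sg (a ord0 i - y ord0 i))); last by field.
by apply: cvgM; [exact: cvg_cst|apply: cvgB; exact: cvg_atan].
Qed.

Let measurable_mass k : measurable_fun setT (mass k).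
Proof.
apply: measurable_prod => i _.
apply: (measurableT_comp (f := poisson_mass k.+1%:R^-1 (a ord0 i) (b ord0 i))); last exact: measurable_coord.
apply: continuous_measurable_fun => u; apply: cvgM; first exact: cvg_cst.
have ca e : {for u, continuous (fun u : R => atan ((e - u) / k.+1%:R^-1))}.
  apply: (@continuous_comp R R R (fun u => (e - u) / k.+1%:R^-1) (@atan R)); last exact: continuous_atan.
  by apply: cvgM; [apply: cvgB; [exact: cvg_cst|exact: cvg_id]|exact: cvg_cst].
by apply: cvgB; exact: ca.
Qed.

Let mass_le k y : `|mass k y| <= (2 * pi) ^+ n.
Proof.
rewrite ger0_norm; last by apply: prodr_ge0 => i _; exact: poisson_mass_ge0.
rewrite /mass -[n in leRHS]card_ord -prodr_const; apply: ler_prod => i _.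
by rewrite poisson_mass_ge0//= poisson_mass_le.
Qed.

Let cvg_Rintegral_mass : (fun k => \int[P]_y mass k y) @ \oo --> \int[P]_y mass_lim y /\
  P.-integrable setT (EFin \o mass_lim).
Proof.
have [] // := @Rintegral_dct _ _ R P mass mass_lim (cst ((2 * pi) ^+ n)).
exact: finite_measure_integrable_cst.
Qed.

Let cvg_Rintegral_cbox_phik :
  (fun k => \int[leb]_x (\1_(cbox a b) x * cosint (phik k) (x - c))) @ \oo -->
  \int[leb]_x (\1_(cbox a b) x * cosint phi (x - c)).
Proof.
pose D := \int[leb]_xi `|phi xi|.
have [] // := @Rintegral_dct _ _ R leb (fun k x => \1_(cbox a b) x * cosint (phik k) (x - c))
  (fun x => \1_(cbox a b) x * cosint phi (x - c)) (fun x => D * \1_(cbox a b) x).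
- move=> k; apply: measurable_funM; first by apply: measurable_indic; exact: measurable_cbox.
  exact: measurable_cosint_phik.
- by move=> x; apply: cvgM; [exact: cvg_cst|exact: cvg_phik].
- move=> k x; rewrite normrM [X in X * _]ger0_norm// mulrC ler_wpM2r//.
  apply: (le_trans (normr_cosint_le _ (iphik k))); apply: le_Rintegral => //.
  + exact: (integrable_norm (iphik k)).
  + exact: (integrable_norm iphi).
- by apply: integrable_cmul; exact: integrable_indic_cbox.
Qed.

(** The smoothed measure is integrated over the box and the smoothing scale sent to 0. On the faces
    [mass_lim] takes values between 0 and (2 pi)^n, which is why two inequalities come out and not
    an equality. *)
Lemma Rintegral_cbox_cosint :
  (2 * pi) ^+ n * fine (P (obox a b)) <=
    \int[leb]_x (\1_(cbox a b) x * cosint phi (x - c)) <=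
  (2 * pi) ^+ n * fine (P (cbox a b)).
Proof.
have -> : \int[leb]_x (\1_(cbox a b) x * cosint phi (x - c)) = \int[P]_y mass_lim y.
  have h := cvg_Rintegral_cbox_phik.
  rewrite (funext Rintegral_cbox_phik) in h.
  exact: (cvg_unique _ h cvg_Rintegral_mass.1).
have im := cvg_Rintegral_mass.2.
have iA A : measurable A -> P.-integrable setT (fun y => ((2 * pi) ^+ n * \1_A y)%:E).
  by move=> mA; apply: integrable_cmul; exact: integrable_indic.
have EA A : measurable A -> (2 * pi) ^+ n * fine (P A) = \int[P]_y ((2 * pi) ^+ n * \1_A y).
  move=> mA; rewrite RintegralZl//; last exact: integrable_indic.
  by rewrite /Rintegral integral_indic// setIT.
have fact0 i (y : 'rV[R]_n) :
    0 <= pi * (Num.sg (b ord0 i - y ord0 i) - Num.sg (a ord0 i - y ord0 i)).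
  rewrite mulr_ge0 ?pi_ge0// subr_ge0.
  by have := ab i; case: sgrP; case: sgrP => // *; lra.
have fact2 i (y : 'rV[R]_n) :
    pi * (Num.sg (b ord0 i - y ord0 i) - Num.sg (a ord0 i - y ord0 i)) <= 2 * pi.
  rewrite mulrC ler_pM2r ?pi_gt0//.
  by case: sgrP; case: sgrP => // *; lra.
have mO := measurable_obox a b; have mC := measurable_cbox a b.
rewrite !EA//; apply/andP; split; apply: le_Rintegral => //.
- by apply: iA.
- move=> y _; rewrite indicE; case: (boolP (y \in _)) => [|_]; last first.
    by rewrite mulr0 prodr_ge0.
  rewrite inE => yB; rewrite mulr1 /mass_lim -[n in leLHS]card_ord -prodr_const.
  rewrite le_eqVlt; apply/orP; left; apply/eqP; apply: eq_bigr => i _.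
  have := yB i; rewrite in_itv/= => /andP[ay yb].
  by rewrite gtr0_sg ?subr_gt0// ltr0_sg ?subr_lt0//; ring.
- by apply: iA.
- move=> y _; rewrite indicE; case: (boolP (y \in _)) => [_|yB].
    rewrite mulr1 /mass_lim -[n in leRHS]card_ord -prodr_const.
    by apply: ler_prod => i _; rewrite fact0 fact2.
  have [i yi] : exists i, ~ y ord0 i \in `[a ord0 i, b ord0 i].
    by apply/existsNP; move: yB; rewrite notin_setE.
  rewrite mulr0 /mass_lim (bigD1 i)//=.
  rewrite (_ : pi * _ = 0) ?mul0r//.
  have [ya|ay] := ltP (y ord0 i) (a ord0 i).
    by rewrite !gtr0_sg ?subr_gt0// ?(lt_trans ya)// subrr mulr0.
  have [lby|yb] := ltP (b ord0 i) (y ord0 i).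
    by rewrite !ltr0_sg ?subr_lt0// ?(lt_trans (ab i))// subrr mulr0.
  by exfalso; apply: yi; rewrite in_itv/= ay yb.
Qed.

End inversion.

Section density_measure.
Context d (T : measurableType d) (R : realType) (mu : {measure set T -> \bar R}).
Variables (g : T -> R) (mg : measurable_fun [set: T] g) (g0 : forall x, 0 <= g x).

(* The two proofs are arguments so that the measure structure can be inferred. *)
Definition density_measure of measurable_fun [set: T] g & (forall x, 0 <= g x) :=
  fun B : set T => (\int[mu]_(x in B) (g x)%:E)%E.

Local Notation Q := (density_measure mg g0).

Let density_measure0 : Q set0 = 0%E.
Proof. exact: integral_set0. Qed.

Let density_measure_ge0 B : (0 <= Q B)%E.
Proof. by apply: integral_ge0 => x _; rewrite lee_fin. Qed.

Let density_measure_sigma_additive : semi_sigma_additive Q.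
Proof.
move=> F mF tF mUF; rewrite /density_measure ge0_integral_bigcup//=; last 2 first.
- by apply/measurable_EFinP; exact: measurable_funTS.
- by move=> x _; rewrite lee_fin.
apply: is_cvg_ereal_nneg_natsum_cond => n _ _.
by apply: integral_ge0 => x _; rewrite lee_fin.
Qed.

HB.instance Definition _ := isMeasure.Build _ _ _ Q
  density_measure0 density_measure_ge0 density_measure_sigma_additive.

End density_measure.

(** * Measures determined by their values on boxes *)

Section box_uniqueness.
Variables (R : realType) (n : nat).
Implicit Types (a b : 'rV[R]_n).

Lemma oboxI a b a' b' : obox a b `&` obox a' b' =
  obox (\row_i Num.max (a ord0 i) (a' ord0 i)) (\row_i Num.min (b ord0 i) (b' ord0 i)).
Proof.
apply/seteqP; split => [v [vab vab'] i|v vI].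
  rewrite !mxE in_itv/= gt_max lt_min.
  move: (vab i) (vab' i); rewrite !in_itv/= => /andP[h1 h2] /andP[h3 h4].
  by rewrite h1 h2 h3 h4.
by split=> i; have := vI i; rewrite !mxE !in_itv/= gt_max lt_min => /andP[/andP[h1 h2] /andP[h3 h4]]; rewrite ?h1 ?h2 ?h3 ?h4.
Qed.

(** An open set is the union of the boxes with rational corners that it contains, and these are
    countably many. *)
Lemma sigma_algebra_obox :
  @measurable _ 'rV[R]_n = <<s [set obox p.1 p.2 | p in [set: 'rV[R]_n * 'rV[R]_n]] >>.
Proof.
apply/seteqP; split; last first.
  apply: smallest_sub; first exact: sigma_algebra_measurable.
  by move=> _ [p _ <-]; exact: measurable_obox.
apply: smallest_sub; first exact: smallest_sigma_algebra.
move=> U oU.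
pose G : set (set 'rV[R]_n) := [set obox p.1 p.2 | p in [set: 'rV[R]_n * 'rV[R]_n]].
pose B (q : 'rV[rat]_n * 'rV[rat]_n) : set 'rV[R]_n :=
  obox (map_mx ratr q.1) (map_mx ratr q.2).
have -> : U = \bigcup_(q in [set q | B q `<=` U]) B q.
  apply/seteqP; split=> [x Ux|x [q /= sqU] /sqU //].
  have /nbhs_ballP[e /= e0 eU] : nbhs x U by apply: open_nbhs_nbhs; split.
  have lP (i : 'I_n) : exists s : rat, ratr s \in `](x ord0 i - e), (x ord0 i)[%R.
    by apply: rat_in_itvoo; rewrite ltrBlDr ltrDl.
  have rP (i : 'I_n) : exists s : rat, ratr s \in `](x ord0 i), (x ord0 i + e)[%R.
    by apply: rat_in_itvoo; rewrite ltrDl.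
  have [l lE] := choice lP; have [r rE] := choice rP.
  exists (\row_i l i, \row_i r i) => /=; last first.
    move=> i; rewrite !mxE in_itv/=.
    by move: (lE i) (rE i); rewrite !in_itv/= => /andP[_ ->] /andP[-> _].
  move=> v /= Bv; apply: eU; split=> // i j; rewrite ord1 /ball/= distrC ltr_distl.
  have := Bv j; rewrite !mxE !in_itv/= => /andP[lv vr].
  move: (lE j) (rE j); rewrite !in_itv/= => /andP[xl _] /andP[_ rx].
  by rewrite (lt_trans xl lv) (lt_trans vr rx).
have -> : \bigcup_(q in [set q | B q `<=` U]) B q =
  \bigcup_(q in [set: 'rV[rat]_n * 'rV[rat]_n]) (if `[< B q `<=` U >] then B q else set0).
  rewrite bigcup_mkcond; apply: eq_bigcupr => q _.
  by case: asboolP => h; [rewrite mem_set|rewrite memNset].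
pose TG := g_sigma_algebraType G.
suff : @measurable _ TG (\bigcup_(q in [set: 'rV[rat]_n * 'rV[rat]_n]) (if `[< B q `<=` U >] then B q else set0)) by [].
apply: countable_bigcupT_measurable => [|q]; first exact: countableP.
case: asboolP => _ //; apply: sub_sigma_algebra.
by exists (map_mx ratr q.1, map_mx ratr q.2).
Qed.

Lemma obox_cover : \bigcup_k obox (const_mx (- k%:R)) (const_mx k%:R) = [set: 'rV[R]_n].
Proof.
apply/seteqP; split=> // v _.
exists (Num.bound (enorm v)) => // i; rewrite !mxE in_itv/= -ltr_norml.
rewrite (le_lt_trans (normr_coord_le_enorm _ _))//.
by have := archi_boundP (enorm_ge0 v).
Qed.

(** Open boxes are stable under intersection, generate the Borel sets and exhaust the space by sets
    of finite mass, as the uniqueness theorem for measures asks. *)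
Lemma measure_unique_obox (m1 m2 : {measure set 'rV[R]_n -> \bar R}) :
  (forall a b, (m1 (obox a b) < +oo)%E) ->
  (forall a b, m1 (obox a b) = m2 (obox a b)) ->
  forall A, measurable A -> m1 A = m2 A.
Proof.
move=> m1oo m12; apply: (measure_unique
  [set obox p.1 p.2 | p in [set: 'rV[R]_n * 'rV[R]_n]]
  (fun k => obox (const_mx (- k%:R)) (const_mx k%:R))).
- exact: sigma_algebra_obox.
- by move=> _ _ [p _ <-] [q _ <-]; rewrite oboxI; eexists (_, _).
- by move=> k; exists (const_mx (- k%:R), const_mx k%:R).
- exact: obox_cover.
- by move=> _ [p _ <-]; exact: m12.
- by move=> k; exact: m1oo.
Qed.

(* Shrinking boxes absorbs the boundary: an inequality between the open box
   for one measure and the closed box for the other passes to open boxes. *)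
Lemma le_measure_obox (m1 m2 : {measure set 'rV[R]_n -> \bar R}) :
  (forall a b, (forall i, a ord0 i < b ord0 i) -> (m1 (obox a b) <= m2 (cbox a b))%E) ->
  forall a b, (m1 (obox a b) <= m2 (obox a b))%E.
Proof.
move=> m12 a b.
have [ab|] := pselect (forall i, a ord0 i < b ord0 i); last first.
  move=> /existsNP[i /negP]; rewrite -leNgt => ba.
  rewrite (_ : obox a b = set0) ?measure0//.
  by apply/seteqP; split=> v //= /(_ i); rewrite in_itv/= => /andP[av vb]; have := lt_le_trans (lt_trans av vb) ba; rewrite ltxx.
(* Each side is shortened at both ends by the fraction 1 / (k + 3), so that a positive length
   remains already for [k = 0]. *)
pose al k : 'rV[R]_n := \row_i (a ord0 i + (b ord0 i - a ord0 i) / k.+3%:R).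
pose be k : 'rV[R]_n := \row_i (b ord0 i - (b ord0 i - a ord0 i) / k.+3%:R).
have ba i : 0 < b ord0 i - a ord0 i by rewrite subr_gt0.
have albe k i : al k ord0 i < be k ord0 i.
  rewrite !mxE -subr_gt0.
  rewrite (_ : _ - _ = (b ord0 i - a ord0 i) * (1 - 2 / k.+3%:R)); last by ring.
  by rewrite mulr_gt0// subr_gt0 ltr_pdivrMr// mul1r ltr_nat.
have step k l i : (k <= l)%N ->
    (b ord0 i - a ord0 i) / l.+3%:R <= (b ord0 i - a ord0 i) / k.+3%:R.
  by move=> kl; rewrite ler_pM2l// lef_pV2 ?posrE// ler_nat !ltnS.
(* The shrunken boxes, open or closed according to [o], increase to the same open box, so continuity
   from below serves both measures. *)
have cover (o : bool) : \bigcup_k (if o then obox (al k) (be k) else cbox (al k) (be k)) = obox a b.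
  apply/seteqP; split.
    move=> v [k _] vk i; rewrite in_itv/=.
    have d0 : 0 < (b ord0 i - a ord0 i) / k.+3%:R by rewrite divr_gt0.
    by case: o vk => /(_ i); rewrite !mxE in_itv/=; move: d0;
      set e := _ / _ => d0 /andP[h1 h2]; apply/andP; split; lra.
  move=> v vab.
  have [k kP] : exists k : nat, forall i,
      (b ord0 i - a ord0 i) / k.+3%:R < v ord0 i - a ord0 i /\
      (b ord0 i - a ord0 i) / k.+3%:R < b ord0 i - v ord0 i.
    pose K i := maxn (Num.bound ((b ord0 i - a ord0 i) / (v ord0 i - a ord0 i)))
      (Num.bound ((b ord0 i - a ord0 i) / (b ord0 i - v ord0 i))).
    exists (\max_(i < n) K i) => i.
    have Kl : (K i <= \max_(i < n) K i)%N by exact: leq_bigmax.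
    have := vab i; rewrite in_itv/= => /andP[av vb].
    have lt_k (x : R) : 0 < x -> (Num.bound ((b ord0 i - a ord0 i) / x) <= K i)%N ->
        (b ord0 i - a ord0 i) / (\max_(i < n) K i).+3%:R < x.
      move=> x0 xK; rewrite ltr_pdivrMr// mulrC -ltr_pdivrMr//.
      apply: lt_le_trans (archi_boundP _) _.
        by rewrite divr_ge0// ltW.
      by rewrite ler_nat (leq_trans xK)// (leq_trans Kl)// !leqW.
    by split; apply: lt_k; rewrite ?subr_gt0// ?leq_maxl ?leq_maxr.
  exists k => //; case: o => i; rewrite !mxE in_itv/=; have [] := kP i;
    by set e := _ / _ => h1 h2; apply/andP; split; lra.
have cvgm (m : {measure set 'rV[R]_n -> \bar R}) (o : bool) :
   m (if o then obox (al k) (be k) else cbox (al k) (be k)) @[k --> \oo] --> m (obox a b).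
  rewrite -(cover o); apply: (@nondecreasing_cvg_mu _ _ _ m
    (fun k => if o then obox (al k) (be k) else cbox (al k) (be k))).
  - by move=> k; case: o; [exact: measurable_obox|exact: measurable_cbox].
  - by rewrite cover; exact: measurable_obox.
  - move=> k l kl; apply/subsetPset => v.
    by case: o => vk i; have := vk i; have := step _ _ i kl;
      rewrite !mxE !in_itv/=; set e := _ / _; set e' := _ / _ => h /andP[h1 h2];
      apply/andP; split; lra.
apply: (lee_cvg_to (cvgm m1 true) (cvgm m2 false)); apply: nearW => k.
by apply: m12 => i; exact: albe.
Qed.
End box_uniqueness.

Section inversion_density.
Variables (R : realType) (n : nat) (P : probability 'rV[R]_n R) (c : 'rV[R]_n)
  (phi : 'rV[R]_n -> R).
Notation leb := (lebesgue_rV R n).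
Hypotheses (iphi : leb.-integrable setT (EFin \o phi))
  (cfc : forall xi, \int[P]_y cos (dot xi y) = phi xi * cos (dot xi c))
  (cfs : forall xi, \int[P]_y sin (dot xi y) = phi xi * sin (dot xi c)).

Definition cf_density (x : 'rV[R]_n) : R := ((2 * pi) ^+ n)^-1 * cosint phi (x - c).

Lemma cf_density_ge0 x : 0 <= cf_density x.
Proof.
rewrite mulr_ge0 ?(cosint_cf_ge0 iphi cfc cfs)//.
by rewrite invr_ge0 exprn_ge0// mulr_ge0// pi_ge0.
Qed.

Lemma measurable_cf_density : measurable_fun setT cf_density.
Proof. by apply: measurable_funM => //; exact: (measurable_cosint_cf iphi cfc cfs). Qed.

Let Q : {measure set _ -> \bar R} := density_measure leb measurable_cf_density cf_density_ge0.

Let Q_cbox (a b : 'rV[R]_n) : (forall i, a ord0 i < b ord0 i) ->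
  (P (obox a b) <= Q (cbox a b) <= P (cbox a b))%E.
Proof.
move=> ab.
have twopi : 0 < (2 * pi) ^+ n :> R by rewrite exprn_gt0// mulr_gt0// pi_gt0.
have i1 : leb.-integrable setT (fun x => (\1_(cbox a b) x * cosint phi (x - c))%:E).
  apply: (integrable_mul_bounded (integrable_indic_cbox ab) (D := \int[leb]_xi `|phi xi|)).
    exact: (measurable_cosint_cf iphi cfc cfs).
  by move=> x; exact: normr_cosint_le.
have -> : Q (cbox a b) = (((2 * pi) ^+ n)^-1 * \int[leb]_x (\1_(cbox a b) x * cosint phi (x - c)))%:E.
  rewrite EFinM EFin_Rintegral// -integralZl// /Q /= /density_measure integral_mkcond.
  apply: eq_integral => x _; rewrite patchE indicE /cf_density.
  by case: ifPn => _; rewrite ?mul1r ?mul0r ?mule0// -EFinM.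
have /andP[h1 h2] := Rintegral_cbox_cosint iphi cfc cfs ab.
rewrite -(fineK (fin_num_measure P _ (measurable_obox a b))).
rewrite -[P (cbox a b)](fineK (fin_num_measure P _ (measurable_cbox a b))).
by rewrite !lee_fin mulrC ler_pdivlMr// ler_pdivrMr// ![_ * (2 * pi) ^+ n]mulrC h1 h2.
Qed.

(** [Q_cbox] bounds [P] of the open box by [Q] of the closed one, and also [Q] of the open box by
    [P] of the closed one; [le_measure_obox] turns these into equality on open boxes. *)
Theorem probability_cf_density B : measurable B ->
  P B = (\int[leb]_(x in B) (cf_density x)%:E)%E.
Proof.
move=> mB; apply: (@measure_unique_obox R n P Q) => //.
  by move=> a b; rewrite ltey_eq fin_num_measure//; exact: measurable_obox.
move=> a b; apply/eqP; rewrite eq_le; apply/andP; split.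
- by apply: (@le_measure_obox R n P Q) => a' b' ab; case/andP: (Q_cbox ab).
- apply: (@le_measure_obox R n Q P) => a' b' ab.
  have /andP[_] := Q_cbox ab; apply: le_trans; apply: le_measure; rewrite ?inE.
  + exact: measurable_obox.
  + exact: measurable_cbox.
  + move=> v h i; move: (h i); rewrite !in_itv/= => /andP[h1 h2].
    by rewrite !ltW.
Qed.

End inversion_density.

(** * Smoothness and uniqueness of the density *)

Section trig_bounds.
Variable R : realType.
Implicit Types a u x y z : R.

Let MVT_le (f df : R -> R) x y : (forall z : R, is_derive z 1 f (df z)) ->
  exists2 z, `|z - x| <= `|y - x| & f y - f x = df z * (y - x).
Proof.
move=> fdf; have cf (z : R) : {for z, continuous f}.
  by apply/differentiable_continuous/derivable1_diffP; case: (fdf z).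
have [xy|yx] := leP x y.
  have [z] := MVT_segment xy (fun z _ => fdf z) (continuous_subspaceT cf).
  rewrite in_itv/= => /andP[xz zy] fE; exists z => //.
  by rewrite !ger0_norm ?subr_ge0// lerD2r.
have [z] := MVT_segment (ltW yx) (fun z _ => fdf z) (continuous_subspaceT cf).
rewrite in_itv/= => /andP[yz zx] fE; exists z.
  by rewrite !ler0_norm ?subr_le0 ?(ltW yx)// lerN2 lerD2r.
by rewrite -opprB fE -mulrN opprB.
Qed.

Lemma sin_lipschitz x y : `|sin y - sin x| <= `|y - x|.
Proof.
have [z _ ->] := MVT_le x y (fun z => is_derive_sin z).
by rewrite normrM ler_piMl// cos_max.
Qed.

Lemma cos_lipschitz x y : `|cos y - cos x| <= `|y - x|.
Proof.
have [z _ ->] := MVT_le x y (fun z => is_derive_cos z).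
by rewrite normrM ler_piMl// normrN sin_max.
Qed.

Lemma normr_sinB_le x y : `|sin y - sin x| <= Num.min 2 `|y - x|.
Proof.
rewrite le_min sin_lipschitz andbT (le_trans (ler_normB _ _))//.
by rewrite -[2]/(1 + 1) lerD// sin_max.
Qed.

(** The minimum keeps the remainder of first order in [u] for large [u], so that after integration
    against phi only the first moment of phi has to be finite. *)
Lemma cos_taylor1 a u : `|cos (a + u) - cos a + u * sin a| <= `|u| * Num.min 2 `|u|.
Proof.
have [z] := MVT_le a (a + u) (fun z => is_derive_cos z).
rewrite [a + u - a]addrC addKr => zu ->.
rewrite (_ : _ + _ = u * (sin a - sin z)); last by ring.
rewrite normrM ler_wpM2l// (le_trans (normr_sinB_le _ _))// le_min.
by rewrite !ge_min lexx/= distrC zu orbT.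
Qed.

Lemma onem_cos_le u : 1 - cos u <= u ^+ 2.
Proof.
have := cos_taylor1 0 u; rewrite add0r cos0 sin0 mulr0 addr0 distrC => h.
rewrite (le_trans (ler_norm _))// (le_trans h)// -real_normK ?num_real// expr2.
by rewrite ler_wpM2l// ge_min lexx orbT.
Qed.

End trig_bounds.

Section cosint_differentiable.
Variables (R : realType) (n : nat) (phi : 'rV[R]_n -> R).
Notation leb := (lebesgue_rV R n).
Hypotheses (iphi : leb.-integrable setT (EFin \o phi))
  (iphi1 : leb.-integrable setT (fun xi => (phi xi * enorm xi)%:E)).
Implicit Types (x y v : 'rV[R]_n).

Let mphi : measurable_fun setT phi.
Proof. by apply/measurable_EFinP; case/integrableP: iphi. Qed.

(** A modulus of continuity for the gradient of [cosint phi]. It tends to 0 with [e] by dominated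
    convergence, with the first moment of phi, doubled, as majorant. *)
Let om (e : R) : R := \int[leb]_xi (`|phi xi * enorm xi| * Num.min 2 (e * enorm xi)).

Let mom (e : R) : measurable_fun setT (fun xi : 'rV[R]_n => Num.min 2 (e * enorm xi)).
Proof.
by apply: measurable_minr => //; apply: measurable_funM => //; exact: measurable_enorm.
Qed.

Let normr_om (e : R) (xi : 'rV[R]_n) : 0 <= e -> `|Num.min 2 (e * enorm xi)| <= 2.
Proof.
by move=> e0; rewrite ger0_norm ?ge_min ?lexx// le_min ?ler0n mulr_ge0// enorm_ge0.
Qed.

Let iom (e : R) : 0 <= e ->
  leb.-integrable setT (fun xi => (`|phi xi * enorm xi| * Num.min 2 (e * enorm xi))%:E).
Proof.
move=> e0; apply: (integrable_mul_bounded (integrable_norm iphi1) (D := 2)).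
- exact: mom.
- by move=> xi; exact: normr_om.
Qed.

Let le_om e e' : 0 <= e -> e <= e' -> om e <= om e'.
Proof.
move=> e0 ee'; apply: le_Rintegral => //.
- exact: iom.
- by apply: iom; exact: le_trans ee'.
- move=> xi _; rewrite ler_wpM2l// le_min ge_min lexx/= ge_min orbC.
  by rewrite ler_wpM2r// enorm_ge0.
Qed.

Let om_cvg0 : (fun k => om k.+1%:R^-1) @ \oo --> (0 : R).
Proof.
have [] // := @Rintegral_dct _ _ R leb
  (fun k xi => `|phi xi * enorm xi| * Num.min 2 (k.+1%:R^-1 * enorm xi))
  (cst 0) (fun xi => 2 * `|phi xi * enorm xi|).
- move=> k; apply: measurable_funM; last exact: mom.
  by apply: measurableT_comp => //; apply: measurable_funM => //; exact: measurable_enorm.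
- move=> xi; apply/cvgr0Pnorm_le => e e0.
  have h : `|phi xi * enorm xi| * (k.+1%:R^-1 * enorm xi) @[k --> \oo] --> (0 : R).
    rewrite -(mulr0 `|phi xi * enorm xi|); apply: cvgM; first exact: cvg_cst.
    by rewrite -(mul0r (enorm xi)); apply: cvgM; [exact: cvg_harmonic|exact: cvg_cst].
  have /cvgr0_norm_le/(_ e e0) := h; apply: filterS => k; apply: le_trans.
  rewrite !normrM ler_wpM2l// !ger0_norm ?ge_min ?lexx ?orbT//.
  + by rewrite enorm_ge0.
  + by rewrite le_min ler0n mulr_ge0 ?enorm_ge0.
- move=> k xi; rewrite normrM normr_id mulrC ler_wpM2r// normr_om//.
- by apply: integrable_cmul; exact: (integrable_norm iphi1).
by rewrite /Rintegral integral0.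
Qed.

Let om_small e : 0 < e -> exists2 r, 0 < r & forall s, 0 <= s -> s <= r -> om s <= e.
Proof.
move=> e0; have /cvgr0_norm_le/(_ e e0) [k _ /(_ k (leqnn k))/= kP] := om_cvg0.
exists k.+1%:R^-1 => // s s0 sk; apply: (le_trans (le_om s0 sk)).
by apply: le_trans kP; exact: ler_norm.
Qed.

Definition dcosint x v : R := - \int[leb]_xi (phi xi * sin (dot xi x) * dot xi v).

Let idcosint x v :
  leb.-integrable setT (fun xi => (phi xi * sin (dot xi x) * dot xi v)%:E).
Proof.
apply: (@integrable_dominated _ _ _ leb _ (fun xi => enorm v * `|phi xi * enorm xi|)).
- apply: measurable_funM; last exact: measurable_dotl.
  by apply: measurable_funM => //; exact: measurable_sindotl.
- move=> xi; rewrite !normrM (ger0_norm (enorm_ge0 xi)).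
  rewrite (le_trans (y := `|phi xi| * 1 * (enorm xi * enorm v)))//.
    by rewrite ler_pM ?mulr_ge0// ?ler_wpM2l ?sin_max// CauchySchwarz_dot.
  by rewrite mulr1 mulrA mulrC.
- by apply: integrable_cmul; exact: (integrable_norm iphi1).
Qed.

Let dcosint_linear x : linear (dcosint x : 'rV[R]_n -> R^o).
Proof.
move=> a u v; rewrite /dcosint.
transitivity (- \int[leb]_xi (a * (phi xi * sin (dot xi x) * dot xi u) +
    phi xi * sin (dot xi x) * dot xi v)).
  by congr (- _); apply: eq_Rintegral => xi _; rewrite dotDr dotZr; ring.
rewrite RintegralD//; [|by apply: integrable_cmul; exact: idcosint|exact: idcosint].
rewrite RintegralZl//; last exact: idcosint.
by rewrite opprD -mulrN.
Qed.

Let cosint_taylor x v :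
  `|cosint phi (x + v) - cosint phi x - dcosint x v| <= enorm v * om (enorm v).
Proof.
have iv := integrable_cosint (x + v) iphi; have ix := integrable_cosint x iphi.
rewrite /cosint /dcosint opprK -RintegralB//.
have ivx : leb.-integrable setT
    (fun xi => (phi xi * cos (dot xi (x + v)) - phi xi * cos (dot xi x))%:E).
  exact: (integrableB measurableT iv ix).
rewrite -RintegralD//; last exact: idcosint.
have itot : leb.-integrable setT
    (fun xi => (phi xi * cos (dot xi (x + v)) - phi xi * cos (dot xi x) +
       phi xi * sin (dot xi x) * dot xi v)%:E).
  exact: (integrableD measurableT ivx (idcosint x v)).
apply: (le_trans (le_normr_Rintegral measurableT itot)).
rewrite -RintegralZl//; last by apply: iom; exact: enorm_ge0.
apply: le_Rintegral => //.
- exact: (integrable_norm itot).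
- by apply: integrable_cmul; apply: iom; exact: enorm_ge0.
move=> xi _.
rewrite (_ : _ + _ = phi xi * (cos (dot xi x + dot xi v) - cos (dot xi x) + dot xi v * sin (dot xi x))); last by rewrite dotDr; ring.
rewrite normrM (le_trans (ler_wpM2l _ (cos_taylor1 _ _)))//.
rewrite [leRHS]mulrCA !normrM (ger0_norm (enorm_ge0 xi)) -!mulrA ler_wpM2l//.
have cs : `|dot xi v| <= enorm xi * enorm v := CauchySchwarz_dot xi v.
rewrite [leRHS]mulrA ler_pM//.
by rewrite le_min !ge_min lexx/= [enorm v * _]mulrC cs orbT.
Qed.

Let dcosint_lipschitz_om x y v : `|dcosint x v - dcosint y v| <= enorm v * om (enorm (x - y)).
Proof.
rewrite /dcosint -opprD normrN -RintegralB//; try exact: idcosint.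
have itot : leb.-integrable setT (fun xi =>
   (phi xi * sin (dot xi x) * dot xi v - phi xi * sin (dot xi y) * dot xi v)%:E).
  exact: (integrableB measurableT (idcosint x v) (idcosint y v)).
apply: (le_trans (le_normr_Rintegral measurableT itot)).
rewrite -RintegralZl//; last by apply: iom; exact: enorm_ge0.
apply: le_Rintegral => //.
- exact: (integrable_norm itot).
- by apply: integrable_cmul; apply: iom; exact: enorm_ge0.
move=> xi _; rewrite -mulrBl -mulrBr !normrM (ger0_norm (enorm_ge0 xi)).
rewrite [leRHS]mulrCA -!mulrA ler_wpM2l// [leLHS]mulrC [leRHS]mulrA ler_pM//.
  exact: CauchySchwarz_dot.
rewrite (le_trans (normr_sinB_le _ _))// -dotBr le_min !ge_min lexx/= [_ * enorm xi]mulrC.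
by rewrite CauchySchwarz_dot orbT.
Qed.

Lemma normr_dcosint_le x v : `|dcosint x v| <= enorm v * \int[leb]_xi `|phi xi * enorm xi|.
Proof.
rewrite /dcosint normrN (le_trans (le_normr_Rintegral measurableT (idcosint x v)))//.
rewrite -RintegralZl//; last exact: (integrable_norm iphi1).
apply: le_Rintegral => //.
- exact: (integrable_norm (idcosint x v)).
- by apply: integrable_cmul; exact: (integrable_norm iphi1).
move=> xi _; rewrite !normrM (ger0_norm (enorm_ge0 xi)).
rewrite [leRHS]mulrCA -mulrA ler_wpM2l// (le_trans (y := 1 * `|dot xi v|))//.
  by rewrite ler_wpM2r// sin_max.
by rewrite mul1r [leRHS]mulrC CauchySchwarz_dot.
Qed.

Variables (k : R) (c : 'rV[R]_n).
Let q x := k * cosint phi (x - c).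

Let dq x : 'rV[R]_n -> R^o := fun v => k * dcosint (x - c) v.

Let dq_linear x : linear (dq x).
Proof.
by move=> a u v; rewrite /dq dcosint_linear mulrDr; congr (_ + _); exact: mulrCA.
Qed.

Let enorm_coord_cvg x e : 0 < e -> \forall y \near x, enorm (y - x) <= e.
Proof.
move=> e0; have n0 : 0 < n.+1%:R :> R by [].
(* [n.+1] in place of the comparison constant [n] keeps the radius positive for [n = 0]. *)
apply/nbhs_ballP; exists (e / n.+1%:R) => /=; first by rewrite divr_gt0.
move=> y; rewrite -ball_normE/= distrC => /ltW; rewrite ler_pdivlMr// => h.
rewrite (le_trans (enorm_le_mx_norm _))// (le_trans _ h)// mulrC ler_wpM2l//.
by rewrite ler_nat.
Qed.

Let dq_continuous x : continuous (dq x).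
Proof.
move=> y; pose K := `|k| * \int[leb]_xi `|phi xi * enorm xi|.
have K0 : 0 <= K by rewrite mulr_ge0// Rintegral_ge0.
apply/(cvgrPdist_le (FF := nbhs_filter y)) => e e0.
have /enorm_coord_cvg := divr_gt0 e0 (ltr_pwDl ltr01 K0).
move=> /(_ y); apply: filterS => z; rewrite ler_pdivlMr; last by rewrite ltr_pwDl.
apply: le_trans; rewrite -opprB normrN.
have -> : dq x z - dq x y = dq x (z - y).
  by rewrite (_ : z - y = -1 *: y + z) ?dq_linear ?scaleN1r 1?addrC.
rewrite normrM (le_trans (ler_wpM2l _ (normr_dcosint_le _ _)))// mulrCA ler_wpM2l ?enorm_ge0//.
by rewrite -/K lerDr.
Qed.

Let q_taylor x : (q : 'rV[R]_n -> R^o) \o shift x = cst (q x : R^o) + dq x +o_ (0 : 'rV[R]_n) id.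
Proof.
apply/eqaddoP => e e0.
have kn0 : 0 < (`|k| + 1) * n.+1%:R by rewrite mulr_gt0// ltr_wpDl.
have [r r0 rP] := om_small (divr_gt0 e0 kn0).
have := enorm_coord_cvg 0 r0; apply: filterS => v; rewrite subr0 => vr.
rewrite /= !fctE /q /dq -[v + x - c]addrA [v + _]addrC.
rewrite (_ : _ - _ = k * (cosint phi (x - c + v) - cosint phi (x - c) - dcosint (x - c) v)); last by ring.
rewrite normrM (le_trans (ler_wpM2l _ (cosint_taylor _ _)))//.
have := rP _ (enorm_ge0 v) vr; rewrite ler_pdivlMr// => omv.
have om0 : 0 <= om (enorm v).
  apply: Rintegral_ge0 => xi _; rewrite mulr_ge0// le_min ler0n.
  by rewrite mulr_ge0 ?enorm_ge0.
have nv : enorm v <= n.+1%:R * `|v|.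
  by rewrite (le_trans (enorm_le_mx_norm v))// ler_wpM2r// ler_nat.
apply: (le_trans _ (ler_wpM2r (normr_ge0 v) omv)).
have : `|k| * (enorm v * om (enorm v)) <= (`|k| + 1) * (n.+1%:R * `|v| * om (enorm v)).
  by rewrite ler_pM ?mulr_ge0 ?enorm_ge0 ?lerDl ?ler01// ler_wpM2r.
by move=> /le_trans; apply; rewrite le_eqVlt; apply/orP; left; apply/eqP; ring.
Qed.

Let diff_q x : 'd (q : 'rV[R]_n -> R^o) x = dq x :> (_ -> _).
Proof.
(* [dq x] is bundled as a linear map so that the uniqueness of the differential identifies it. *)
pose lM := GRing.isLinear.Build _ _ _ _ _ (dq_linear x).
pose L : {linear 'rV[R]_n -> R^o} := HB.pack (dq x) lM.
by apply: (@diff_unique _ _ _ _ L); [exact: dq_continuous|exact: q_taylor].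
Qed.

Lemma differentiable_cosint x : differentiable (q : 'rV[R]_n -> R^o) x.
Proof.
apply/diff_locallyP; rewrite diff_q; split; first exact: dq_continuous.
exact: q_taylor.
Qed.

Let derive_q x v : 'D_v q x = k * dcosint (x - c) v.
Proof. by rewrite (deriveE _ (differentiable_cosint x)) diff_q. Qed.

Lemma Cb1_cosint : Cb1 q.
Proof.
split.
- exact: differentiable_cosint.
- move=> i x; under eq_fun do rewrite derive_q.
  apply: (cvgM (FF := nbhs_filter x)); first exact: cst_continuous.
  pose v : 'rV[R]_n := delta_mx ord0 i.
  apply/(cvgrPdist_le (FF := nbhs_filter x)) => e e0.
  have v0 : 0 < enorm v + 1 by rewrite ltr_wpDl// enorm_ge0.
  have [r r0 rP] := om_small (divr_gt0 e0 v0).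
  have := enorm_coord_cvg x r0; apply: filterS => y yr.
  rewrite (le_trans (dcosint_lipschitz_om _ _ _))//.
  have {}yr : enorm (x - c - (y - c)) <= r.
    by rewrite opprB addrA subrK -enormN opprB.
  have := rP _ (enorm_ge0 _) yr; rewrite ler_pdivlMr// mulrC; apply: le_trans.
  rewrite ler_wpM2r ?lerDl//; apply: Rintegral_ge0 => xi _; rewrite mulr_ge0// le_min ler0n.
  by rewrite mulr_ge0 ?enorm_ge0.
- exists (`|k| * \int[leb]_xi `|phi xi|) => x; rewrite normrM ler_wpM2l//.
  exact: normr_cosint_le.
- exists (`|k| * \int[leb]_xi `|phi xi * enorm xi|) => x i.
  rewrite derive_q normrM ler_wpM2l// (le_trans (normr_dcosint_le _ _))//.
  rewrite ler_piMl ?Rintegral_ge0//.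
  rewrite -(@ler_pXn2r _ 2)// ?nnegrE ?enorm_ge0// sqr_enorm dot_delta mxE !eqxx.
  by rewrite expr1n.
Qed.

Lemma cosint_lipschitz x y :
  `|cosint phi x - cosint phi y| <= enorm (x - y) * \int[leb]_xi `|phi xi * enorm xi|.
Proof.
have ix := integrable_cosint x iphi; have iy := integrable_cosint y iphi.
rewrite /cosint -RintegralB//.
have ixy := integrableB measurableT ix iy.
apply: (le_trans (le_normr_Rintegral measurableT ixy)).
rewrite -RintegralZl//; last exact: (integrable_norm iphi1).
apply: le_Rintegral => //.
- exact: (integrable_norm ixy).
- by apply: integrable_cmul; exact: (integrable_norm iphi1).
move=> xi _; rewrite -mulrBr !normrM (ger0_norm (enorm_ge0 xi)) mulrCA ler_wpM2l//.
rewrite (le_trans (cos_lipschitz _ _))// -dotBr mulrC.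
exact: CauchySchwarz_dot.
Qed.

End cosint_differentiable.

Section density_uniqueness.
Variables (R : realType) (n : nat).
Notation leb := (lebesgue_rV R n).

Lemma le_continuous_density (p q : 'rV[R]_n -> R) : continuous p -> continuous q ->
  (forall x, 0 <= p x) -> (forall x, 0 <= q x) ->
  (forall B, measurable B -> (\int[leb]_(x in B) (p x)%:E <= \int[leb]_(x in B) (q x)%:E)%E) ->
  forall x, p x <= q x.
Proof.
move=> cp cq p0 q0 pq x; rewrite leNgt; apply/negP => qpx.
(* A third of the gap: on a small box both functions move by at most [e], so [p] still exceeds [q]
   by [e] there, and the box has positive finite volume. *)
pose e := (p x - q x) / 3.
have e0 : 0 < e by rewrite divr_gt0 ?subr_gt0.
have hp := (cvgrPdist_le (FF := nbhs_filter x) p (p x)).1 (cp x) e e0.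
have hq := (cvgrPdist_le (FF := nbhs_filter x) q (q x)).1 (cq x) e e0.
have hpq : nbhs x [set v | `|p x - p v| <= e /\ `|q x - q v| <= e].
  exact: (@filterI _ _ (nbhs_filter x) _ _ hp hq).
have [r /= r0 rP] := (nbhs_ballP x _).1 hpq.
pose a : 'rV[R]_n := \row_i (x ord0 i - r / 2).
pose b : 'rV[R]_n := \row_i (x ord0 i + r / 2).
have r20 : 0 < r / 2 by rewrite divr_gt0.
have ab i : a ord0 i < b ord0 i by rewrite !mxE; lra.
have inB v : cbox a b v -> p x - e <= p v /\ q v <= q x + e.
  move=> vB; have [/ler_normlP[h1 h2] /ler_normlP[h3 h4]] : `|p x - p v| <= e /\ `|q x - q v| <= e.
    apply: rP; split=> // i j; rewrite ord1 /ball/= distrC ltr_distl.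
    have := vB j; rewrite !mxE in_itv/= => /andP[h1 h2]; apply/andP; split; lra.
  by split; lra.
have mB := measurable_cbox a b.
pose V := fine (leb (cbox a b)).
have VE : leb (cbox a b) = V%:E.
  by rewrite fineK// ge0_fin_numE// lebesgue_rV_cbox_lty.
have V0 : 0 < V.
  rewrite /V lebesgue_rV_box/=; last by move=> i; rewrite ltW.
  by apply: prodr_gt0 => i _; rewrite subr_gt0.
have mp := continuous_measurable_rV cp; have mq := continuous_measurable_rV cq.
have : ((p x - e)%:E * V%:E <= (q x + e)%:E * V%:E)%E.
  rewrite -VE -!integral_cst//; apply: le_trans (le_trans (pq _ mB) _).
    apply: ge0_le_integral => //.
    - by move=> v _; rewrite lee_fin /e; have := p0 x; have := q0 x; lra.
    - by apply/measurable_EFinP; exact: measurable_funTS.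
    - by move=> v vB; rewrite lee_fin (inB v vB).1.
  apply: ge0_le_integral => //.
  - by move=> v _; rewrite lee_fin.
  - by apply/measurable_EFinP; exact: measurable_funTS.
  - by move=> v vB; rewrite lee_fin (inB v vB).2.
rewrite -!EFinM lee_fin ler_pM2r// /e; lra.
Qed.

(** [get] returns an unspecified admissible density; continuity of both densities forces it to be
    [q]. *)
Lemma densityE (mu : set 'rV[R]_n -> \bar R) (q : 'rV[R]_n -> R) :
  is_Cb1_density mu q -> density mu = q.
Proof.
move=> qmu; have pmu : is_Cb1_density mu (density mu) by exact: getI qmu.
have cont p : is_Cb1_density mu p -> continuous p.
  by case=> -[dp _ _ _] _ _ x; exact: differentiable_continuous.
apply/funext => x; apply/eqP; rewrite eq_le; apply/andP; split.
- apply: le_continuous_density; [exact: cont|exact: cont|by case: pmu|by case: qmu|].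
  by move=> B mB; case: pmu => _ _ <- //; case: qmu => _ _ <-.
- apply: le_continuous_density; [exact: cont|exact: cont|by case: qmu|by case: pmu|].
  by move=> B mB; case: pmu => _ _ <- //; case: qmu => _ _ <-.
Qed.

End density_uniqueness.

(** * Positive definite functions *)

Section positive_definite.
Variables (R : realType) (n : nat).
Notation leb := (lebesgue_rV R n).
Implicit Types (u v : 'rV[R]_n -> R) (x y z xi : 'rV[R]_n).

(** For even, continuous and integrable [u] this is positive definiteness, by Bochner's theorem;
    only the sign of the transform is ever used. *)
Definition posdef u := forall z, 0 <= cosint u z.

Lemma posdef_laplace_rV s : 0 < s -> posdef (@laplace_rV R n s).
Proof.
move=> s0 z; rewrite /cosint (Rintegral_laplace_rV z s0).1.
by rewrite poisson_kernel_ge0// ltW.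
Qed.

Lemma posdef_cvg (u_ : nat -> 'rV[R]_n -> R) u v :
  (forall k, measurable_fun setT (u_ k)) ->
  (forall x, u_ ^~ x @ \oo --> u x) ->
  (forall k x, `|u_ k x| <= v x) ->
  leb.-integrable setT (EFin \o v) ->
  (forall k, posdef (u_ k)) -> posdef u.
Proof.
move=> mu_ u_u u_v iv pu z; have h := cosint_dct (z := z) mu_ u_u u_v iv.
by apply: (cvgr_to_ge h); apply: nearW => k; exact: pu.
Qed.

Variable mu : {finite_measure set 'rV[R]_n -> \bar R}.

(** The [m] of the overview when [mu] is [nu] restricted to the large jumps. *)
Definition cosmass xi : R := \int[mu]_y cos (dot xi y).

Let lam : R := fine (mu setT).

Let mcos2 : measurable_fun setT (fun p : 'rV[R]_n * 'rV[R]_n => cos (dot p.1 p.2)).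
Proof.
apply: (measurableT_comp (f := @cos R)).
  by apply: continuous_measurable_fun; exact: continuous_cos.
exact: measurable_dot2.
Qed.

Lemma measurable_cosmass : measurable_fun setT cosmass.
Proof. by apply: (measurable_Rintegral1 mu mcos2 (C := 1)) => p; exact: cos_max. Qed.

Lemma normr_cosmass_le xi : `|cosmass xi| <= fine (mu setT).
Proof.
have ic : mu.-integrable setT (EFin \o (fun y => cos (dot xi y))).
  by apply: (@integrable_bounded _ _ _ _ _ 1); [exact: measurable_cosdot|move=> y; exact: cos_max].
apply: (le_trans (le_normr_Rintegral measurableT ic)).
rewrite -[leRHS]mul1r -(Rintegral_cst mu measurableT 1); apply: le_Rintegral => //.
- exact: (integrable_norm ic).
- exact: finite_measure_integrable_cst.
- by move=> y _; exact: cos_max.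
Qed.

(** The product formula for cosines turns multiplication by [cosmass] into convolution with the
    symmetrised measure. The division by 2 is the source of the 4 in the far estimate. *)
Lemma cosint_cosmass u z : leb.-integrable setT (EFin \o u) ->
  cosint (fun xi => u xi * cosmass xi) z =
  \int[mu]_y ((cosint u (z + y) + cosint u (z - y)) / 2).
Proof.
move=> iu; transitivity (\int[leb]_xi (u xi * \int[mu]_y (cos (dot xi z) * cos (dot xi y)))).
  apply: eq_Rintegral => xi _; rewrite RintegralZl//; first by rewrite /cosmass; ring.
  by apply: (@integrable_bounded _ _ _ _ _ 1); [exact: measurable_cosdot|move=> y; exact: cos_max].
rewrite (@Rintegral_Fubini _ _ _ _ _ leb mu u
   (fun p => cos (dot p.1 z) * cos (dot p.1 p.2)) 1)//.
- apply: eq_Rintegral => y _.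
  have i1 := integrable_cosint (z + y) iu; have i2 := integrable_cosint (z - y) iu.
  rewrite /cosint -RintegralD// -RintegralZr//; last exact: (integrableD measurableT i1 i2).
  by apply: eq_Rintegral => xi _; rewrite dotDr dotBr cosD cosB; field.
- apply: measurable_funM => //.
  apply: (measurableT_comp (f := fun xi => cos (dot xi z))) => //; exact: measurable_cosdotl.
- by move=> p; rewrite normrM -[leRHS]mul1r ler_pM// cos_max.
Qed.

Lemma posdef_cosmass u : leb.-integrable setT (EFin \o u) -> posdef u ->
  posdef (fun xi => u xi * cosmass xi).
Proof.
move=> iu pu z; rewrite cosint_cosmass//; apply: Rintegral_ge0 => y _.
by rewrite divr_ge0// addr_ge0.
Qed.

Let integrable_cosmassX u k : leb.-integrable setT (EFin \o u) ->
  leb.-integrable setT (fun xi => (u xi * cosmass xi ^+ k)%:E).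
Proof.
move=> iu; apply: (integrable_mul_bounded iu (D := lam ^+ k)).
  by apply: measurable_funX; exact: measurable_cosmass.
move=> xi; rewrite normrX lerXn2r// ?nnegrE//; last exact: normr_cosmass_le.
by rewrite fine_ge0.
Qed.

Let posdef_cosmassX u k : leb.-integrable setT (EFin \o u) -> posdef u ->
  posdef (fun xi => u xi * cosmass xi ^+ k).
Proof.
move=> iu pu; elim: k => [|k IH].
  by under eq_fun do rewrite expr0 mulr1.
under eq_fun do rewrite exprSr mulrA.
by apply: posdef_cosmass => //; exact: integrable_cosmassX.
Qed.

Variable t : R.
Hypothesis t0 : 0 <= t.

Let S k xi : R := series (exp_coeff (t * cosmass xi)) k.

Let SS k xi : S k.+1 xi = S k xi + (t * cosmass xi) ^+ k / k`!%:R.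
Proof. by rewrite /S /series/= big_nat_recr. Qed.

Let S_le k xi : `|S k xi| <= expR (t * lam).
Proof.
have tl : 0 <= t * lam by rewrite mulr_ge0// fine_ge0.
apply: (@le_trans _ _ (series (exp_coeff (t * lam)) k)).
  rewrite /S /series/= (le_trans (ler_norm_sum _ _ _))//; apply: ler_sum => i _.
  rewrite /exp_coeff/= normrM [X in _ * X]ger0_norm// ler_wpM2r// normrX.
  rewrite lerXn2r ?nnegrE// normrM (ger0_norm t0) ler_wpM2l//.
  exact: normr_cosmass_le.
apply: nondecreasing_cvgn_le; last exact: is_cvg_series_exp_coeff.
apply/nondecreasing_seqP => i; rewrite /series/= big_nat_recr//= lerDl.
by rewrite /exp_coeff/= divr_ge0// exprn_ge0.
Qed.

Let mS k : measurable_fun setT (S k).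
Proof.
elim: k => [|k IH].
  by rewrite (_ : S 0 = cst 0)//; apply/funext => xi; rewrite /S /series/= big_geq.
rewrite (funext (SS k)).
apply: measurable_funD => //; apply: measurable_funM => //.
by apply: measurable_funX; apply: measurable_funM => //; exact: measurable_cosmass.
Qed.

Let iS u k : leb.-integrable setT (EFin \o u) ->
  leb.-integrable setT (fun xi => (u xi * S k xi)%:E).
Proof.
by move=> iu; apply: (integrable_mul_bounded iu (D := expR (t * lam))).
Qed.

Let cosint_S u k z : leb.-integrable setT (EFin \o u) ->
  cosint (fun xi => u xi * S k.+1 xi) z =
  cosint (fun xi => u xi * S k xi) z +
    t ^+ k / k`!%:R * cosint (fun xi => u xi * cosmass xi ^+ k) z.
Proof.
move=> iu; rewrite /cosint -RintegralZl//; last first.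
  by apply: integrable_cosint; exact: integrable_cosmassX.
rewrite -RintegralD//.
- apply: eq_Rintegral => xi _; rewrite SS exprMn; ring.
- by apply: integrable_cosint; exact: iS.
- by apply: integrable_cmul; apply: integrable_cosint; exact: integrable_cosmassX.
Qed.

(** In the exponential series each term [u xi * cosmass xi ^+ k] has a nonnegative transform, so
    dropping all orders but 0 and 1 only lowers the value. The partial sums are dominated by
    [expR (t * lam) * |u|]. *)
Lemma cosint_expR_ge u z : leb.-integrable setT (EFin \o u) -> posdef u ->
  cosint u z + t * cosint (fun xi => u xi * cosmass xi) z <=
  cosint (fun xi => u xi * expR (t * cosmass xi)) z.
Proof.
move=> iu pu.
have mu_ : measurable_fun setT u by apply/measurable_EFinP; case/integrableP: iu.
(* [S k] consists of the first [k] terms, so [S k.+2] is where orders 0 and 1 are both present. *)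
have SE k : cosint u z + t * cosint (fun xi => u xi * cosmass xi) z <=
    cosint (fun xi => u xi * S k.+2 xi) z.
  elim: k => [|k IH].
    rewrite !cosint_S// (_ : (fun xi => u xi * S 0 xi) = fun=> 0); last first.
      by apply/funext => xi; rewrite /S /series/= big_geq// mulr0.
    rewrite (_ : cosint (fun=> 0) z = 0); last first.
      by rewrite /cosint; under eq_Rintegral do rewrite mul0r; rewrite /Rintegral integral0.
    rewrite add0r expr0 expr1 fact0 factS fact0 muln1 !divr1 mul1r.
    by under [in leRHS]eq_fun do rewrite expr0 mulr1.
  rewrite cosint_S// (le_trans IH)// lerDl mulr_ge0 ?divr_ge0 ?exprn_ge0//.
  exact: posdef_cosmassX.
have h : (fun k => cosint (fun xi => u xi * S k xi) z) @ \oo -->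
    cosint (fun xi => u xi * expR (t * cosmass xi)) z.
  apply: (@cosint_dct R n (fun k xi => u xi * S k xi)
    (fun xi => u xi * expR (t * cosmass xi)) (fun xi => expR (t * lam) * `|u xi|)).
  - by move=> k; apply: measurable_funM.
  - move=> xi; apply: cvgM; first exact: cvg_cst.
    exact: is_cvg_series_exp_coeff.
  - by move=> k xi; rewrite normrM mulrC ler_wpM2r.
  - by apply: integrable_cmul; exact: (integrable_norm iu).
by apply: (cvgr_to_ge h); exists 2%N => // -[|[|k]] //= _; exact: SE.
Qed.

Lemma posdef_expR u : leb.-integrable setT (EFin \o u) -> posdef u ->
  posdef (fun xi => u xi * expR (t * cosmass xi)).
Proof.
move=> iu pu z; apply: le_trans (cosint_expR_ge z iu pu).
by rewrite addr_ge0// mulr_ge0//; exact: posdef_cosmass.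
Qed.

End positive_definite.

(** * The characteristic exponent *)

(** [mfrestr] makes a finite measure out of [nu] on a set of finite mass, the form in which
    [cosmass] and the Fubini lemma can use it. *)
Lemma Rintegral_mfrestr d (T : measurableType d) (R : realType)
    (mu : {measure set T -> \bar R}) (D : set T) (mD : measurable D)
    (Doo : (mu D < +oo)%E) (f : T -> R) (C : R) :
  measurable_fun [set: T] f -> (forall x, `|f x| <= C) ->
  \int[mfrestr mD Doo]_x f x = \int[mu]_(x in D) f x.
Proof.
move=> mf fC; rewrite /Rintegral; congr fine.
have fi : (mfrestr mD Doo).-integrable [set: T] (EFin \o f).
  exact: (@integrable_bounded _ _ _ (mfrestr mD Doo) f C mf fC).
rewrite (@negligible_integral _ _ _ _ setT (~` D) (EFin \o f))//.
- rewrite setTD setCK; apply: eq_measure_integral => A mA AD.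
  exact: (congr1 mu (setIidl AD)).
- exact: measurableC.
- have : mu (~` D `&` D) = 0%E by rewrite setICl measure0.
  by [].
Qed.

Section levy_exponent_theory.
Variables (R : realType) (d : nat) (nu : {measure set 'rV[R]_d -> \bar R}).
Hypothesis nu_levy : levy_measure nu.
Implicit Types (xi x y b : 'rV[R]_d) (D : set 'rV[R]_d).

Let w y : R := Num.min 1 (enorm y ^+ 2).

Let w_ge0 y : 0 <= w y.
Proof. by rewrite le_min ler01 sqr_ge0. Qed.

Let mw : measurable_fun setT w.
Proof.
by apply: measurable_minr => //; apply: measurable_funX; exact: measurable_enorm.
Qed.

Let iw : nu.-integrable setT (EFin \o w).
Proof.
apply/integrableP; split; first exact/measurable_EFinP.
under eq_integral do rewrite /= ger0_norm//.
exact: nu_levy.2.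
Qed.

(** For |y| < 1 this is 1 - cos a <= a^2 with Cauchy-Schwarz, otherwise 1 - cos a <= 2; the factor
    covers both cases. *)
Let cos_bound xi y : `|1 - cos (dot xi y)| <= (2 + enorm xi ^+ 2) * w y.
Proof.
have c1 := cos_le1 (dot xi y); have c2 := cos_geN1 (dot xi y).
rewrite ger0_norm ?subr_ge0//.
have h := onem_cos_le (dot xi y).
have cs : dot xi y ^+ 2 <= enorm xi ^+ 2 * enorm y ^+ 2.
  by rewrite -exprMn -real_normK ?num_real// lerXn2r ?nnegrE ?mulr_ge0 ?enorm_ge0// CauchySchwarz_dot.
have x0 := sqr_ge0 (enorm xi); have y0 := sqr_ge0 (enorm y).
by rewrite /w minElt; case: ifPn => _; nra.
Qed.

Lemma measurable_onem_cos xi : measurable_fun setT (fun y => 1 - cos (dot xi y)).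
Proof. by apply: measurable_funB => //; exact: measurable_cosdot. Qed.

Lemma integrable_onem_cos xi : nu.-integrable setT (fun y => (1 - cos (dot xi y))%:E).
Proof.
apply: (integrable_dominated (measurable_onem_cos xi) (cos_bound xi)).
exact: integrable_cmul.
Qed.

Lemma onem_cos_ge0 xi y : 0 <= 1 - cos (dot xi y) :> R.
Proof. by rewrite subr_ge0 cos_le1. Qed.

(** The exponent of the jumps in [D]: the psi of the overview for [D = setT], and psi' for the
    complement of [outer (a * h)]. *)
Definition jump_exponent D xi : R := \int[nu]_(y in D) (1 - cos (dot xi y)).

Lemma jump_exponent_ge0 D xi : 0 <= jump_exponent D xi.
Proof. by apply: Rintegral_ge0 => y _; exact: onem_cos_ge0. Qed.

Lemma jump_exponentU D xi : measurable D ->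
  jump_exponent setT xi = jump_exponent D xi + jump_exponent (~` D) xi.
Proof.
move=> mD; rewrite /jump_exponent -(setUv D) Rintegral_setU//.
- exact: measurableC.
- by rewrite setUv; exact: integrable_onem_cos.
- by apply/disj_setPCl.
Qed.

Lemma jump_exponent_bound xi :
  jump_exponent setT xi <= (2 + enorm xi ^+ 2) * \int[nu]_y w y.
Proof.
rewrite -RintegralZl//; apply: le_Rintegral => //.
- exact: integrable_onem_cos.
- exact: integrable_cmul.
- by move=> y _; apply: le_trans (cos_bound xi y); exact: ler_norm.
Qed.

(** 1 - cos(2 a) = 2 (1 - cos a) (1 + cos a) <= 4 (1 - cos a). It propagates bounds on psi from a
    ball of frequencies to larger balls. *)
Lemma jump_exponent_double xi : jump_exponent setT (2 *: xi) <= 4 * jump_exponent setT xi.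
Proof.
rewrite -RintegralZl//; last exact: integrable_onem_cos.
apply: le_Rintegral => //.
- exact: integrable_onem_cos.
- by apply: integrable_cmul; exact: integrable_onem_cos.
move=> y _; rewrite dotZl (_ : 2 * _ = dot xi y + dot xi y); last by ring.
rewrite cosD; have := cos2Dsin2 (dot xi y); have := cos_le1 (dot xi y).
have := cos_geN1 (dot xi y); nra.
Qed.

Definition outer (r : R) : set 'rV[R]_d := [set y | r <= enorm y].

Lemma measurable_outer r : measurable (outer r).
Proof.
rewrite -[X in measurable X]setTI (_ : outer r = (@enorm R d) @^-1` `[r, +oo[).
  by apply: measurable_enorm => //; exact: measurable_itv.
by apply/seteqP; split => y /=; rewrite in_itv/= andbT.
Qed.

Lemma eball_sub_outer x r e : r + e <= enorm x -> eball x e `<=` outer r.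
Proof.
move=> rx y; rewrite /eball /outer /= => yx.
by have := ler_enormD (x - y) y; rewrite subrK -opprB enormN; lra.
Qed.

(** Chebyshev's inequality: the Levy weight is at least min(1, r^2) > 0 on [outer r]. *)
Lemma levy_outer_lty (r : R) : 0 < r -> (nu (outer r) < +oo)%E.
Proof.
move=> r0; set D := outer r; have mD : measurable D := measurable_outer r.
pose m := Num.min 1 (r ^+ 2); have m0 : 0 < m by rewrite lt_min ltr01 exprn_gt0.
have : (m%:E * nu D < +oo)%E.
  apply: le_lt_trans nu_levy.2; rewrite -integral_cst//.
  apply: (@le_trans _ _ (\int[nu]_(y in D) (w y)%:E)%E).
    apply: ge0_le_integral => //.
    - by move=> y _; rewrite lee_fin ltW.
    - by apply/measurable_EFinP; exact: measurable_funTS.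
    - move=> y Dy; rewrite lee_fin /m /w le_min !ge_min lexx/=.
      by rewrite lerXn2r ?orbT// nnegrE ?enorm_ge0// ltW.
  apply: ge0_subset_integral => //.
  - exact/measurable_EFinP.
  - by move=> y _; rewrite lee_fin.
move=> h; have [//|] := ltP (nu D) +oo%E; rewrite leye_eq => /eqP E.
by move: h; rewrite E gt0_muley ?lte_fin// ltxx.
Qed.

End levy_exponent_theory.

Section levy_complex.
Variables (R : realType) (d : nat) (nu : {measure set 'rV[R]_d -> \bar R}).
Hypothesis nu_levy : levy_measure nu.
Implicit Types (xi y b : 'rV[R]_d) (D : set 'rV[R]_d).

Lemma Re_cexp_i (a : R) : complex.Re (cexp ('i%C * a%:C%C)) = cos a.
Proof. by rewrite /cexp /= !(mul0r, mul1r, mulr0, subr0, addr0, add0r, sub0r, oppr0) ?expR0 ?mul1r. Qed.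

Lemma Im_cexp_i (a : R) : complex.Im (cexp ('i%C * a%:C%C)) = sin a.
Proof. by rewrite /cexp /= !(mul0r, mul1r, mulr0, subr0, addr0, add0r, sub0r, oppr0) ?expR0 ?mul1r. Qed.

(** The compensator and the drift are purely imaginary. *)
Lemma Re_levy_exponent b xi :
  complex.Re (levy_exponent nu b xi) = jump_exponent nu setT xi.
Proof.
rewrite /levy_exponent /cintegral /=.
rewrite !(mul0r, mul1r, mulr0, subr0, addr0, add0r, sub0r, oppr0).
rewrite -mulN1r -RintegralZl//.
  apply: eq_Rintegral => y _.
  by rewrite !(mul0r, mul1r, mulr0, subr0, addr0, add0r) expR0; ring.
under eq_fun do rewrite !(mul0r, mul1r, mulr0, subr0, addr0, add0r) expR0.
rewrite (_ : _ \o _ = EFin \o (fun y => -1 * (1 - cos (dot xi y)))).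
  by apply: integrable_cmul; exact: integrable_onem_cos.
by apply/funext => y /=; congr EFin; ring.
Qed.

Hypothesis nu_sym : symmetric_measure nu.

Let nu_opp D : measurable D -> nu ((fun y => - y) @^-1` D) = nu D.
Proof.
move=> mD; rewrite [RHS]nu_sym//; congr (nu _).
apply/seteqP; split=> [y /= Dy|_ [y Dy <-]/=]; last by rewrite opprK.
by exists (- y) => //; rewrite opprK.
Qed.

Lemma Rintegral_odd (f : 'rV[R]_d -> R) : measurable_fun setT f ->
  (forall y, f (- y) = - f y) -> \int[nu]_y f y = 0.
Proof.
move=> mf fN; rewrite /Rintegral integralE.
rewrite (_ : \int[nu]_y ((fun y => (f y)%:E)^\- y)%E = \int[nu]_y ((fun y => (f y)%:E)^\+ y)%E)%E.
  (* If both parts are infinite, [fine] of their difference is 0 by default, so this case agrees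
     with the claim as well. *)
  by case: (\int[nu]_y ((fun y => (f y)%:E)^\+ y)%E)%E => //= r; rewrite subrr.
pose g := ((fun y => (f y)%:E)^\+)%E.
have mg : measurable_fun setT g by apply: measurable_funepos; exact/measurable_EFinP.
pose o (y : 'rV[R]_d) : 'rV[R]_d := - y.
transitivity (\int[nu]_(y in o @^-1` setT) ((g \o o) y))%E.
  rewrite preimage_setT; apply: eq_integral => y _.
  by rewrite /g /= !unlock /o fN EFinN.
rewrite -(ge0_integral_pushforward (@measurable_oppr R d))//; last by move=> y _; exact: funepos_ge0.
apply: eq_measure_integral; first exact: measurable_oppr.
by move=> mo A mA _; exact: nu_opp.
Qed.

(** The sine and its compensator are odd in [y], since the unit ball is symmetric; only the drift
    survives. *)
Lemma Im_levy_exponent b xi :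
  complex.Im (levy_exponent nu b xi) = - dot xi b.
Proof.
rewrite /levy_exponent /cintegral /=.
rewrite !(mul0r, mul1r, mulr0, subr0, addr0, add0r, sub0r, oppr0).
rewrite (_ : Rintegral _ _ _ = 0) ?oppr0 ?sub0r ?add0r//.
under eq_Rintegral do rewrite !(mul0r, mul1r, mulr0, subr0, addr0, add0r, sub0r, oppr0) expR0 mul1r.
apply: Rintegral_odd.
  apply: measurable_funB; first exact: measurable_sindot.
  apply: measurable_funM; first exact: measurable_dot.
  by apply: measurable_indic; exact: measurable_eball.
move=> y; rewrite dotNr sinN.
rewrite (_ : \1_(eball 0 1) (- y) = \1_(eball 0 1) y :> R); first by ring.
rewrite !indicE; congr (_%:R); congr nat_of_bool.
by apply/idP/idP; rewrite !inE /eball /= !subr0 enormN.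
Qed.

End levy_complex.

Section characteristic_function.
Variables (R : realType) (d : nat) (nu : {measure set 'rV[R]_d -> \bar R}).
Hypotheses (nu_levy : levy_measure nu) (nu_sym : symmetric_measure nu).
Variables (b : 'rV[R]_d) (P : R -> probability 'rV[R]_d R).
Hypothesis P_levy : levy_semigroup nu b P.
Implicit Types (xi y : 'rV[R]_d).

Let psi := jump_exponent nu setT.

Let cfE t xi : 0 <= t ->
  complex.Complex (\int[P t]_y cos (dot xi y)) (\int[P t]_y sin (dot xi y)) =
  complex.Complex (expR (- (t * psi xi)) * cos (dot xi (t *: b)))
    (expR (- (t * psi xi)) * sin (dot xi (t *: b))).
Proof.
move=> t0; have := P_levy.2 t xi t0.
rewrite /cintegral; under eq_Rintegral do rewrite Re_cexp_i.
under [X in complex.Complex _ X = _ -> _]eq_Rintegral do rewrite Im_cexp_i.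
move=> ->; rewrite /cexp.
have -> : complex.Re (- (t%:C%C * levy_exponent nu b xi)) = - (t * psi xi).
  by rewrite /psi -(Re_levy_exponent nu_levy b); case: (levy_exponent nu b xi) => u v /=; ring.
have -> : complex.Im (- (t%:C%C * levy_exponent nu b xi)) = dot xi (t *: b).
  rewrite dotZr; have := Im_levy_exponent nu_sym b xi.
  by case: (levy_exponent nu b xi) => u v /= ->; ring.
by [].
Qed.

Lemma levy_cf_cos t xi : 0 <= t ->
  \int[P t]_y cos (dot xi y) = expR (- (t * psi xi)) * cos (dot xi (t *: b)).
Proof. by move=> /(cfE xi)[]. Qed.

Lemma levy_cf_sin t xi : 0 <= t ->
  \int[P t]_y sin (dot xi y) = expR (- (t * psi xi)) * sin (dot xi (t *: b)).
Proof. by move=> /(cfE xi)[]. Qed.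

End characteristic_function.

Section jump_exponent_posdef.
Variables (R : realType) (d : nat) (nu : {measure set 'rV[R]_d -> \bar R}).
Hypothesis nu_levy : levy_measure nu.
Notation leb := (lebesgue_rV R d).
Implicit Types (xi y : 'rV[R]_d) (D : set 'rV[R]_d).

Lemma jump_exponent_finite D (mD : measurable D) (Doo : (nu D < +oo)%E) xi :
  jump_exponent nu D xi = fine (nu D) - cosmass (mfrestr mD Doo) xi.
Proof.
rewrite /jump_exponent -(@Rintegral_mfrestr _ _ _ nu D mD Doo _ 2).
- rewrite RintegralB//.
  + rewrite Rintegral_cst// mul1r; congr (fine _ - _).
    exact: (congr1 nu (setTI D)).
  + exact: finite_measure_integrable_cst.
  + apply: (@integrable_bounded _ _ _ (mfrestr mD Doo) _ 1); first exact: measurable_cosdot.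
    by move=> y; exact: cos_max.
- exact: measurable_onem_cos.
- move=> y; rewrite (le_trans (ler_normB _ _))// normr1 -[leRHS]/(1 + 1).
  by rewrite lerD2l cos_max.
Qed.

(** Away from 0 the Levy measure is finite. The sets increase to [D] up to the point 0, where 1 -
    cos vanishes. *)
Let Dk D (k : nat) := D `&` outer (k.+1%:R^-1 : R).

Let mDk D k : measurable D -> measurable (Dk D k).
Proof. by move=> mD; apply: measurableI => //; exact: measurable_outer. Qed.

Let Dkoo D k : measurable D -> (nu (Dk D k) < +oo)%E.
Proof.
move=> mD; apply: (@le_lt_trans _ _ (nu (outer (k.+1%:R^-1 : R)))).
  apply: measureIr => //; exact: measurable_outer.
exact: levy_outer_lty.
Qed.

Let jumpE D xi : jump_exponent nu D xi = \int[nu]_y (\1_D y * (1 - cos (dot xi y))).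
Proof.
rewrite /jump_exponent Rintegral_mkcond; apply: eq_Rintegral => y _.
by rewrite patchE indicE; case: ifPn; rewrite ?mul1r ?mul0r.
Qed.

Let cvg_jump D xi : measurable D ->
  (fun k => jump_exponent nu (Dk D k) xi) @ \oo --> jump_exponent nu D xi.
Proof.
move=> mD; under eq_fun do rewrite jumpE; rewrite jumpE.
have [] // := @Rintegral_dct _ _ R nu (fun k y => \1_(Dk D k) y * (1 - cos (dot xi y)))
  (fun y => \1_D y * (1 - cos (dot xi y))) (fun y => 1 - cos (dot xi y)).
- move=> k; apply: measurable_funM; last exact: measurable_onem_cos.
  by apply: measurable_indic; exact: mDk.
- move=> y; have [y0|y0] := eqVneq (enorm y) 0.
    rewrite (enorm_eq0 y0) dot0r cos0 subrr mulr0.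
    by under eq_fun do rewrite mulr0; exact: cvg_cst.
  have y_gt0 : 0 < enorm y by rewrite lt_def y0 enorm_ge0.
  apply: cvg_near_cst.
  have /cvgr0_norm_le/(_ _ y_gt0) := @cvg_harmonic R.
  apply: filterS => k; rewrite /harmonic/= ger0_norm ?invr_ge0// => ky.
  congr (_ * _); rewrite !indicE; congr (_%:R); congr nat_of_bool.
  by apply/idP/idP; rewrite !inE; [case|move=> Dy; split].
- move=> k y; rewrite normrM (ger0_norm (onem_cos_ge0 _ _)) ler_piMl ?onem_cos_ge0//.
  by rewrite ger0_norm// indicE; case: (_ \in _).
- exact: integrable_onem_cos.
Qed.

Let measurable_jumpk D k : measurable D -> measurable_fun setT (jump_exponent nu (Dk D k)).
Proof.
move=> mD; rewrite (funext (jump_exponent_finite (mDk k mD) (Dkoo k mD))).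
by apply: measurable_funB => //; exact: measurable_cosmass.
Qed.

Lemma measurable_jump_exponent D : measurable D -> measurable_fun setT (jump_exponent nu D).
Proof.
move=> mD; apply: (measurable_fun_cvg (fun k => measurable_jumpk k mD)) => xi _.
exact: cvg_jump.
Qed.

Variable t : R.
Hypothesis t0 : 0 <= t.

Let E D xi : R := expR (- (t * jump_exponent nu D xi)).

Let measurable_E D : measurable D -> measurable_fun setT (E D).
Proof.
move=> mD; apply: (measurableT_comp (f := @expR R)) => //.
by apply: measurable_funN; apply: measurable_funM => //; exact: measurable_jump_exponent.
Qed.

Let E_le1 D xi : E D xi <= 1.
Proof. by rewrite -expR0 ler_expR lerNl oppr0 mulr_ge0// jump_exponent_ge0. Qed.

(** For finite mass lam the function is exp(-t lam) exp(t m), which is bounded below by exp(-2 t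
    lam) and so not integrable: the damping has to stay on until the truncation of small jumps is
    removed. *)
Lemma posdef_jump_exponent D : measurable D ->
  leb.-integrable setT (fun xi => (expR (- (t * jump_exponent nu D xi)))%:E) ->
  posdef (fun xi => expR (- (t * jump_exponent nu D xi))).
Proof.
move=> mD iE.
have step1 k s : 0 < s -> posdef (fun xi => laplace_rV s xi * E (Dk D k) xi).
  move=> s0 z; pose lam := fine (nu (Dk D k)).
  rewrite (_ : cosint _ _ = expR (- (t * lam)) *
     cosint (fun xi => laplace_rV s xi * expR (t * cosmass (mfrestr (mDk k mD) (Dkoo k mD)) xi)) z).
    rewrite mulr_ge0 ?expR_ge0//; apply: posdef_expR => //.
    - exact: integrable_laplace_rV.
    - exact: posdef_laplace_rV.
  rewrite /cosint -RintegralZl//; last first.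
    apply: integrable_cosint.
    apply: (integrable_mul_bounded (integrable_laplace_rV d s0) (D := expR (t * lam))).
      apply: (measurableT_comp (f := @expR R)) => //.
      by apply: measurable_funM => //; exact: measurable_cosmass.
    move=> xi; rewrite ger0_norm ?expR_ge0// ler_expR ler_wpM2l//.
    rewrite (le_trans (ler_norm _))// (le_trans (normr_cosmass_le _ _))//.
    rewrite le_eqVlt; apply/orP; left; apply/eqP; congr fine.
    exact: (congr1 nu (setTI (Dk D k))).
  apply: eq_Rintegral => xi _; rewrite /E (jump_exponent_finite (mDk k mD) (Dkoo k mD)).
  by rewrite mulrBr opprB addrC expRD -/lam; ring.
(* The small jumps return, with the damping factor as the integrable majorant. *)
have step2 s : 0 < s -> posdef (fun xi => laplace_rV s xi * E D xi).
  move=> s0; apply: (@posdef_cvg _ _ (fun k xi => laplace_rV s xi * E (Dk D k) xi) _ (laplace_rV s)).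
  - move=> k; apply: measurable_funM; first exact: measurable_laplace_rV.
    by apply: measurable_E; exact: mDk.
  - move=> xi; apply: cvgM; first exact: cvg_cst.
    apply: continuous_cvg; first exact: continuous_expR.
    by apply: cvgN; apply: cvgM; [exact: cvg_cst|exact: cvg_jump].
  - move=> k xi; rewrite normrM !ger0_norm ?expR_ge0 ?laplace_rV_ge0//.
    by rewrite ler_piMr ?laplace_rV_ge0// E_le1.
  - exact: integrable_laplace_rV.
  - by move=> k; exact: step1.
(* The damping goes last: now [E D] itself, integrable by assumption, is the majorant. *)
apply: (@posdef_cvg _ _ (fun k xi => laplace_rV k.+1%:R^-1 xi * E D xi) _ (E D)) => //.
- move=> k; apply: measurable_funM; first exact: measurable_laplace_rV.
  exact: measurable_E.
- move=> xi; rewrite -[X in _ --> X]mul1r; apply: cvgM; last exact: cvg_cst.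
  exact: cvg_laplace_rV.
- move=> k xi; rewrite normrM !ger0_norm ?expR_ge0 ?laplace_rV_ge0//.
  by rewrite ler_piMl ?expR_ge0// laplace_rV_le1// invr_ge0.
- by move=> k; exact: step2.
Qed.

End jump_exponent_posdef.

(** * Mass of the large jumps *)

Section outer_mass.
Variables (R : realType) (d : nat) (nu : {measure set 'rV[R]_d -> \bar R}).
Hypothesis nu_levy : levy_measure nu.
Notation lambda := (@lebesgue_measure R).
Variables (r s K : R).
Hypotheses (r0 : 0 < r) (s0 : 0 < s) (rs : 2 * d.+1%:R <= s * r)
  (psi_le : forall (i : 'I_d) u, 0 <= u <= s ->
     jump_exponent nu setT (u *: delta_mx ord0 i) <= K).

Let J : set R := `[0, s]%classic.

Let iJ : lambda.-integrable [set: R] (fun u => (\1_J u)%:E).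
Proof.
apply: integrable_indic_lty; first exact: measurable_itv.
by rewrite [ltLHS](lebesgue_measure_itv `[0, s])/=; case: ifP => // _; rewrite -EFinB ltry.
Qed.

(** Equals s - sin(s c) / c for nonzero [c], hence is at least s / 2 as soon as s |c| >= 2. *)
Let g (c : R) : R := \int[lambda]_u (\1_J u * (1 - cos (u * c))).

Let mcos (c : R) : measurable_fun [set: R] (fun u : R => 1 - cos (u * c)).
Proof.
apply: continuous_measurable_fun => u; apply: cvgB; first exact: cvg_cst.
apply: (@continuous_comp R R R (fun u => u * c) (@cos R)); last exact: continuous_cos.
by apply: cvgM; [exact: cvg_id|exact: cvg_cst].
Qed.

Let ig c : lambda.-integrable [set: R] (fun u => (\1_J u * (1 - cos (u * c)))%:E).
Proof.
apply: (integrable_mul_bounded iJ (D := 2)) => [|u]; first exact: mcos.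
by rewrite (le_trans (ler_normB _ _))// normr1 -[2]/(1 + 1) lerD2l cos_max.
Qed.

Let g_ge0 c : 0 <= g c.
Proof.
by apply: Rintegral_ge0 => u _; rewrite mulr_ge0// subr_ge0 cos_le1.
Qed.

Let g_large c : 2 <= s * `|c| -> s / 2 <= g c.
Proof.
move=> sc; have c0 : c != 0.
  by apply: contraTneq sc => ->; rewrite normr0 mulr0 -ltNge.
pose F (u : R) := u - sin (u * c) / c.
have dF (u : R) : is_derive u 1 F (1 - cos (u * c)).
  by apply: is_derive_eq; rewrite /GRing.scale/=; field.
have cF (u : R) : {for u, continuous F}.
  by apply/differentiable_continuous/derivable1_diffP; case: (dF u).
have -> : g c = F s - F 0.
  apply: EFin_inj; rewrite /g EFin_Rintegral; last exact: ig.
  transitivity (\int[lambda]_(u in `[0%R, s]) (1 - cos (u * c))%:E)%E.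
    rewrite [RHS]integral_mkcond; apply: eq_integral => u _.
    by rewrite patchE indicE; case: ifPn; rewrite ?mul1r ?mul0r.
  rewrite (@continuous_FTC2 _ (fun u => 1 - cos (u * c)) F)//.
  - apply: continuous_subspaceT => u; apply: cvgB; first exact: cvg_cst.
    apply: (@continuous_comp R R R (fun u => u * c) (@cos R)); last exact: continuous_cos.
    by apply: cvgM; [exact: cvg_id|exact: cvg_cst].
  - split.
    + by move=> u _; case: (dF u).
    + by apply: cvg_at_right_filter; exact: cF.
    + by apply: cvg_at_left_filter; exact: cF.
  - by move=> u _; rewrite derive1E; case: (dF u).
have F0 : F 0 = 0 by rewrite /F mul0r sin0 mul0r subr0.
rewrite F0 /F subr0.
have : `|sin (s * c) / c| <= s / 2.
  rewrite normrM normfV ler_pdivrMr ?normr_gt0// (le_trans (sin_max _))//.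
  by rewrite mulrAC ler_pdivlMr// mul1r.
by rewrite ler_norml => /andP[h1 h2]; lra.
Qed.

Let Doo := levy_outer_lty nu_levy r0.
Let mD := @measurable_outer R d r.
Let nur : {finite_measure set 'rV[R]_d -> \bar R} := mfrestr mD Doo.

Let mk (i : 'I_d) : measurable_fun setT
  (fun p : R * 'rV[R]_d => 1 - cos (p.1 * p.2 ord0 i)).
Proof.
apply: measurable_funB => //; apply: (measurableT_comp (f := @cos R)).
  by apply: continuous_measurable_fun; exact: continuous_cos.
apply: measurable_funM => //.
exact: (measurableT_comp (measurable_coord i) measurable_snd).
Qed.

Let kC (i : 'I_d) (p : R * 'rV[R]_d) : `|1 - cos (p.1 * p.2 ord0 i)| <= 2.
Proof.
by rewrite (le_trans (ler_normB _ _))// normr1 -[2]/(1 + 1) lerD2l cos_max.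
Qed.

Let fubini (i : 'I_d) : \int[nur]_y g (y ord0 i) =
  \int[lambda]_u (\1_J u * \int[nur]_y (1 - cos (u * y ord0 i))).
Proof. by rewrite (Rintegral_Fubini nur iJ (mk i) (kC i)). Qed.

Let int_g_le (i : 'I_d) : \int[nur]_y g (y ord0 i) <= s * K.
Proof.
have dotu (u : R) (y : 'rV[R]_d) : u * y ord0 i = dot (u *: delta_mx ord0 i) y.
  by rewrite dotZl dot_delta.
have innerE u : \int[nur]_y (1 - cos (u * y ord0 i)) =
    jump_exponent nu (outer r) (u *: delta_mx ord0 i).
  under eq_Rintegral do rewrite dotu.
  rewrite (Rintegral_mfrestr mD Doo (C := 2))//; first exact: measurable_onem_cos.
  by move=> y; rewrite (le_trans (ler_normB _ _))// normr1 -[2]/(1 + 1) lerD2l cos_max.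
rewrite fubini.
have JE : \int[lambda]_u \1_J u = s.
  apply: EFin_inj; rewrite EFin_Rintegral; last exact: iJ.
  rewrite integral_indic ?setIT; [|exact: measurableT|exact: measurable_itv].
  by rewrite [LHS](lebesgue_measure_itv `[0, s])/= lte_fin s0 -EFinB subr0.
rewrite -[s in leRHS]JE [leRHS]mulrC -RintegralZl//; apply: le_Rintegral => //.
- apply: (integrable_mul_bounded iJ (D := 2 * fine (nur setT))).
    exact: (measurable_Rintegral1 nur (mk i) (kC i)).
  move=> u; rewrite -(Rintegral_cst nur measurableT 2).
  have mku : measurable_fun setT (fun y : 'rV[R]_d => 1 - cos (u * y ord0 i)).
    by under eq_fun do rewrite dotu; exact: measurable_onem_cos.
  have iku : nur.-integrable setT (EFin \o (fun y => 1 - cos (u * y ord0 i))).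
    by apply: (@integrable_bounded _ _ _ nur _ 2) => // y; exact: (kC i (u, y)).
  apply: (le_trans (le_normr_Rintegral measurableT iku)); apply: le_Rintegral => //.
  + exact: (integrable_norm iku).
  + exact: finite_measure_integrable_cst.
  + by move=> y _; exact: (kC i (u, y)).
- by apply: integrable_cmul; exact: iJ.
- move=> u _; rewrite innerE indicE; case: (boolP (u \in J)) => [|_]; last by rewrite mul0r mulr0.
  rewrite inE /J/= in_itv/= => us; rewrite mul1r mulr1; apply: le_trans (psi_le i us).
  by rewrite [leRHS](jump_exponentU nu_levy _ mD) lerDl jump_exponent_ge0.
Qed.

Let outer_coord y : outer r y -> exists i : 'I_d, 2 <= s * `|y ord0 i|.
Proof.
move=> yr; apply: contrapT => /forallNP h.
(* If every coordinate were below r / (d + 1), summing would give this bound, which is absurd for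
   [r > 0]. This explains the [d.+1] in the hypothesis [rs]. *)
suff : r <= d%:R * (r / d.+1%:R).
  by rewrite mulrCA ler_pMr// ler_pdivlMr// mul1r ler_nat ltnn.
apply: (le_trans yr); apply: (le_trans (enorm_le_sum y)).
have -> : d%:R * (r / d.+1%:R) = \sum_(i < d) (r / d.+1%:R).
  by rewrite sumr_const card_ord mulr_natl.
apply: ler_sum => i _; rewrite leNgt; apply/negP => hi; apply: (h i).
have d0 : 0 < d.+1%:R :> R by [].
move: hi; rewrite ltr_pdivrMr// => hi.
rewrite -(ler_pM2r d0); apply: (le_trans rs); rewrite -mulrA ler_pM2l; last exact: s0.
exact: ltW.
Qed.

(** A jump of length at least [r] has a coordinate on which [g] is at least s / 2. Summing over
    coordinates, the mass times s / 2 is at most the sum over i of the integral of psi(v e_i) over 0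
    <= v <= s, which is at most d s K. *)
Lemma outer_mass_le : fine (nu (outer r)) <= 2 * d%:R * K.
Proof.
have igi (i : 'I_d) : nur.-integrable setT (fun y => (g (y ord0 i))%:E).
  apply: (@integrable_bounded _ _ _ nur (fun y => g (y ord0 i)) (2 * \int[lambda]_u `|\1_J u|)).
    exact: (measurable_Rintegral2 nur iJ (mk i) (kC i)).
  by move=> y; exact: (normr_Rintegral_mul iJ (mk i) (kC i)).
have iS : nur.-integrable setT (fun y => (\sum_(i < d) g (y ord0 i))%:E).
  rewrite (_ : (fun y => _) = fun y : 'rV[R]_d => \sum_(i < d) (g (y ord0 i))%:E)%E.
    exact: integrable_sum.
  by apply/funext => y; rewrite sumEFin.
have sumE : \int[nur]_y (\sum_(i < d) g (y ord0 i)) = \sum_(i < d) \int[nur]_y g (y ord0 i).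
  apply: EFin_inj; rewrite -sumEFin EFin_Rintegral//.
  transitivity (\int[nur]_y (\sum_(i < d) (g (y ord0 i))%:E))%E.
    by apply: eq_integral => y _; rewrite sumEFin.
  rewrite integral_sum//; apply: eq_bigr => i _.
  by rewrite EFin_Rintegral//; exact: igi.
have : s / 2 * fine (nu (outer r)) <= d%:R * (s * K).
  have -> : fine (nu (outer r)) = \int[nur]_y \1_(outer r) y.
    rewrite /Rintegral integral_indic// setIT; congr fine.
    exact: (congr1 nu (esym (setIid (outer r)))).
  have i1 : nur.-integrable setT (fun y => (\1_(outer r) y)%:E) by exact: integrable_indic.
  rewrite -RintegralZl//.
  apply: (@le_trans _ _ (\int[nur]_y (\sum_(i < d) g (y ord0 i)))).
    apply: le_Rintegral => //.
    - exact: integrable_cmul.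
    - move=> y _; rewrite indicE; case: (boolP (y \in _)) => [|_]; last first.
        by rewrite mulr0 sumr_ge0.
      rewrite inE => /outer_coord[i yi]; rewrite mulr1 (bigD1 i)//=.
      by rewrite (le_trans (g_large yi))// lerDl sumr_ge0.
  rewrite sumE mulr_natl -[d in leRHS]card_ord -sumr_const.
  by apply: ler_sum => i _; exact: int_g_le.
move=> h; rewrite -(ler_pM2l s0).
rewrite (_ : s * (2 * d%:R * K) = 2 * (d%:R * (s * K))); last by ring.
have {}h := ler_wpM2l (ler0n R 2) h; apply: le_trans h.
by rewrite le_eqVlt; apply/orP; left; apply/eqP; field.
Qed.

End outer_mass.

(** * The scale h(t) *)

Section levy_h_theory.
Variables (R : realType) (d : nat) (nu : {measure set 'rV[R]_d -> \bar R}).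
Hypothesis nu_levy : levy_measure nu.
Variable b : 'rV[R]_d.
Notation leb := (lebesgue_rV R d).
Implicit Types (xi : 'rV[R]_d).

Let psi := jump_exponent nu setT.

Let W : R := \int[nu]_y Num.min 1 (enorm y ^+ 2).

Let W0 : 0 <= W.
Proof. by apply: Rintegral_ge0 => y _; rewrite le_min ler01 sqr_ge0. Qed.

Lemma jump_exponent_le_Psi xi r : enorm xi <= r -> psi xi <= levy_Psi nu b r.
Proof.
move=> xir; apply: ub_le_sup; last by exists xi => //; exact: Re_levy_exponent.
exists ((2 + r ^+ 2) * W) => _ [z zr <-].
rewrite Re_levy_exponent// (le_trans (jump_exponent_bound nu_levy z))//.
rewrite ler_wpM2r// lerD2l lerXn2r// ?nnegrE ?enorm_ge0//.
exact: le_trans (enorm_ge0 z) zr.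
Qed.

Variable t : R.
Notation h := (levy_h nu b t).

Let h_ge0 : 0 <= h.
Proof.
rewrite invr_ge0 /levy_Psi_inv; set S := (X in sup X).
have [hS|/sup_out->//] := pselect (has_sup S).
have [r rS] := hS.1; apply: (le_trans (ltW rS.1)).
by apply: ub_le_sup => //; exact: hS.2.
Qed.

(* When [Psi] does not attain [1 / t], the supremum defining [levy_h] is [0], hence so
   is [levy_h], and the integrability bound would make a positive integral vanish. *)
Lemma levy_h_gt0 (M : R) : (0 < d)%N -> 0 <= t ->
  (\int[leb]_xi (expR (- (t * psi xi)) * enorm xi)%:E <= (M * h ^- d.+1)%:E)%E ->
  0 < h.
Proof.
move=> d0 t0 hM; rewrite lt_def h_ge0 andbT; apply/eqP => h0.
(* With [h = 0] the bound collapses to 0, because the inverse of 0 is 0 by convention. *)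
move: hM; rewrite h0 expr0n/= invr0 mulr0; apply/negP; rewrite -ltNge.
pose B : set 'rV[R]_d := cbox (const_mx 1) (const_mx 2).
have mB : measurable B := measurable_cbox _ _.
have B12 i : (const_mx 1 : 'rV[R]_d) ord0 i < (const_mx 2 : 'rV[R]_d) ord0 i.
  by rewrite !mxE ltr1n.
(* On the cube with sides [1, 2] one has 1 <= |xi| <= 2 d, so by [jump_exponent_bound] the integrand
   is at least [c]. *)
pose c := expR (- (t * ((2 + (d%:R * 2) ^+ 2) * W))).
have B0 : (0 < leb B)%E.
  have -> : leb B = (\prod_(i < d) ((const_mx 2 : 'rV[R]_d) ord0 i - (const_mx 1 : 'rV[R]_d) ord0 i))%:E.
    exact: (lebesgue_rV_box (fun i => ltW (B12 i))).
  by rewrite lte_fin; apply: prodr_gt0 => i _; rewrite subr_gt0 B12.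
apply: (@lt_le_trans _ _ (\int[leb]_(xi in B) c%:E)%E).
  rewrite integral_cst//; apply: mule_gt0; last exact: B0.
  by rewrite lte_fin expR_gt0.
have mpsi : measurable_fun setT (fun xi : 'rV[R]_d => (expR (- (t * psi xi)) * enorm xi)%:E).
  apply/measurable_EFinP; apply: measurable_funM; last exact: measurable_enorm.
  apply: (measurableT_comp (f := @expR R)) => //; apply: measurable_funN.
  by apply: measurable_funM => //; exact: measurable_jump_exponent.
apply: (@le_trans _ _ (\int[leb]_(xi in B) (expR (- (t * psi xi)) * enorm xi)%:E)%E); last first.
  apply: ge0_subset_integral => //.
  by move=> xi _; rewrite lee_fin mulr_ge0 ?expR_ge0 ?enorm_ge0.
apply: ge0_le_integral => //.
- by move=> xi _; rewrite lee_fin expR_ge0.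
- exact: measurable_funTS.
move=> xi xiB; rewrite lee_fin.
have coord i : 1 <= xi ord0 i <= 2.
  by have := xiB i; rewrite !mxE in_itv.
have e1 : 1 <= enorm xi.
  apply: le_trans (normr_coord_le_enorm xi (Ordinal d0)).
  by have /andP[h1 _] := coord (Ordinal d0); rewrite ger0_norm// (le_trans _ h1).
have e2 : enorm xi <= d%:R * 2.
  apply: (le_trans (enorm_le_sum xi)).
  have -> : d%:R * 2 = \sum_(i < d) (2 : R) by rewrite sumr_const card_ord mulr_natl.
  apply: ler_sum => i _; have /andP[h1 h2] := coord i.
  by rewrite ger0_norm// (le_trans _ h1).
rewrite -[c]mulr1 ler_pM ?expR_ge0// ler_expR lerN2 ler_wpM2l//.
rewrite (le_trans (jump_exponent_bound nu_levy xi))// ler_wpM2r// lerD2l.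
by rewrite lerXn2r// nnegrE ?enorm_ge0 ?mulr_ge0.
Qed.

(** 1 / h is the supremum of the radii r with Psi(r) = 1 / t; a frequency strictly below it lies
    below one of these radii. *)
Lemma jump_exponent_le_h xi : 0 < h -> enorm xi < h^-1 -> psi xi <= t^-1.
Proof.
rewrite invrK invr_gt0 /levy_Psi_inv; set S := (X in sup X) => S0 xiS.
have hS : has_sup S by apply: contrapT => /sup_out E; move: S0; rewrite E ltxx.
have [r [r0 <-] xir] := sup_gt hS.1 xiS.
by apply: jump_exponent_le_Psi; exact: ltW.
Qed.

Lemma jump_exponent_le_h_double k xi : 0 < h -> enorm xi < 2 ^+ k * h^-1 ->
  psi xi <= 4 ^+ k * t^-1.
Proof.
move=> h0; elim: k xi => [|k IH] xi.
  by rewrite !mul1r; exact: jump_exponent_le_h.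
rewrite exprS -mulrA -ltr_pdivrMl// => xik.
have -> : xi = 2 *: (2^-1 *: xi) by rewrite scalerA divff// scale1r.
rewrite (le_trans (jump_exponent_double nu_levy _))// exprS -mulrA ler_wpM2l//.
by apply: IH; rewrite enormZ ger0_norm ?invr_ge0.
Qed.

End levy_h_theory.

(** * Bounds on the transition density *)

Section lower_bound.
Variables (R : realType) (d : nat).
Notation leb := (lebesgue_rV R d).
Hypothesis d_ge1 : (0 < d)%N.

(* [expR (-1)] times the volume of a cube of side [1 / (2 d)], which lies in the unit
   ball. *)
Definition vol_const : R := expR (-1) * (2 * d%:R)^-1 ^+ d.

Lemma vol_const_gt0 : 0 < vol_const.
Proof. by rewrite mulr_gt0 ?expR_gt0// exprn_gt0// invr_gt0 mulr_gt0 ?ltr0n. Qed.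

Variables (u : 'rV[R]_d -> R) (h : R).
Hypotheses (h0 : 0 < h) (iu : leb.-integrable setT (EFin \o u))
  (iu1 : leb.-integrable setT (fun xi => (u xi * enorm xi)%:E))
  (u0 : forall xi, 0 <= u xi)
  (u_ge : forall xi, enorm xi < h^-1 -> expR (-1) <= u xi).

Lemma cosint0_ge : vol_const * h ^- d <= cosint u 0.
Proof.
pose l : R := (2 * d%:R)^-1 * h^-1.
have dp : 0 < d%:R :> R by rewrite ltr0n.
have l0 : 0 < l by rewrite mulr_gt0 ?invr_gt0 ?mulr_gt0.
pose B : set 'rV[R]_d := cbox 0 (const_mx l).
have B0 i : (0 : 'rV[R]_d) ord0 i < (const_mx l : 'rV[R]_d) ord0 i by rewrite !mxE.
have mB : measurable B := measurable_cbox _ _.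
have iB := integrable_indic_cbox B0.
have BE : \int[leb]_xi \1_B xi = l ^+ d.
  rewrite /Rintegral integral_indic// setIT.
  transitivity (\prod_(i < d) ((const_mx l : 'rV[R]_d) ord0 i - (0 : 'rV[R]_d) ord0 i)).
    exact: (congr1 fine (lebesgue_rV_box (fun i => ltW (B0 i)))).
  by under eq_bigr do rewrite !mxE subr0; rewrite prodr_const card_ord.
rewrite (_ : vol_const * h ^- d = expR (-1) * l ^+ d); last first.
  by rewrite /vol_const /l exprMn exprVn [h^-1 ^+ d]exprVn -mulrA.
rewrite -BE -RintegralZl//; apply: le_Rintegral => //.
- exact: integrable_cmul.
- exact: (integrable_cosint 0 iu).
move=> xi _; rewrite dot0r cos0 mulr1 indicE.
case: (boolP (xi \in B)) => [|_]; last by rewrite mulr0.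
rewrite inE => xiB; rewrite mulr1; apply: u_ge.
have : enorm xi <= d%:R * l.
  apply: (le_trans (enorm_le_sum xi)).
  have -> : d%:R * l = \sum_(i < d) l by rewrite sumr_const card_ord mulr_natl.
  apply: ler_sum => i _; have := xiB i; rewrite !mxE in_itv/= => /andP[h1 h2].
  by rewrite ger0_norm.
move=> /le_lt_trans; apply; rewrite /l invfM mulrA mulrCA mulfV ?gt_eqF// mulr1.
by rewrite gtr_pMl ?invr_gt0// invf_lt1// ltr1n.
Qed.

(** The Lipschitz constant is at most L h^(-d-1), and the radius is the one at which the loss
    reaches half of the lower bound at 0. *)
Lemma cosint_ge (L : R) x : 0 < L ->
  \int[leb]_xi (u xi * enorm xi) <= L * h ^- d.+1 ->
  enorm x <= vol_const / (2 * L) * h ->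
  vol_const / 2 * h ^- d <= cosint u x.
Proof.
move=> L0 uL xh.
have := cosint_lipschitz iu iu1 x 0; rewrite subr0.
have -> : \int[leb]_xi `|u xi * enorm xi| = \int[leb]_xi (u xi * enorm xi).
  by apply: eq_Rintegral => xi _; rewrite ger0_norm// mulr_ge0// enorm_ge0.
move=> lip.
have H : enorm x * \int[leb]_xi (u xi * enorm xi) <= vol_const / 2 * h ^- d.
  apply: (@le_trans _ _ (vol_const / (2 * L) * h * (L * h ^- d.+1))).
    apply: ler_pM => //; first exact: enorm_ge0.
    by apply: Rintegral_ge0 => xi _; rewrite mulr_ge0// enorm_ge0.
  rewrite le_eqVlt; apply/orP; left; apply/eqP; rewrite exprS invfM.
  by field; rewrite ?expf_neq0 ?gt_eqF.
have := le_trans lip H; rewrite ler_norml => /andP[h1 _].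
have := cosint0_ge; move: h1; set a := h ^- d; set c := vol_const; nra.
Qed.

End lower_bound.

(** * Near and far estimates for a fixed time *)

Section transition_density.
Variables (R : realType) (d : nat) (nu : {measure set 'rV[R]_d -> \bar R}).
Hypotheses (nu_levy : levy_measure nu) (nu_sym : symmetric_measure nu).
Variables (b : 'rV[R]_d) (P : R -> probability 'rV[R]_d R).
Hypothesis P_levy : levy_semigroup nu b P.
Hypothesis d_ge1 : (0 < d)%N.
Notation leb := (lebesgue_rV R d).
Let psi := jump_exponent nu setT.
Variables (t M : R).
Hypotheses (t0 : 0 < t) (M0 : 0 < M).
Notation h := (levy_h nu b t).
Hypothesis int_le :
  (\int[leb]_xi (expR (- (t * psi xi)) * enorm xi)%:E <= (M * h ^- d.+1)%:E)%E.

Let h0 : 0 < h := levy_h_gt0 nu_levy d_ge1 (ltW t0) int_le.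

Let phi (xi : 'rV[R]_d) : R := expR (- (t * psi xi)).

Let mphi : measurable_fun setT phi.
Proof.
apply: (measurableT_comp (f := @expR R)) => //; apply: measurable_funN.
by apply: measurable_funM => //; exact: measurable_jump_exponent.
Qed.

Let iphi1 : leb.-integrable setT (fun xi => (phi xi * enorm xi)%:E).
Proof.
apply/integrableP; split.
  by apply/measurable_EFinP; apply: measurable_funM => //; exact: measurable_enorm.
under eq_integral do rewrite gee0_abs ?lee_fin ?mulr_ge0 ?expR_ge0 ?enorm_ge0//.
by apply: le_lt_trans int_le _; rewrite ltry.
Qed.

Let phi_le : \int[leb]_xi (phi xi * enorm xi) <= M * h ^- d.+1.
Proof. by rewrite -lee_fin EFin_Rintegral. Qed.

Let phi_le1 xi : phi xi <= 1.
Proof. by rewrite -expR0 ler_expR lerNl oppr0 mulr_ge0 ?(ltW t0)// jump_exponent_ge0. Qed.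

(** The assumption controls only phi |xi|, which dominates phi where |xi| >= 1; the rest lies in a
    cube, where phi <= 1. *)
Let iphi : leb.-integrable setT (EFin \o phi).
Proof.
have B0 i : (const_mx (-1) : 'rV[R]_d) ord0 i < (const_mx 1 : 'rV[R]_d) ord0 i.
  by rewrite !mxE; lra.
apply: (@integrable_dominated _ _ _ leb phi (fun xi =>
  \1_(cbox (const_mx (-1)) (const_mx 1)) xi + phi xi * enorm xi)) => //.
- move=> xi; rewrite ger0_norm ?expR_ge0//.
  have [xi1|xi1] := leP 1 (enorm xi).
    by apply: ler_wpDl => //; rewrite ler_peMr ?expR_ge0.
  rewrite indicE mem_set; last first.
    move=> i; rewrite !mxE in_itv/= -ler_norml.
    exact: le_trans (normr_coord_le_enorm xi i) (ltW xi1).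
  by apply: ler_wpDr; rewrite ?phi_le1// mulr_ge0 ?expR_ge0 ?enorm_ge0.
- exact: (integrableD measurableT (integrable_indic_cbox B0) iphi1).
Qed.

(** By symmetry of [nu] the law of [P t] is centred at [t *: b], and the argument x + t b cancels
    this shift. *)
Lemma densityE_cosint x :
  density (P t) (x + t *: b) = ((2 * pi) ^+ d)^-1 * cosint phi x.
Proof.
have cfc xi := levy_cf_cos nu_levy nu_sym P_levy xi (ltW t0).
have cfs xi := levy_cf_sin nu_levy nu_sym P_levy xi (ltW t0).
rewrite (@densityE _ _ _ (cf_density (t *: b) phi)) ?/cf_density ?addrK//; split.
- exact: Cb1_cosint.
- exact: (cf_density_ge0 iphi cfc cfs).
- exact: (probability_cf_density iphi cfc cfs).
Qed.

Let expRN1_le (e : R) : e <= t^-1 -> expR (-1) <= expR (- (t * e)).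
Proof. by move=> et; rewrite ler_expR lerN2 mulrC -ler_pdivlMr// mul1r. Qed.

Lemma transition_density_near x : enorm x <= vol_const R d / (2 * M) * h ->
  vol_const R d / 2 * h ^- d <= cosint phi x.
Proof.
apply: (cosint_ge d_ge1 h0 iphi iphi1) => //; first by move=> xi; exact: expR_ge0.
by move=> xi xih; apply: expRN1_le; exact: (jump_exponent_le_h nu_levy h0 xih).
Qed.

Variables (a L : R).
Hypotheses (a0 : 0 < a) (tail : t * fine (nu (outer (a * h))) <= L).

Let r := a * h.
Let r0 : 0 < r. Proof. exact: mulr_gt0. Qed.
Let D := @outer R d r.
Let mD : measurable D := @measurable_outer R d r.
Let Doo : (nu D < +oo)%E := levy_outer_lty nu_levy r0.
Let nur : {finite_measure set 'rV[R]_d -> \bar R} := mfrestr mD Doo.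
Let lam := fine (nu D).

Let u (xi : 'rV[R]_d) : R := expR (- (t * jump_exponent nu (~` D) xi)).

Let mu_ : measurable_fun setT u.
Proof.
apply: (measurableT_comp (f := @expR R)) => //; apply: measurable_funN.
apply: measurable_funM => //; apply: measurable_jump_exponent => //.
exact: measurableC.
Qed.

Let massE : fine (nur setT) = lam.
Proof. by congr fine; exact: (congr1 nu (setTI D)). Qed.

(** Removing the large jumps lowers the exponent by at most 2 lam, and t lam <= L. Hence [u]
    inherits the moment bound of phi with [M] replaced by [expR (2 * L) * M]. *)
Let u_le xi : u xi <= expR (2 * L) * phi xi.
Proof.
rewrite /u /phi -expRD ler_expR /psi (jump_exponentU nu_levy xi mD).
rewrite (jump_exponent_finite mD Doo).
have := normr_cosmass_le nur xi; rewrite massE ler_norml => /andP[h1 h2].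
have {}h1 := ler_wpM2l (ltW t0) h1.
rewrite -/nur; move: tail h1; rewrite -/r -/D -/lam mulrN; lra.
Qed.

Let iu : leb.-integrable setT (EFin \o u).
Proof.
apply: (@integrable_dominated _ _ _ leb u (fun xi => expR (2 * L) * phi xi)) => //.
- by move=> xi; rewrite ger0_norm ?expR_ge0.
- exact: integrable_cmul.
Qed.

Let iu1 : leb.-integrable setT (fun xi => (u xi * enorm xi)%:E).
Proof.
apply: (@integrable_dominated _ _ _ leb (fun xi => u xi * enorm xi)
   (fun xi => expR (2 * L) * (phi xi * enorm xi))) => //.
- by apply: measurable_funM => //; exact: measurable_enorm.
- move=> xi; rewrite ger0_norm ?mulr_ge0 ?expR_ge0 ?enorm_ge0//.
  by rewrite mulrA ler_wpM2r ?enorm_ge0.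
- exact: integrable_cmul.
Qed.

Let u_int_le : \int[leb]_xi (u xi * enorm xi) <= expR (2 * L) * M * h ^- d.+1.
Proof.
rewrite -mulrA (le_trans _ (ler_wpM2l (expR_ge0 _) phi_le))//.
rewrite -RintegralZl//; apply: le_Rintegral => //.
- exact: integrable_cmul.
- by move=> xi _; rewrite mulrA ler_wpM2r ?enorm_ge0.
Qed.

Let posdef_u : posdef u.
Proof.
apply: posdef_jump_exponent => //; first exact: ltW.
exact: measurableC.
Qed.

(** Dropping jumps lowers the exponent, so [u] also stays above exp(-1) for |xi| < 1 / h; only the
    radius shrinks, through the larger moment bound. *)
Let cosint_u_near x : enorm x <= vol_const R d / (2 * (expR (2 * L) * M)) * h ->
  vol_const R d / 2 * h ^- d <= cosint u x.
Proof.
apply: (cosint_ge d_ge1 h0 iu iu1) => //.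
- by move=> xi; exact: expR_ge0.
- move=> xi xih; apply: expRN1_le; apply: le_trans (jump_exponent_le_h nu_levy h0 xih).
  by rewrite (jump_exponentU nu_levy xi mD) lerDr jump_exponent_ge0.
- by rewrite mulr_gt0 ?expR_gt0.
Qed.

Let mcosint_u : measurable_fun setT (cosint u).
Proof.
apply: continuous_measurable_rV => x.
apply: differentiable_continuous.
have := differentiable_cosint iu iu1 1 0 x.
by under eq_fun do rewrite mul1r subr0.
Qed.

(** The two conditions on [e] have separate roles: the lower bound on |x| puts the ball inside the
    large jumps, and the upper bound on [e] puts x - y in the near zone of [u] for every y in the
    ball. *)
Lemma transition_density_far x (e : R) :
  e <= vol_const R d / (2 * (expR (2 * L) * M)) ->
  (a + e) * h <= enorm x ->
  expR (- L) * t * (vol_const R d / 4) * h ^- d * fine (nu (eball x (e * h))) <= cosint phi x.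
Proof.
move=> eL xfar.
have phiE : phi = fun xi => expR (- (t * lam)) * (u xi * expR (t * cosmass nur xi)).
  apply/funext => xi; rewrite /phi /u /psi (jump_exponentU nu_levy xi mD).
  rewrite (jump_exponent_finite mD Doo) -!expRD; congr expR.
  by rewrite -/lam -/nur; ring.
have iexp : leb.-integrable setT (fun xi => (u xi * expR (t * cosmass nur xi))%:E).
  apply: (integrable_mul_bounded iu (D := expR (t * lam))).
    apply: (measurableT_comp (f := @expR R)) => //.
    by apply: measurable_funM => //; exact: measurable_cosmass.
  move=> xi; rewrite ger0_norm ?expR_ge0// ler_expR ler_wpM2l ?(ltW t0)//.
  by rewrite (le_trans (ler_norm _))// (le_trans (normr_cosmass_le _ _))// massE.
have -> : cosint phi x = expR (- (t * lam)) * cosint (fun xi => u xi * expR (t * cosmass nur xi)) x.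
  rewrite phiE /cosint -RintegralZl//; last exact: integrable_cosint.
  by apply: eq_Rintegral => xi _; rewrite -mulrA.
have ball_outer : eball x (e * h) `<=` D.
  by apply: eball_sub_outer; rewrite -mulrDl.
have mball := measurable_eball x (e * h).
have ball_mass : nur (eball x (e * h)) = nu (eball x (e * h)).
  by exact: (congr1 nu (setIidl ball_outer)).
have mx1 : measurable_fun setT (fun y : 'rV[R]_d => cosint u (x + y)).
  rewrite (_ : (fun y => _) = cosint u \o (fun y : 'rV[R]_d => y - - x)).
    exact: (measurableT_comp mcosint_u (measurable_addl (- x))).
  by apply/funext => y /=; rewrite opprK addrC.
have mx2 : measurable_fun setT (fun y : 'rV[R]_d => cosint u (x - y)).
  rewrite (_ : (fun y => _) = cosint u \o ((fun y : 'rV[R]_d => - y) \o (fun y : 'rV[R]_d => y - x))).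
    apply: (measurableT_comp mcosint_u).
    exact: (measurableT_comp (@measurable_oppr R d) (measurable_addl x)).
  by apply/funext => y /=; rewrite opprB.
pose I := \int[leb]_xi `|u xi|.
have main : vol_const R d / 4 * h ^- d * fine (nu (eball x (e * h))) <=
    cosint (fun xi => u xi * cosmass nur xi) x.
  rewrite cosint_cosmass// -ball_mass.
  have -> : fine (nur (eball x (e * h))) = \int[nur]_y \1_(eball x (e * h)) y.
    by rewrite /Rintegral integral_indic// setIT.
  have i1 : nur.-integrable setT (fun y => (\1_(eball x (e * h)) y)%:E).
    exact: integrable_indic.
  rewrite -RintegralZl//; apply: le_Rintegral => //.
  - exact: integrable_cmul.
  - apply: (@integrable_bounded _ _ _ nur (fun y => (cosint u (x + y) + cosint u (x - y)) / 2) I).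
      by apply: measurable_funM => //; exact: measurable_funD.
    move=> y; rewrite normrM [X in _ * X]ger0_norm// ler_pdivrMr// mulr2n mulrDr mulr1.
    by rewrite (le_trans (ler_normD _ _))// lerD// normr_cosint_le.
  - move=> y _; have g1 := posdef_u (x + y); have g2 := posdef_u (x - y).
    rewrite indicE; case: (boolP (y \in _)) => [|_]; last first.
      by rewrite mulr0 divr_ge0// addr_ge0.
    rewrite inE /eball /= => yx; rewrite mulr1.
    (* Only the translate by -y is estimated; the one by +y is nonnegative and dropped, so half of
       the near bound remains. *)
    have : vol_const R d / 2 * h ^- d <= cosint u (x - y).
      apply: cosint_u_near; rewrite -opprB enormN (le_trans (ltW yx))//.
      by rewrite ler_wpM2r// ltW.
    set c := vol_const R d; set hd := h ^- d; lra.
have exp_ge : t * cosint (fun xi => u xi * cosmass nur xi) x <=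
    cosint (fun xi => u xi * expR (t * cosmass nur xi)) x.
  apply: le_trans (cosint_expR_ge nur (ltW t0) x iu posdef_u).
  by rewrite lerDr; exact: posdef_u.
have LE : expR (- L) <= expR (- (t * lam)) by rewrite ler_expR lerN2.
have hd0 : 0 <= vol_const R d / 4 * h ^- d * fine (nu (eball x (e * h))).
  rewrite mulr_ge0 ?fine_ge0// mulr_ge0 ?invr_ge0 ?exprn_ge0 ?(ltW h0)//.
  by rewrite divr_ge0// ltW// vol_const_gt0.
rewrite (_ : expR (- L) * t * _ * _ * fine _ = expR (- L) * (t * (vol_const R d / 4 * h ^- d * fine (nu (eball x (e * h)))))); last by rewrite !mulrA.
apply: ler_pM => //.
  by rewrite mulr_ge0// ltW.
by apply: le_trans exp_ge; rewrite ler_wpM2l// ltW.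
Qed.

End transition_density.

Unset Implicit Arguments.
Set Strict Implicit.

Theorem theorem2 (R : realType) (d : nat) (d_ge1 : (1 <= d)%N) (b : 'rV[R]_d)
  (nu : {measure set 'rV[R]_d -> \bar R})
  (nu_levy : levy_measure nu)
  (nu_sym : symmetric_measure nu)
  (nu_infty : nu [set: 'rV[R]_d] = +oo%E)
  (P : R -> probability 'rV[R]_d R)
  (P_semigroup : levy_semigroup nu b P)
  (T : set R) (T_pos : T `<=` [set t | 0 < t])
  (M3 : R) (M3_gt0 : 0 < M3)
  (integrability : forall t : R, T t ->
    (\int[lebesgue_rV R d]_xi
       (expR (- (t * complex.Re (levy_exponent nu b xi))) * enorm xi)%:E
     <= (M3 * (levy_h nu b t) ^- d.+1)%:E)%E)
  (M4 : R) (M4_gt0 : 0 < M4)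
  (A : set 'rV[R]_d) (A_borel : measurable A)
  (gamma : R) (gamma_ge0 : 0 <= gamma) (gamma_led : gamma <= d%:R)
  (f : R -> R) (f_ge0 : forall s : R, 0 < s -> 0 <= f s)
  (nu_ball : forall (x : 'rV[R]_d) (r : R), A x -> 0 < r ->
    ((M4 * r `^ gamma * f (enorm x + r))%:E <= nu (eball x r))%E) :
  exists C4 C5 C6 : R,
    [/\ 0 < C4, 0 < C5, C5 < C6 &
    [/\ (forall (x : 'rV[R]_d) (t : R), T t -> enorm x < C6 * levy_h nu b t ->
           C4 * (levy_h nu b t) ^- d <= density (P t) (x + t *: b)),
        (forall (x : 'rV[R]_d) (t : R), T t -> C6 * levy_h nu b t <= enorm x -> A x ->
           C4 * t * (levy_h nu b t) `^ (gamma - d%:R)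
             * f (enorm x + C5 * levy_h nu b t)
           <= density (P t) (x + t *: b)) &
        (forall f0 : \bar R, (0 <= f0)%E -> forall (x : 'rV[R]_d) (t : R), A x -> T t ->
           ((C4 * (levy_h nu b t) ^- d)%:E *
              Order.min 1
                ((t * (levy_h nu b t) `^ gamma)%:E *
                 extend0 f f0
                   (Num.min (enorm x + C5 * levy_h nu b t) (2 * enorm x))%R)
            <= (density (P t) (x + t *: b))%:E)%E)]].
Proof.
pose psi := jump_exponent nu setT.
have int_le t : T t -> (\int[lebesgue_rV R d]_xi (expR (- (t * psi xi)) * enorm xi)%:E
     <= (M3 * (levy_h nu b t) ^- d.+1)%:E)%E.
  move=> /integrability; apply: le_trans; rewrite le_eqVlt; apply/orP; left; apply/eqP.
  by apply: eq_integral => xi _; rewrite Re_levy_exponent.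
have h_gt0 t : T t -> 0 < levy_h nu b t.
  move=> Tt; exact: (levy_h_gt0 nu_levy d_ge1 (ltW (T_pos _ Tt)) (int_le _ Tt)).
pose c0 := vol_const R d; have c0_gt0 : 0 < c0 by exact: vol_const_gt0.
pose k1 := c0 / (2 * M3); have k1_gt0 : 0 < k1 by rewrite divr_gt0// mulr_gt0.
(* [k1 * h] is the radius of the near estimate; cutting jumps at half of it leaves room for the ball
   of radius [C5 * h]. *)
pose a := k1 / 2; have a_gt0 : 0 < a by rewrite divr_gt0.
(* Chosen so that [s = x0 / h] and [r = a * h] satisfy the requirement of [outer_mass_le] with
   equality. *)
pose x0 := 2 * d.+1%:R / a.
have x0_gt0 : 0 < x0 by rewrite divr_gt0// mulr_gt0.
have [k x0k] : exists k : nat, x0 < 2 ^+ k.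
  exists (Num.bound x0); apply: lt_trans (archi_boundP (ltW x0_gt0)) _.
  by rewrite -natrX ltr_nat ltn_expl.
(* [k] doublings cover the frequencies up to x0 / h and cost the factor 4^k over 1 / t;
   [outer_mass_le] adds the factor 2 d. *)
pose L : R := 2 * d%:R * 4 ^+ k.
have L_ge0 : 0 <= L by rewrite mulr_ge0 ?exprn_ge0// mulr_ge0.
have tail t : T t -> t * fine (nu (outer (a * levy_h nu b t))) <= L.
  move=> Tt; have t0 := T_pos _ Tt; have h0 := h_gt0 _ Tt.
  set h := levy_h nu b t in h0 *.
  have s0 : 0 < x0 * h^-1 by apply: divr_gt0.
  suff : fine (nu (outer (a * h))) <= 2 * d%:R * (4 ^+ k * t^-1).
    by rewrite mulrA ler_pdivlMr// mulrC.
  apply: (outer_mass_le nu_levy (mulr_gt0 a_gt0 h0) s0).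
    rewrite /x0 le_eqVlt; apply/orP; left; apply/eqP; field.
    by rewrite ?(gt_eqF a_gt0) ?(gt_eqF h0) ?andbT.
  move=> i u /andP[u0 us]; apply: (jump_exponent_le_h_double nu_levy h0).
  rewrite enormZ ger0_norm//.
  have -> : enorm (delta_mx ord0 i : 'rV[R]_d) = 1.
    by rewrite /enorm dot_delta mxE !eqxx sqrtr1.
  by rewrite mulr1 (le_lt_trans us)// ltr_pM2r// invr_gt0.
pose k2 := c0 / (2 * (expR (2 * L) * M3)).
have eM_gt0 : 0 < expR (2 * L) * M3 by exact: mulr_gt0 (expR_gt0 _) M3_gt0.
have k2_gt0 : 0 < k2 by apply: divr_gt0 => //; exact: mulr_gt0.
have k21 : k2 <= k1.
  rewrite ler_pM2l// lef_pV2 ?posrE; [|exact: mulr_gt0|exact: mulr_gt0].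
  rewrite ler_pM2l// ler_peMl ?(ltW M3_gt0)// -expR0 ler_expR; exact: mulr_ge0.
(* C5 <= k2 is what the far estimate asks, and k2 <= k1 gives C6 <= 3 k1 / 4, inside the near
   region. *)
pose C5 := k2 / 4; pose C6 := a + C5.
have C5_gt0 : 0 < C5 by rewrite divr_gt0.
have C6k1 : C6 <= k1 by rewrite /C6 /C5 /a; lra.
pose tp : R := ((2 * pi) ^+ d)^-1.
have tp_gt0 : 0 < tp by rewrite invr_gt0 exprn_gt0// mulr_gt0// pi_gt0.
(* The smaller of the two constants, near and far; [C5] to the power gamma comes from the radius
   [C5 * h] in the lower bound on [nu]. *)
pose m := Num.min (c0 / 2) (expR (- L) * (c0 / 4) * M4 * C5 `^ gamma).
have c04 : 0 < c0 / 4 by exact: divr_gt0.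
have m_gt0 : 0 < m.
  rewrite lt_min; apply/andP; split; first exact: divr_gt0.
  apply: mulr_gt0; last exact: powR_gt0.
  by apply: mulr_gt0 => //; apply: mulr_gt0 => //; exact: expR_gt0.
pose C4 := tp * m; have C4_gt0 : 0 < C4 by rewrite mulr_gt0.
have near x t : T t -> enorm x < C6 * levy_h nu b t ->
    C4 * levy_h nu b t ^- d <= density (P t) (x + t *: b).
  move=> Tt xh; have t0 := T_pos _ Tt; have h0 := h_gt0 _ Tt.
  rewrite (densityE_cosint nu_levy nu_sym P_semigroup t0 (int_le _ Tt)).
  rewrite /C4 -mulrA ler_pM2l//.
  apply: le_trans (transition_density_near nu_levy d_ge1 t0 M3_gt0 (int_le _ Tt) _).
    by rewrite ler_wpM2r ?invr_ge0 ?exprn_ge0 ?(ltW h0)// ge_min lexx.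
  by rewrite (le_trans (ltW xh))// ler_wpM2r// ltW.
have far x t : T t -> C6 * levy_h nu b t <= enorm x -> A x ->
    C4 * t * levy_h nu b t `^ (gamma - d%:R) * f (enorm x + C5 * levy_h nu b t)
      <= density (P t) (x + t *: b).
  move=> Tt xh Ax; have t0 := T_pos _ Tt; have h0 := h_gt0 _ Tt.
  rewrite (densityE_cosint nu_levy nu_sym P_semigroup t0 (int_le _ Tt)).
  have e0 : 0 < C5 * levy_h nu b t by rewrite mulr_gt0.
  apply: le_trans (ler_wpM2l (ltW tp_gt0)
    (transition_density_far nu_levy d_ge1 t0 M3_gt0 (int_le _ Tt) a_gt0 (tail _ Tt) (e := C5) _ xh)); last first.
    by rewrite -/c0 -/k2 /C5; lra.
  have ball_outer : eball x (C5 * levy_h nu b t) `<=` outer (a * levy_h nu b t).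
    by apply: eball_sub_outer; rewrite -mulrDl.
  (* Finiteness of this mass lets the lower bound on [nu] be read as an inequality between reals. *)
  have ball_lty : (nu (eball x (C5 * levy_h nu b t)) < +oo)%E.
    apply: le_lt_trans (levy_outer_lty nu_levy (mulr_gt0 a_gt0 h0)).
    by apply: le_measure ball_outer; rewrite inE; [exact: measurable_eball|exact: measurable_outer].
  have := nu_ball x _ Ax e0.
  rewrite -[nu _]fineK ?ge0_fin_numE// lee_fin.
  rewrite powRM ?(ltW C5_gt0) ?(ltW h0)//.
  have -> : levy_h nu b t `^ (gamma - d%:R) = levy_h nu b t `^ gamma * levy_h nu b t ^- d.
    by rewrite powRB ?powR_mulrn ?(ltW h0) ?(gt_eqF h0) ?implybT.
  set h := levy_h nu b t; set F := f _; set B := fine _; set hg := h `^ gamma; set hd := h ^- d.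
  move=> FB.
  have F0 : 0 <= F by apply: f_ge0; rewrite ltr_wpDl ?enorm_ge0.
  have hd0 : 0 < hd by rewrite invr_gt0 exprn_gt0.
  have hg0 : 0 <= hg by exact: powR_ge0.
  have mle : m <= expR (- L) * (c0 / 4) * M4 * C5 `^ gamma by rewrite ge_min lexx orbT.
  have G0 : 0 <= t * hd * hg * F by rewrite !mulr_ge0// ltW.
  have H0 : 0 <= expR (- L) * t * (c0 / 4) * hd.
    by rewrite !mulr_ge0 ?expR_ge0 ?(ltW t0) ?(ltW hd0)// divr_ge0// ltW.
  apply: (@le_trans _ _ (tp * (expR (- L) * t * (c0 / 4) * hd * (M4 * (C5 `^ gamma * hg) * F)))).
    rewrite /C4 (_ : tp * m * t * (hg * hd) * F = tp * (m * (t * hd * hg * F))); last by ring.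
    apply: le_trans (ler_wpM2l (ltW tp_gt0) (ler_wpM2r G0 mle)) _.
    by rewrite le_eqVlt; apply/orP; left; apply/eqP; ring.
  by rewrite ler_wpM2l ?(ltW tp_gt0)// ler_wpM2l.
exists C4, C5, C6; split=> //; first by rewrite /C6 ltrDr.
split=> //.
move=> f0 f0_ge0 x t Ax Tt; have t0 := T_pos _ Tt; have h0 := h_gt0 _ Tt.
have h_hd : 0 <= C4 * levy_h nu b t ^- d.
  by rewrite mulr_ge0 ?(ltW C4_gt0)// invr_ge0 exprn_ge0// ltW.
(* In the near region the minimum is bounded by 1, whatever value [f0] has. *)
have [xh|xh] := ltP (enorm x) (C6 * levy_h nu b t).
  apply: (@le_trans _ _ ((C4 * levy_h nu b t ^- d)%:E * 1)%E).
    by rewrite lee_wpmul2l ?lee_fin// ge_min lexx.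
  by rewrite mule1 lee_fin; exact: near.
have C5x : C5 * levy_h nu b t <= enorm x.
  by rewrite (le_trans _ xh)// ler_wpM2r ?(ltW h0)// /C6 lerDr ltW.
have e0 : 0 < C5 * levy_h nu b t by rewrite mulr_gt0.
(* Since |x| >= C6 h > C5 h, the first argument is the smaller one; it is positive, so [extend0]
   returns the value of [f]. *)
have -> : Num.min (enorm x + C5 * levy_h nu b t) (2 * enorm x) = enorm x + C5 * levy_h nu b t.
  by apply: min_l; move: C5x; set q := C5 * _; lra.
rewrite /extend0 gt_eqF; last by rewrite ltr_wpDl ?enorm_ge0.
apply: (@le_trans _ _ ((C4 * levy_h nu b t ^- d)%:E * ((t * levy_h nu b t `^ gamma)%:E *
    (f (enorm x + C5 * levy_h nu b t))%:E))%E).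
  by rewrite lee_wpmul2l ?lee_fin// ge_min lexx orbT.
rewrite -!EFinM lee_fin; apply: le_trans (far _ _ Tt xh Ax).
rewrite powRB ?powR_mulrn ?(ltW h0) ?(gt_eqF h0) ?implybT//.
by rewrite le_eqVlt; apply/orP; left; apply/eqP; ring.
Qed.
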